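(* Let $K\subset H$ be Hopf algebras with invertible antipode over a field $k$, $K$ a Hopf subalgebra of $H$, such that $H$ is faithfully flat as a left $K$-module, and let $\overline H=H/HK^+$. Let $A$ and $B$ be right faithfully flat right $H$-Galois extensions, connected by a strict $H$-Morita context $(A,B,M,N,\alpha,\beta)$. (1) $A^{{\rm co}\overline H}$ and $B^{{\rm co}\overline H}$ are connected by a strict $K$-Morita context, with connecting modules $M^{{\rm co}\overline H}$ and $N^{{\rm co}\overline H}$. (2) $(M\otimes_B-,\ N\otimes_A-)$ is a pair of inverse equivalences between the categories ${}_B\mathcal{M}(H)^{\overline H}$ and ${}_A\mathcal{M}(H)^{\overline H}$. (3) The square formed by the horizontal functors $N\otimes_A-:{}_A\mathcal{M}(H)^{\overline H}\rightleftarrows{}_B\mathcal{M}(H)^{\overline H}:M\otimes_B-$ and $N^{{\rm co}\overline H}\otimes_{A^{{\rm co}\overline H}}-:{}_{A^{{\rm co}\overline H}}\mathcal{M}\rightleftarrows{}_{B^{{\rm co}\overline H}}\mathcal{M}:M^{{\rm co}\overline H}\otimes_{B^{{\rm co}\overline H}}-$, and the vertical functors $(-)^{{\rm co}\overline H}:{}_A\mathcal{M}(H)^{\overline H}\rightleftarrows{}_{A^{{\rm co}\overline H}}\mathcal{M}:A\otimes_{A^{{\rm co}\overline H}}-$ and $(-)^{{\rm co}\overline H}:{}_B\mathcal{M}(H)^{\overline H}\rightleftarrows{}_{B^{{\rm co}\overline H}}\mathcal{M}:B\otimes_{B^{{\rm co}\overline H}}-$, commutes up to natural equivalence of functors; that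 is, there are natural isomorphisms $$(N\otimes_AU)^{{\rm co}\overline H}\cong N^{{\rm co}\overline H}\otimes_{A^{{\rm co}\overline H}}U^{{\rm co}\overline H},\qquad(M\otimes_BV)^{{\rm co}\overline H}\cong M^{{\rm co}\overline H}\otimes_{B^{{\rm co}\overline H}}V^{{\rm co}\overline H},$$ $$N\otimes_AA\otimes_{A^{{\rm co}\overline H}}Q\cong B\otimes_{B^{{\rm co}\overline H}}N^{{\rm co}\overline H}\otimes_{A^{{\rm co}\overline H}}Q,\qquad M\otimes_BB\otimes_{B^{{\rm co}\overline H}}P\cong A\otimes_{A^{{\rm co}\overline H}}M^{{\rm co}\overline H}\otimes_{B^{{\rm co}\overline H}}P$$ for $U\in{}_A\mathcal{M}(H)^{\overline H}$, $V\in{}_B\mathcal{M}(H)^{\overline H}$, $Q\in{}_{A^{{\rm co}\overline H}}\mathcal{M}$, $P\in{}_{B^{{\rm co}\overline H}}\mathcal{M}$.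
   Context: $\otimes=\otimes_k$; right coactions $\rho(m)=m_{[0]}\otimes m_{[1]}$; $M^{{\rm co}H}=\{m\mid\rho(m)=m\otimes1\}$. A right $H$-comodule algebra $A$ is a right faithfully flat $H$-Galois extension (of $A^{{\rm co}H}$) if $A$ is faithfully flat as a right $A^{{\rm co}H}$-module and ${\rm can}':A\otimes_{A^{{\rm co}H}}A\to A\otimes H$, ${\rm can}'(a\otimes b)=a_{[0]}b\otimes a_{[1]}$, is bijective (equivalently ${\rm can}(a\otimes b)=ab_{[0]}\otimes b_{[1]}$ is bijective). For right $H$-comodule algebras $A,B$, ${}_A\mathcal{M}_B^H$ is the category of $(A,B)$-bimodules with right $H$-coaction satisfying $\rho(amb)=a_{[0]}m_{[0]}b_{[0]}\otimes a_{[1]}m_{[1]}b_{[1]}$, with bilinear $H$-colinear maps; $M\otimes_BN$ carries the coaction $m_{[0]}\otimes n_{[0]}\otimes m_{[1]}n_{[1]}$. An $H$-Morita context connecting $A$ and $B$ is $(A,B,M,N,\alpha,\beta)$ with connecting modules $M\in{}_A\mathcal{M}_B^H$, $N\in{}_B\mathcal{M}_A^H$, and morphisms $\alpha:M\otimes_BN\to A$ in ${}_A\mathcal{M}_A^H$, $\beta:N\otimes_AM\to B$ in ${}_B\mathcal{M}_B^H$ with $\alpha(m\otimes n)m'=m\beta(n\otimes m')$ and $\beta(n\otimes m)n'=n\alpha(m\otimes n')$; it is strict if $\alpha,\beta$ are isomorphisms. $K$-Morita contexts are defined in the same way with $K$ in place of $H$. $K^+=\ker(\varepsilon_K)$; $\overline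 H=H/HK^+\cong H\otimes_Kk$ is a left $H$-module coalgebra with $h\cdot\overline l=\overline{hl}$, $\Delta(\overline h)=\overline{h_{(1)}}\otimes\overline{h_{(2)}}$, $\varepsilon(\overline h)=\varepsilon(h)$. A right $H$-comodule $M$ is a right $\overline H$-comodule via $m\mapsto m_{[0]}\otimes\overline{m_{[1]}}$. For a right $\overline H$-comodule $M$, $M^{{\rm co}\overline H}=\{m\mid\rho_{\overline H}(m)=m\otimes\overline1\}$. For $M\in\mathcal{M}^H$, $M^{{\rm co}\overline H}=\{m\mid\rho(m)\in M\otimes K\}$, which is a right $K$-comodule; $A^{{\rm co}\overline H}$ is a right $K$-comodule algebra. ${}_A\mathcal{M}(H)^{\overline H}$ is the category of $k$-modules $U$ with a left $A$-action and a right $\overline H$-coaction satisfying $\rho(au)=a_{[0]}u_{[0]}\otimes a_{[1]}\cdot u_{[1]}$, with $A$-linear $\overline H$-colinear maps. For $V\in{}_B\mathcal{M}(H)^{\overline H}$, $M\otimes_BV\in{}_A\mathcal{M}(H)^{\overline H}$ with coaction $m\otimes v\mapsto m_{[0]}\otimes v_{[0]}\otimes m_{[1]}\cdot v_{[1]}$, and similarly for $N\otimes_A-$. $A\otimes_{A^{{\rm co}\overline H}}Q$ has the coaction induced by that on $A$. *)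

(* Defs.v *)
From HB Require Import structures.
From mathcomp Require Import all_boot all_algebra.
From mathcomp Require Import boolp.
From mathcomp Require Import freeg.
Set Implicit Arguments. Unset Strict Implicit. Unset Printing Implicit Defensive.
Import GRing.Theory.
Local Open Scope ring_scope.
Local Open Scope quotient_scope.

Section Linear.
Variables (k : fieldType) (V W : lmodType k) (f : V -> W).
Hypothesis fL : linear f.

Lemma lin0 : f 0 = 0.
Proof. by have := fL (-1) 0 0; rewrite !scaleN1r oppr0 addr0 addNr. Qed.
Lemma linD x y : f (x + y) = f x + f y.
Proof. by rewrite -[x]scale1r fL !scale1r. Qed.
Lemma linZ a x : f (a *: x) = a *: f x.
Proof. by rewrite -[a *: x]addr0 fL lin0 addr0. Qed.
Lemma linN x : f (- x) = - f x.
Proof. by rewrite -scaleN1r linZ scaleN1r. Qed.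
End Linear.

(* [quot S] is the quotient of V by the subspace spanned by S. *)
Section Quot.
Variables (k : fieldType) (V : lmodType k) (S : V -> Prop).

Inductive kspan : V -> Prop :=
| kspan_zero : kspan 0
| kspan_cons a u v : S u -> kspan v -> kspan (a *: u + v).

Lemma kspan_lin a u v : kspan u -> kspan v -> kspan (a *: u + v).
Proof.
move=> + Sv; elim=> [|b w w' Sw _ IH]; first by rewrite scaler0 add0r.
by rewrite scalerDr scalerA -addrA; apply: kspan_cons.
Qed.

Lemma kspan_gen u : S u -> kspan u.
Proof.
move=> Su; rewrite -[u]addr0 -[u]scale1r.
by apply: kspan_cons => //; apply: kspan_zero.
Qed.

Definition quot_rel (x y : V) : bool := `[< kspan (x - y) >].

Lemma quot_rel_refl : reflexive quot_rel.
Proof. by move=> x; apply/asboolP; rewrite subrr; apply: kspan_zero. Qed.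

Lemma quot_rel_sym : symmetric quot_rel.
Proof.
suff s x y : quot_rel x y -> quot_rel y x by move=> x y; apply/idP/idP; apply: s.
move=> /asboolP Sxy; apply/asboolP.
by rewrite -opprB -scaleN1r -[_ *: _]addr0; apply: kspan_lin => //; apply: kspan_zero.
Qed.

Lemma quot_rel_trans : transitive quot_rel.
Proof.
move=> y x z /asboolP Sxy /asboolP Syz; apply/asboolP.
by rewrite -[x](subrK y) -addrA -[x - y]scale1r; apply: kspan_lin.
Qed.

Canonical quot_equiv :=
  EquivRel quot_rel quot_rel_refl quot_rel_sym quot_rel_trans.

Definition quot := {eq_quot quot_rel}.
HB.instance Definition _ := Choice.on quot.
HB.instance Definition _ := EqQuotient.on quot.

Definition qproj (v : V) : quot := \pi_quot v.

Lemma qprojP v w : qproj v = qproj w <-> kspan (v - w).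
Proof.
split=> [/eqmodP /asboolP //|Svw]; by apply/eqmodP/asboolP.
Qed.

Lemma quotK q : qproj (repr q) = q.
Proof. exact: reprK. Qed.

Lemma qprojE v : kspan (repr (qproj v) - v).
Proof. by apply/qprojP; rewrite quotK. Qed.

Definition quot_add (x y : quot) := qproj (repr x + repr y).
Definition quot_opp (x : quot) := qproj (- repr x).
Definition quot_scale (a : k) (x : quot) := qproj (a *: repr x).

Lemma qprojD u v : qproj (u + v) = quot_add (qproj u) (qproj v).
Proof.
apply/esym/qprojP; rewrite opprD addrACA -[_ - u]scale1r.
by apply: kspan_lin; apply: qprojE.
Qed.
Lemma qprojZ a v : qproj (a *: v) = quot_scale a (qproj v).
Proof.
apply/esym/qprojP; rewrite -scalerBr -[_ *: _]addr0.
by apply: kspan_lin; [apply: qprojE | apply: kspan_zero].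
Qed.
Lemma qprojN v : qproj (- v) = quot_opp (qproj v).
Proof. by rewrite -scaleN1r qprojZ /quot_opp /quot_scale scaleN1r. Qed.

Lemma quotP (P : quot -> Prop) : (forall v, P (qproj v)) -> forall q, P q.
Proof. by move=> Pq q; rewrite -(quotK q). Qed.

Lemma quot_addA : associative quot_add.
Proof.
by elim/quotP=> x; elim/quotP=> y; elim/quotP=> z; rewrite -!qprojD addrA.
Qed.
Lemma quot_addC : commutative quot_add.
Proof. by elim/quotP=> x; elim/quotP=> y; rewrite -!qprojD addrC. Qed.
Lemma quot_add0 : left_id (qproj 0) quot_add.
Proof. by elim/quotP=> x; rewrite -!qprojD add0r. Qed.
Lemma quot_addN : left_inverse (qproj 0) quot_opp quot_add.
Proof. by elim/quotP=> x; rewrite -qprojN -qprojD addNr. Qed.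
HB.instance Definition _ :=
  GRing.isZmodule.Build quot quot_addA quot_addC quot_add0 quot_addN.

Lemma quot_scaleA a b x : quot_scale a (quot_scale b x) = quot_scale (a * b) x.
Proof. by elim/quotP: x => x; rewrite -!qprojZ scalerA. Qed.
Lemma quot_scale1 : left_id 1 quot_scale.
Proof. by elim/quotP=> x; rewrite -qprojZ scale1r. Qed.
Lemma quot_scaleDr : right_distributive quot_scale +%R.
Proof.
move=> a; elim/quotP=> x; elim/quotP=> y; rewrite -[_ + _]qprojD -!qprojZ.
by rewrite scalerDr qprojD.
Qed.
Lemma quot_scaleDl v : {morph quot_scale^~ v : a b / a + b}.
Proof. by move=> a b; elim/quotP: v => x; rewrite -!qprojZ scalerDl qprojD. Qed.
HB.instance Definition _ := GRing.Zmodule_isLmodule.Build k quot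
  quot_scaleA quot_scale1 quot_scaleDr quot_scaleDl.

Lemma qproj_linear : linear qproj.
Proof. by move=> a u v; rewrite qprojD qprojZ. Qed.
HB.instance Definition _ := GRing.isLinear.Build k V quot *:%R qproj qproj_linear.

(* Meaningful only if f is linear and kills S, see [quot_liftE]. *)
Definition quot_lift (W : lmodType k) (f : V -> W) (q : quot) : W := f (repr q).

Lemma quot_liftE (W : lmodType k) (f : V -> W) :
  linear f -> (forall s, S s -> f s = 0) ->
  forall v, quot_lift f (qproj v) = f v.
Proof.
move=> fL fS v; rewrite /quot_lift.
have fsp w : kspan w -> f w = 0.
  elim=> [|a x y Sx _ fy]; first exact: lin0 fL.
  by rewrite fL fS // fy scaler0 addr0.
by rewrite -[repr _](subrK v) (linD fL) fsp ?add0r //; apply: qprojE.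
Qed.

Lemma quot_lift_linear (W : lmodType k) (f : V -> W) :
  linear f -> (forall s, S s -> f s = 0) -> linear (quot_lift f).
Proof.
move=> fL fS a; elim/quotP=> x; elim/quotP=> y.
by rewrite -qproj_linear !quot_liftE //; apply: fL.
Qed.
End Quot.

(* The tensor product over R of M (with right action ra) and N (with left
   action la), as a quotient of the free vector space on M * N.  All modules
   over k-algebras are carried by k-spaces; since k maps to the centre of the
   algebras, this is no restriction on the modules, and linear maps over a
   k-algebra are k-linear. *)
Section Tensor.
Variables (k : fieldType) (R : Type) (M N : lmodType k).
Variables (ra : M -> R -> M) (la : R -> N -> N).

Let g (m : M) (n : N) : {freeg (M * N)%type / k} := << (m, n) >>.

Inductive tens_rel : {freeg (M * N)%type / k} -> Prop :=
| tens_rel_l a m m' n : tens_rel (g (a *: m + m') n - (a *: g m n + g m' n))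
| tens_rel_r a m n n' : tens_rel (g m (a *: n + n') - (a *: g m n + g m n'))
| tens_rel_bal m r n : tens_rel (g (ra m r) n - g m (la r n)).

Definition tens := quot tens_rel.
HB.instance Definition _ := GRing.Lmodule.on tens.

Definition pure (m : M) (n : N) : tens := qproj tens_rel (g m n).

Definition bilin (P : lmodType k) (f : M -> N -> P) : Prop :=
  (forall n, linear (f^~ n)) /\ (forall m, linear (f m)).

Definition balanced (P : Type) (f : M -> N -> P) : Prop :=
  forall m r n, f (ra m r) n = f m (la r n).

(* The map induced by f; meaningful only if f is bilinear and balanced, see
   [tliftE]. *)
Definition tlift (P : lmodType k) (f : M -> N -> P) : tens -> P :=
  quot_lift (fglift (fun mn : M * N => f mn.1 mn.2)).

Lemma pure_bilin : bilin pure.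
Proof.
split=> [n|m] a x y; rewrite /pure -qproj_linear; apply/qprojP/kspan_gen.
  exact: tens_rel_l.
exact: tens_rel_r.
Qed.

Lemma pure_balanced : balanced pure.
Proof. by move=> m r n; apply/qprojP/kspan_gen; apply: tens_rel_bal. Qed.

Lemma fglift_linear (K : choiceType) (P : lmodType k) (f : K -> P) :
  linear (fglift f).
Proof.
have fA D D' : fglift f (D - D') = fglift f D - fglift f D'.
  exact: lift_is_additive.
have f0 : fglift f 0 = 0 by rewrite -(subrr 0) fA subrr.
have fD D D' : fglift f (D + D') = fglift f D + fglift f D'.
  by rewrite -{1}[D']opprK fA -[- D']sub0r fA f0 sub0r opprK.
have fS (I : Type) (s : seq I) F :
    fglift f (\sum_(i <- s) F i) = \sum_(i <- s) fglift f (F i).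
  exact: (big_morph _ fD f0).
move=> a u v; rewrite fD; congr (_ + _).
rewrite -{2}[u]freeg_sumE !fS scaler_sumr.
by apply: eq_bigr => z _; rewrite !liftU scalerA.
Qed.

Section Lift.
Variables (P : lmodType k) (f : M -> N -> P).
Hypotheses (fL : bilin f) (fB : balanced f).

Let f0 D : tens_rel D -> fglift (fun mn : M * N => f mn.1 mn.2) D = 0.
Proof.
have L := @fglift_linear _ P (fun mn : M * N => f mn.1 mn.2).
case=> [a m m' n|a m n n'|m r n]; rewrite (linD L) (linN L) ?L /g !liftU /= !scale1r.
- by rewrite fL.1 subrr.
- by rewrite fL.2 subrr.
- by rewrite fB subrr.
Qed.

Lemma tliftE m n : tlift f (pure m n) = f m n.
Proof.
by rewrite /tlift /pure quot_liftE ?liftU ?scale1r //; apply: fglift_linear.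
Qed.

Lemma tlift_linear : linear (tlift f).
Proof. by apply: quot_lift_linear => //; apply: fglift_linear. Qed.

End Lift.

Lemma tens_ind (Q : tens -> Prop) :
  Q 0 -> (forall x y, Q x -> Q y -> Q (x + y)) ->
  (forall m n, Q (pure m n)) -> forall x, Q x.
Proof.
move=> Q0 QD Qp; elim/quotP => D.
have L := @qproj_linear _ _ tens_rel.
rewrite -[D]freeg_sumE; elim: (dom D) => [|[m n] s IH]; first by rewrite big_nil (lin0 L).
rewrite big_cons (linD L); apply: QD => //.
suff -> : << coeff (m, n) D *g (m, n) >> = coeff (m, n) D *: g m n :> {freeg (M * N)%type / k}.
  by rewrite (linZ L) -[_ *: _](linZ (pure_bilin.1 n)).
by apply/eqP/freeg_eqP => z; rewrite coeffZ !coeffU mul1r.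
Qed.

Lemma tens_ext (P : lmodType k) (f f' : tens -> P) : linear f -> linear f' ->
  (forall m n, f (pure m n) = f' (pure m n)) -> f =1 f'.
Proof.
move=> fL fL' e; elim/tens_ind => [|x y ex ey|//]; first by rewrite !lin0.
by rewrite (linD fL) (linD fL') ex ey.
Qed.

End Tensor.

(* Tensor products over k are the case R := k. *)
Definition rscale (k : fieldType) (M : lmodType k) (m : M) (a : k) : M := a *: m.
Definition lscale (k : fieldType) (N : lmodType k) (a : k) (n : N) : N := a *: n.

Notation "M ⊗ N" := (tens (@rscale _ M%type) (@lscale _ N%type))
  (at level 40, left associativity) : type_scope.
Notation "m ⊗ n" := (pure (@rscale _ _) (@lscale _ _) m n)
  (at level 40, left associativity) : ring_scope.

Section TensorK.
Variable k : fieldType.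
Implicit Types M N P Q U V W : lmodType k.

Lemma bilin_balanced M N P (f : M -> N -> P) :
  bilin f -> balanced (@rscale _ M) (@lscale _ N) f.
Proof.
by move=> [fl fr] m a n; rewrite /rscale /lscale (linZ (fl n)) (linZ (fr m)).
Qed.

Lemma kliftE M N P (f : M -> N -> P) : bilin f ->
  forall m n, tlift f (m ⊗ n) = f m n.
Proof. by move=> fL m n; rewrite tliftE //; apply: bilin_balanced. Qed.

Lemma klift_linear M N P (f : M -> N -> P) : bilin f ->
  linear (tlift f : M ⊗ N -> P).
Proof. by move=> fL; apply: tlift_linear => //; apply: bilin_balanced. Qed.

Lemma kpureL M N (n : N) : linear (fun m : M => m ⊗ n).
Proof. exact: (pure_bilin _ _).1. Qed.
Lemma kpureR M N (m : M) : linear (fun n : N => m ⊗ n).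
Proof. exact: (pure_bilin _ _).2. Qed.

Definition kmap M N P Q (f : M -> P) (g : N -> Q) : M ⊗ N -> P ⊗ Q :=
  tlift (fun m n => f m ⊗ g n).

Section Kmap.
Variables (M N P Q : lmodType k) (f : M -> P) (g : N -> Q).
Hypotheses (fL : linear f) (gL : linear g).

Let kmap_bilin : bilin (fun m n => f m ⊗ g n).
Proof.
by split=> [n|m] a x y; rewrite ?fL ?gL ?kpureL ?kpureR.
Qed.

Lemma kmapE m n : kmap f g (m ⊗ n) = f m ⊗ g n.
Proof. exact: kliftE. Qed.

Lemma kmap_linear : linear (kmap f g).
Proof. exact: klift_linear. Qed.
End Kmap.

(* (m ⊗ q), (n ⊗ u) |-> f m n ⊗ g q u, see [tprodE]. *)
Definition tprod M N P Q U V (f : M -> N -> P) (g : Q -> U -> V)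
    (x : M ⊗ Q) (y : N ⊗ U) : P ⊗ V :=
  tlift (fun m q => tlift (fun n u => f m n ⊗ g q u) y) x.

Section Tprod.
Variables (M N P Q U V : lmodType k) (f : M -> N -> P) (g : Q -> U -> V).
Hypotheses (fL : bilin f) (gL : bilin g).

Let b1 m q : bilin (fun n u => f m n ⊗ g q u).
Proof. by split=> [n|u] a x y; rewrite ?fL.2 ?gL.2 ?kpureL ?kpureR. Qed.

Let b2 (y : N ⊗ U) : bilin (fun m q => tlift (fun n u => f m n ⊗ g q u) y : P ⊗ V).
Proof.
split=> [q|m] a x x'; elim/tens_ind: y => [|y y' e e'|n u].
- by rewrite !(lin0 (klift_linear (b1 _ _))) scaler0 addr0.
- by rewrite !(linD (klift_linear (b1 _ _))) e e' scalerDr addrACA.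
- by rewrite !kliftE // fL.1 kpureL.
- by rewrite !(lin0 (klift_linear (b1 _ _))) scaler0 addr0.
- by rewrite !(linD (klift_linear (b1 _ _))) e e' scalerDr addrACA.
- by rewrite !kliftE // gL.1 kpureR.
Qed.

Lemma tprodE m q n u : tprod f g (m ⊗ q) (n ⊗ u) = f m n ⊗ g q u.
Proof. by rewrite /tprod kliftE // kliftE. Qed.

Lemma tprod_bilin : bilin (tprod f g).
Proof.
have L y : linear (fun x => tprod f g x y) by exact: klift_linear.
split=> // x a y y'; elim/tens_ind: x => [|x x' e e'|m q].
- by rewrite !(lin0 (L _)) scaler0 addr0.
- by rewrite !(linD (L _)) e e' scalerDr addrACA.
- by rewrite /tprod !kliftE // (klift_linear (b1 m q)).
Qed.
End Tprod.

Definition tassoc M N P : (M ⊗ N) ⊗ P -> M ⊗ (N ⊗ P) :=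
  tlift (fun x p => kmap id (fun n => n ⊗ p) x).

Lemma tassoc_bilin M N P :
  bilin (fun (x : M ⊗ N) (p : P) => kmap id (fun n => n ⊗ p) x : M ⊗ (N ⊗ P)).
Proof.
split=> [p|x]; first by apply: kmap_linear => //; apply: kpureL.
have L p := @kmap_linear M N _ _ id _ (fun _ _ _ => erefl) (@kpureL N P p).
move=> a p p'; elim/tens_ind: x => [|x x' e e'|m n].
- by rewrite !(lin0 (L _)) scaler0 addr0.
- by rewrite !(linD (L _)) e e' scalerDr addrACA.
- by rewrite !kmapE //; try exact: kpureL; rewrite kpureR kpureR.
Qed.

Lemma tassocE M N P (m : M) (n : N) (p : P) :
  tassoc ((m ⊗ n) ⊗ p) = m ⊗ (n ⊗ p).
Proof.
rewrite /tassoc kliftE; last exact: tassoc_bilin.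
by rewrite kmapE //; apply: kpureL.
Qed.

Lemma tassoc_linear M N P : linear (@tassoc M N P).
Proof. exact/klift_linear/tassoc_bilin. Qed.

Lemma kext M N P (f f' : M ⊗ N -> P) : linear f -> linear f' ->
  (forall m n, f (m ⊗ n) = f' (m ⊗ n)) -> f =1 f'.
Proof. exact: tens_ext. Qed.

Lemma bilin_comp M N M' N' P (b : M' -> N' -> P) (f : M -> M') (g : N -> N') :
  bilin b -> linear f -> linear g -> bilin (fun m n => b (f m) (g n)).
Proof. by move=> [bl br] fL gL; split=> u a x y; rewrite ?fL ?gL ?bl ?br. Qed.

Lemma lin_bilin M N P P' (h : P -> P') (b : M -> N -> P) :
  linear h -> bilin b -> bilin (fun m n => h (b m n)).
Proof. by move=> hL [bl br]; split=> u a x y; rewrite ?bl ?br hL. Qed.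

Lemma lin_comp M N P (f : N -> P) (g : M -> N) :
  linear f -> linear g -> linear (fun x => f (g x)).
Proof. by move=> fL gL a x y; rewrite gL fL. Qed.

Lemma lin_id M : linear (@id M). Proof. by []. Qed.

Lemma kext2 M N M' N' P (F F' : M ⊗ N -> M' ⊗ N' -> P) :
  bilin F -> bilin F' ->
  (forall m n m' n', F (m ⊗ n) (m' ⊗ n') = F' (m ⊗ n) (m' ⊗ n')) ->
  forall x y, F x y = F' x y.
Proof.
move=> [Fl Fr] [Fl' Fr'] e x y.
have : F^~ y =1 F'^~ y; last exact.
apply: kext => // m n.
by have : F (m ⊗ n) =1 F' (m ⊗ n) by apply: kext.
Qed.

Lemma kext3 M N P Q (f f' : (M ⊗ N) ⊗ P -> Q) : linear f -> linear f' ->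
  (forall m n p, f ((m ⊗ n) ⊗ p) = f' ((m ⊗ n) ⊗ p)) -> f =1 f'.
Proof.
move=> fL fL' e; apply: kext => // x p.
have : (fun x => f (x ⊗ p)) =1 (fun x => f' (x ⊗ p)); last exact.
by apply: kext => // ; apply: lin_comp => //; apply: kpureL.
Qed.

End TensorK.

Section TensorLemmas.
Variable k : fieldType.
Implicit Types M N P Q U V W : lmodType k.

Lemma eq_tprod M N P Q U V (f f' : M -> N -> P) (g g' : Q -> U -> V) x y :
  f =2 f' -> g =2 g' -> tprod f g x y = tprod f' g' x y.
Proof.
move=> ef eg; congr (tprod _ _ x y); apply/funext => ?; apply/funext => ?.
  exact: ef.
exact: eg.
Qed.

Lemma eq_kmap M N P Q (f f' : M -> P) (g g' : N -> Q) x :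
  f =1 f' -> g =1 g' -> kmap f g x = kmap f' g' x.
Proof. by move=> ef eg; congr (kmap _ _ x); apply/funext. Qed.

Lemma kmap_comp M N P Q M' N' (f : P -> M') (g : Q -> N') (f' : M -> P)
    (g' : N -> Q) x : linear f -> linear g -> linear f' -> linear g' ->
  kmap f g (kmap f' g' x) = kmap (fun m => f (f' m)) (fun n => g (g' n)) x.
Proof.
move=> fL gL fL' gL'; have c1 := lin_comp fL fL'; have c2 := lin_comp gL gL'.
move: x; apply: kext => [||m n]; last by rewrite !kmapE.
  by apply: lin_comp; apply: kmap_linear.
exact: kmap_linear.
Qed.

Lemma kmap_id M N (x : M ⊗ N) : kmap id id x = x.
Proof.
move: x; apply: kext => [||m n]; last by rewrite kmapE.
  exact: kmap_linear.
by [].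
Qed.

Lemma kmap_tprod M N P Q U V P' V' (p : P -> P') (q : V -> V')
    (f : M -> N -> P) (g : Q -> U -> V) x y :
  linear p -> linear q -> bilin f -> bilin g ->
  kmap p q (tprod f g x y) =
  tprod (fun m n => p (f m n)) (fun h c => q (g h c)) x y.
Proof.
move=> pL qL fL gL; have c1 := lin_bilin pL fL; have c2 := lin_bilin qL gL.
apply: (kext2 (F := fun x y => kmap p q (tprod f g x y))).
- by apply: lin_bilin; [apply: kmap_linear | apply: tprod_bilin].
- exact: tprod_bilin.
by move=> *; rewrite !tprodE // kmapE.
Qed.

Lemma tprod_kmap M N P Q U V M' N' Q' U' (f : M -> N -> P) (g : Q -> U -> V)
    (a : M' -> M) (b : Q' -> Q) (c : N' -> N) (d : U' -> U) x y :
  bilin f -> bilin g -> linear a -> linear b -> linear c -> linear d ->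
  tprod f g (kmap a b x) (kmap c d y) =
  tprod (fun m n => f (a m) (c n)) (fun q u => g (b q) (d u)) x y.
Proof.
move=> fL gL aL bL cL dL.
have c1 := bilin_comp fL aL cL; have c2 := bilin_comp gL bL dL.
apply: (kext2 (F := fun x y => tprod f g (kmap a b x) (kmap c d y))).
- by apply: bilin_comp; [apply: tprod_bilin | apply: kmap_linear..].
- exact: tprod_bilin.
by move=> *; rewrite !kmapE // !tprodE.
Qed.

Lemma tassoc_tprod M N P M' N' P' U V W (f : M -> M' -> U) (g : N -> N' -> V)
    (h : P -> P' -> W) (x : (M ⊗ N) ⊗ P) (y : (M' ⊗ N') ⊗ P') :
  bilin f -> bilin g -> bilin h ->
  tassoc (tprod (tprod f g) h x y) =
  tprod f (tprod g h) (tassoc x) (tassoc y).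
Proof.
move=> fL gL hL; have fgL := tprod_bilin fL gL; have ghL := tprod_bilin gL hL.
have b1 : bilin (fun x y => tassoc (tprod (tprod f g) h x y)).
  by apply: lin_bilin; [apply: tassoc_linear | apply: tprod_bilin].
have b2 : bilin (fun x y => tprod f (tprod g h) (tassoc x) (tassoc y)).
  by apply: bilin_comp; [apply: tprod_bilin | apply: tassoc_linear..].
have : (fun x => tassoc (tprod (tprod f g) h x y)) =1
       (fun x => tprod f (tprod g h) (tassoc x) (tassoc y)); last exact.
apply: kext3; [exact: b1.1 | exact: b2.1 | move=> m n p].
move: y; apply: kext3; [exact: b1.2 | exact: b2.2 | move=> m' n' p'].
by rewrite !(tprodE, tassocE).
Qed.

Lemma tprod_assoc M1 M2 M3 M12 M23 M N1 N2 N3 N12 N23 N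
    (f : M12 -> M3 -> M) (f' : M1 -> M2 -> M12)
    (h : M1 -> M23 -> M) (h' : M2 -> M3 -> M23)
    (g : N12 -> N3 -> N) (g' : N1 -> N2 -> N12)
    (l : N1 -> N23 -> N) (l' : N2 -> N3 -> N23)
    (x : M1 ⊗ N1) (y : M2 ⊗ N2) (z : M3 ⊗ N3) :
  bilin f -> bilin f' -> bilin h -> bilin h' ->
  bilin g -> bilin g' -> bilin l -> bilin l' ->
  (forall a b c, f (f' a b) c = h a (h' b c)) ->
  (forall a b c, g (g' a b) c = l a (l' b c)) ->
  tprod f g (tprod f' g' x y) z = tprod h l x (tprod h' l' y z).
Proof.
move=> fL fL' hL hL' gL gL' lL lL' ef eg.
have A := tprod_bilin fL gL; have A' := tprod_bilin fL' gL'.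
have B := tprod_bilin hL lL; have B' := tprod_bilin hL' lL'.
apply: (kext2 (F := fun x y => tprod f g (tprod f' g' x y) z)
  (F' := fun x y => tprod h l x (tprod h' l' y z))).
- exact: (lin_bilin (A.1 z) A').
- exact: (bilin_comp B (@lin_id _ _) (B'.1 z)).
move=> a b c d; move: z.
apply: kext; [exact: A.2 | exact: (lin_comp (B.2 _) (B'.2 _)) | move=> m n].
by rewrite !tprodE // ef eg.
Qed.

Lemma tprod_pureR M N P Q U V (f : M -> N -> P) (g : Q -> U -> V) x n u :
  bilin f -> bilin g -> tprod f g x (n ⊗ u) = kmap (f^~ n) (g^~ u) x.
Proof.
move=> fL gL; have f1 := fL.1 n; have g1 := gL.1 u.
move: x; apply: kext; [exact: (tprod_bilin fL gL).1 | exact: kmap_linear |].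
by move=> a b; rewrite tprodE // kmapE.
Qed.

Lemma tprod_pureL M N P Q U V (f : M -> N -> P) (g : Q -> U -> V) y m q :
  bilin f -> bilin g -> tprod f g (m ⊗ q) y = kmap (f m) (g q) y.
Proof.
move=> fL gL; have f1 := fL.2 m; have g1 := gL.2 q.
move: y; apply: kext; [exact: (tprod_bilin fL gL).2 | exact: kmap_linear |].
by move=> a b; rewrite tprodE // kmapE.
Qed.

End TensorLemmas.

Section TensorR.
Variables (k : fieldType) (R : Type) (M N M' N' : lmodType k).
Variables (ra : M -> R -> M) (la : R -> N -> N).
Variables (ra' : M' -> R -> M') (la' : R -> N' -> N').

Definition rmap (f : M -> M') (g : N -> N') : tens ra la -> tens ra' la' :=
  tlift (fun m n => pure ra' la' (f m) (g n)).

Variables (f : M -> M') (g : N -> N').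
Hypotheses (fL : linear f) (gL : linear g).
Hypotheses (fR : forall m r, f (ra m r) = ra' (f m) r).
Hypotheses (gR : forall r n, g (la r n) = la' r (g n)).

Let rmap_bilin : bilin (fun m n => pure ra' la' (f m) (g n)).
Proof. exact: (bilin_comp (pure_bilin _ _)). Qed.

Let rmap_bal : balanced ra la (fun m n => pure ra' la' (f m) (g n)).
Proof. by move=> m r n; rewrite fR gR pure_balanced. Qed.

Lemma rmapE m n : rmap f g (pure ra la m n) = pure ra' la' (f m) (g n).
Proof. exact: tliftE. Qed.

Lemma rmap_linear : linear (rmap f g).
Proof. exact: tlift_linear. Qed.
End TensorR.

Arguments rmap {k R M N M' N' ra la ra' la'} f g _.

(* The algebras of MathComp (algType) satisfy 1 != 0; the zero algebra is
   allowed here. *)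
HB.mixin Record isKAlgebra (k : fieldType) A of GRing.Lmodule k A := {
  amul : A -> A -> A;
  aone : A;
  amul_bilin : bilin amul;
  amulA : associative amul;
  amul1l : left_id aone amul;
  amul1r : right_id aone amul
}.

#[short(type="kalgType")]
HB.structure Definition KAlgebra (k : fieldType) :=
  {A of GRing.Lmodule k A & isKAlgebra k A}.

Notation "x ∙ y" := (amul x y) (at level 40, left associativity) : ring_scope.
Notation "𝟙" := aone : ring_scope.

Section AlgTypeKAlgebra.
Variables (k : fieldType) (A : algType k).
Lemma algType_mul_bilin : bilin (fun x y : A => x * y).
Proof.
split=> [y|x] a u v; first by rewrite mulrDl scalerAl.
by rewrite mulrDr scalerAr.
Qed.
HB.instance Definition _ := isKAlgebra.Build k A algType_mul_bilin
  (@mulrA A) (@mul1r A) (@mulr1 A).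
End AlgTypeKAlgebra.

HB.mixin Record isCoalgebra (k : fieldType) C of GRing.Lmodule k C := {
  comul : C -> C ⊗ C;
  counit : C -> k;
  comul_linear : linear comul;
  counit_linear : scalar counit;
  comulA : forall c, tassoc (kmap comul id (comul c)) = kmap id comul (comul c);
  counitl : forall c, tlift (fun c' c'' => counit c' *: c'') (comul c) = c;
  counitr : forall c, tlift (fun c' c'' => counit c'' *: c') (comul c) = c
}.

#[short(type="coalgType")]
HB.structure Definition Coalgebra (k : fieldType) :=
  {C of GRing.Lmodule k C & isCoalgebra k C}.

Section CoalgebraTheory.
Variables (k : fieldType) (C : coalgType k).
Implicit Types c d : C.

Lemma counitL : linear (counit : C -> k^o).
Proof. exact: counit_linear. Qed.
Lemma counit0 : counit (0 : C) = 0. Proof. exact: lin0 counitL. Qed.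
Lemma counitD c d : counit (c + d) = counit c + counit d.
Proof. exact: linD counitL c d. Qed.
Lemma counitN c : counit (- c) = - counit c.
Proof. exact: linN counitL c. Qed.
Lemma counitZ a c : counit (a *: c) = a * counit c.
Proof. exact: linZ counitL a c. Qed.

Lemma counit_scale_bilin (M : lmodType k) :
  bilin (fun (m : M) (c : C) => counit c *: m).
Proof.
split=> u a v w; first by rewrite scalerDr !scalerA mulrC.
by rewrite counit_linear scalerDl scalerA.
Qed.

Lemma counit_scalel_bilin (M : lmodType k) :
  bilin (fun (c : C) (m : M) => counit c *: m).
Proof.
split=> u a v w; first by rewrite counit_linear scalerDl scalerA.
by rewrite scalerDr !scalerA mulrC.
Qed.
End CoalgebraTheory.

HB.mixin Record isHopfAlgebra (k : fieldType) H
    of KAlgebra k H & Coalgebra k H := {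
  comul1 : comul (𝟙 : H) = 𝟙 ⊗ 𝟙;
  comulM : forall g h : H, comul (g ∙ h) =
    tprod amul amul (comul g) (comul h);
  counit1 : counit (𝟙 : H) = 1;
  counitM : forall g h : H, counit (g ∙ h) = counit g * counit h;
  antipode : H -> H;
  antipode_linear : linear antipode;
  antipodel : forall h : H,
    tlift (fun x y => antipode x ∙ y) (comul h) = counit h *: 𝟙;
  antipoder : forall h : H,
    tlift (fun x y => x ∙ antipode y) (comul h) = counit h *: 𝟙
}.

#[short(type="hopfAlgType")]
HB.structure Definition HopfAlgebra (k : fieldType) :=
  {H of KAlgebra k H & Coalgebra k H & isHopfAlgebra k H}.

(* K as a Hopf subalgebra of H, up to isomorphism. *)
Record hopf_emb (k : fieldType) (K H : hopfAlgType k) := HopfEmb {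
  he_fun :> K -> H;
  he_linear : linear he_fun;
  he1 : he_fun 𝟙 = 𝟙;
  heM : forall x y, he_fun (x ∙ y) = he_fun x ∙ he_fun y;
  he_comul : forall x, comul (he_fun x) = kmap he_fun he_fun (comul x);
  he_counit : forall x, counit (he_fun x) = counit x;
  he_antipode : forall x, antipode (he_fun x) = he_fun (antipode x);
  he_inj : injective he_fun
}.

Section Modules.
Variable k : fieldType.

Definition is_lmodule (R : kalgType k) (X : lmodType k) (act : R -> X -> X) :=
  [/\ bilin act, forall x, act 𝟙 x = x &
      forall r s x, act (r ∙ s) x = act r (act s x)].

Definition is_rmodule (R : kalgType k) (X : lmodType k) (act : X -> R -> X) :=
  [/\ bilin act, forall x, act x 𝟙 = x &
      forall r s x, act x (r ∙ s) = act (act x r) s].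

Definition is_comodule (C : coalgType k) (X : lmodType k) (rho : X -> X ⊗ C) :=
  [/\ linear rho,
      forall x, tassoc (kmap rho id (rho x)) = kmap id comul (rho x) &
      forall x, tlift (fun y c => counit c *: y) (rho x) = x].

Record lmodule (R : kalgType k) := LModule {
  lm_sort :> lmodType k;
  lact : R -> lm_sort -> lm_sort;
  lm_ax : is_lmodule lact }.

Record rmodule (R : kalgType k) := RModule {
  rm_sort :> lmodType k;
  ract : rm_sort -> R -> rm_sort;
  rm_ax : is_rmodule ract }.

Record bimodule (A B : kalgType k) := Bimodule {
  bm_sort :> lmodType k;
  bm_lact : A -> bm_sort -> bm_sort;
  bm_ract : bm_sort -> B -> bm_sort;
  bm_lax : is_lmodule bm_lact;
  bm_rax : is_rmodule bm_ract;
  bm_assoc : forall a m b, bm_ract (bm_lact a m) b = bm_lact a (bm_ract m b) }.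

Definition bm_left A B (M : bimodule A B) : lmodule A := LModule (bm_lax M).
Definition bm_right A B (M : bimodule A B) : rmodule B := RModule (bm_rax M).

Record comodule (C : coalgType k) := Comodule {
  cm_sort :> lmodType k;
  coact : cm_sort -> cm_sort ⊗ C;
  cm_ax : is_comodule coact }.

End Modules.

Notation rtens P X := (tens (@ract _ _ P) (@lact _ _ X)).
Notation rpure P X := (pure (@ract _ _ P) (@lact _ _ X)).

Section ModuleCoalgebras.
Variables (k : fieldType) (H : hopfAlgType k).

(* A quotient left H-module coalgebra C of H; the two examples used are H itself
   ([hquot_id]) and H / H K^+ ([hbar_quot]). *)
Record hquot := HQuot {
  hq_sort :> coalgType k;
  hq_act : H -> hq_sort -> hq_sort;
  hq_proj : H -> hq_sort;
  hq_lmod : is_lmodule hq_act;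
  hq_comul : forall h c, comul (hq_act h c) =
    tprod hq_act hq_act (comul h) (comul c);
  hq_counit : forall h c, counit (hq_act h c) = counit h * counit c;
  hq_proj_linear : linear hq_proj;
  hq_proj_act : forall h l, hq_proj (h ∙ l) = hq_act h (hq_proj l);
  hq_proj_comul : forall h, comul (hq_proj h) =
    kmap hq_proj hq_proj (comul h);
  hq_proj_counit : forall h, counit (hq_proj h) = counit h;
  hq_proj_surj : forall c, exists h, hq_proj h = c }.

Lemma amul_lmodule (A : kalgType k) : is_lmodule (@amul _ A).
Proof.
split; [exact: amul_bilin | exact: amul1l |].
by move=> r s x; rewrite amulA.
Qed.

Lemma amul_rmodule (A : kalgType k) : is_rmodule (@amul _ A).
Proof.
split; [exact: amul_bilin | exact: amul1r |].
by move=> r s x; rewrite amulA.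
Qed.

Lemma hquot_id_proj_comul (h : H) : comul (id h) = kmap id id (comul h).
Proof. by rewrite kmap_id. Qed.

Definition hquot_id : hquot :=
  @HQuot H amul id (amul_lmodule H) comulM counitM (fun _ _ _ => erefl)
    (fun _ _ => erefl) hquot_id_proj_comul (fun _ => erefl)
    (fun c => ex_intro _ c erefl).

End ModuleCoalgebras.

Section HQuotient.
Variables (k : fieldType) (K H : hopfAlgType k) (j : hopf_emb K H).

(* Generators of the subspace H K^+. *)
Inductive HKplus : H -> Prop :=
| HKplus_gen h x : counit x = 0 -> HKplus (h ∙ j x).

Definition hbar := quot HKplus.
HB.instance Definition _ := GRing.Lmodule.on hbar.

Definition hbar_proj (h : H) : hbar := qproj HKplus h.
Definition hbar_act (h : H) (c : hbar) : hbar :=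
  quot_lift (fun l => hbar_proj (h ∙ l)) c.
Definition hbar_comul (c : hbar) : hbar ⊗ hbar :=
  quot_lift (fun h => kmap hbar_proj hbar_proj (comul h)) c.
Definition hbar_counit (c : hbar) : k :=
  quot_lift (counit : H -> k^o) c.

Lemma hbar_proj_linear : linear hbar_proj.
Proof. exact: qproj_linear. Qed.

Lemma hbar_proj0 h : HKplus h -> hbar_proj h = 0.
Proof.
move=> Hh; rewrite -(lin0 hbar_proj_linear).
by apply/qprojP; rewrite subr0; apply: kspan_gen.
Qed.

Lemma hbar_projM h x : hbar_proj (h ∙ j x) = counit x *: hbar_proj h.
Proof.
have /hbar_proj0 : HKplus (h ∙ j (x - counit x *: 𝟙)).
  constructor.
  by rewrite counitD counitN counitZ counit1 mulr1 subrr.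
rewrite (linD (he_linear j)) (linN (he_linear j)) (linZ (he_linear j)) he1.
have R := (amul_bilin (s := H)).2 h.
rewrite (linD R) (linN R) (linZ R) amul1r.
rewrite (linD hbar_proj_linear) (linN hbar_proj_linear).
by rewrite (linZ hbar_proj_linear) => /eqP; rewrite subr_eq0 => /eqP.
Qed.

Lemma hbar_actE h l : hbar_act h (hbar_proj l) = hbar_proj (h ∙ l).
Proof.
apply: quot_liftE => [|_ [l' x x0]].
  by apply: lin_comp; [exact: hbar_proj_linear | exact: (amul_bilin (s := H)).2].
by apply: hbar_proj0; rewrite amulA; constructor.
Qed.

Let comul_lift_linear :
  linear (fun h => kmap hbar_proj hbar_proj (comul h)).
Proof.
by apply: lin_comp; [apply: kmap_linear; apply: hbar_proj_linear | apply: comul_linear].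
Qed.

Lemma hbar_comulE h :
  hbar_comul (hbar_proj h) = kmap hbar_proj hbar_proj (comul h).
Proof.
apply: quot_liftE => // _ [l x x0]; have pL := hbar_proj_linear.
have mB := amul_bilin (s := H).
rewrite comulM kmap_tprod // he_comul -[comul l]kmap_id.
rewrite tprod_kmap; try exact: lin_bilin; try exact: he_linear; try by [].
rewrite (@eq_tprod _ _ _ _ _ _ _ _ (fun m n => counit n *: hbar_proj m)
   _ (fun m n => counit n *: hbar_proj m)); try exact: hbar_projM.
have cL := @counit_linear k K.
have B : bilin (fun (m : H) (n : K) => counit n *: hbar_proj m).
  by apply: (bilin_comp (counit_scale_bilin _ _) pL); apply: lin_id.
set F := fun m n => _.
have eB : bilin (fun a b : K => counit a * counit b : k^o).
  split=> u a v w; rewrite cL; first by rewrite mulrDl -mulrA.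
  by rewrite mulrDr mulrCA.
have e z y : tprod F F z y =
    (tlift (fun a b : K => counit a * counit b : k^o) y : k) *:
      kmap hbar_proj hbar_proj z.
  have eL := klift_linear eB; have kL := kmap_linear pL pL.
  apply: (kext2 (F := tprod F F) (F' := fun z y =>
    (tlift (fun a b : K => counit a * counit b : k^o) y : k) *:
      kmap hbar_proj hbar_proj z)); first exact: tprod_bilin.
    split=> [y'|z'] a u v; first by rewrite kL scalerDr !scalerA mulrC.
    by rewrite eL scalerDl -scalerA.
  move=> m n a b; rewrite tprodE // kliftE // kmapE // /F.
  by rewrite (linZ (kpureL _)) (linZ (kpureR _)) scalerA.
have B1 := counit_scalel_bilin K K.
have e' (y : K ⊗ K) : (tlift (fun a b : K => counit a * counit b : k^o) y : k) =
    counit (tlift (fun c' c'' : K => counit c' *: c'') y).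
  have L : linear (fun y : K ⊗ K => counit (tlift (fun c' c'' : K => counit c' *: c'') y) : k^o).
    by move=> a u v; rewrite (klift_linear B1); apply: counitL.
  move: y; apply: (kext (klift_linear eB) L) => a b.
  by rewrite !kliftE // counitZ.
by rewrite e e' counitl x0 scale0r.
Qed.

Lemma hbar_counitE h : hbar_counit (hbar_proj h) = counit h.
Proof.
apply: (@quot_liftE k H HKplus k^o counit) => [|_ [l x x0]]; first exact: counitL.
by rewrite counitM he_counit x0 mulr0.
Qed.

Lemma hbar_ind (P : hbar -> Prop) : (forall h, P (hbar_proj h)) -> forall c, P c.
Proof. exact: quotP. Qed.

Lemma hbar_comul_linear : linear hbar_comul.
Proof.
move=> a; elim/hbar_ind=> x; elim/hbar_ind=> y.
by rewrite -hbar_proj_linear !hbar_comulE comul_linear kmap_linear //;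
  apply: hbar_proj_linear.
Qed.

Lemma hbar_counit_linear : scalar hbar_counit.
Proof.
move=> a; elim/hbar_ind=> x; elim/hbar_ind=> y.
by rewrite -hbar_proj_linear !hbar_counitE counit_linear.
Qed.

Lemma hbar_comulA c :
  tassoc (kmap hbar_comul id (hbar_comul c)) =
  kmap id hbar_comul (hbar_comul c).
Proof.
elim/hbar_ind: c => h; rewrite hbar_comulE.
have pL := hbar_proj_linear; have dL := hbar_comul_linear.
have cL := @comul_linear k H; have ppL := kmap_linear pL pL.
rewrite !kmap_comp //.
rewrite (eq_kmap _ hbar_comulE (fun _ => erefl)).
rewrite (eq_kmap _ (fun _ => erefl) hbar_comulE).
rewrite -(kmap_comp _ ppL pL cL (@lin_id _ _)).
rewrite -(kmap_comp _ pL ppL (@lin_id _ _) cL) -comulA.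
move: (kmap comul id _); apply: kext3 => [||m n p].
- by apply: lin_comp; [apply: tassoc_linear | apply: kmap_linear].
- by apply: lin_comp; [apply: kmap_linear | apply: tassoc_linear].
by rewrite !(kmapE, tassocE).
Qed.

Lemma hbar_counitl c :
  tlift (fun c' c'' => hbar_counit c' *: c'') (hbar_comul c) = c.
Proof.
elim/hbar_ind: c => h; rewrite hbar_comulE -[in RHS](counitl h).
have pL := hbar_proj_linear; have B := counit_scalel_bilin H H.
have B' : bilin (fun (c : hbar) (m : hbar) => hbar_counit c *: m).
  split=> u a v w; first by rewrite hbar_counit_linear scalerDl scalerA.
  by rewrite scalerDr !scalerA mulrC.
move: (comul h); apply: kext => [||m n].
- by apply: lin_comp; [apply: klift_linear | apply: kmap_linear].
- by apply: lin_comp; [| apply: klift_linear].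
by rewrite kmapE // !kliftE // hbar_counitE (linZ pL).
Qed.

Lemma hbar_counitr c :
  tlift (fun c' c'' => hbar_counit c'' *: c') (hbar_comul c) = c.
Proof.
elim/hbar_ind: c => h; rewrite hbar_comulE -[in RHS](counitr h).
have pL := hbar_proj_linear; have B := counit_scale_bilin H H.
have B' : bilin (fun (m : hbar) (c : hbar) => hbar_counit c *: m).
  split=> u a v w; first by rewrite scalerDr !scalerA mulrC.
  by rewrite hbar_counit_linear scalerDl scalerA.
move: (comul h); apply: kext => [||m n].
- by apply: lin_comp; [apply: klift_linear | apply: kmap_linear].
- by apply: lin_comp; [| apply: klift_linear].
by rewrite kmapE // !kliftE // hbar_counitE (linZ pL).
Qed.

HB.instance Definition _ := isCoalgebra.Build k hbar hbar_comul_linear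
  hbar_counit_linear hbar_comulA hbar_counitl hbar_counitr.

Lemma hbar_act_lmodule : is_lmodule hbar_act.
Proof.
have pL := hbar_proj_linear; have [mL mR] := amul_bilin (s := H).
split.
- split=> [c|h] a x y.
    by elim/hbar_ind: c => l; rewrite !hbar_actE mL pL.
  elim/hbar_ind: x => x; elim/hbar_ind: y => y.
  by rewrite -pL !hbar_actE mR pL.
- by elim/hbar_ind => l; rewrite hbar_actE amul1l.
by move=> r s; elim/hbar_ind => l; rewrite !hbar_actE amulA.
Qed.

Lemma hbar_act_comul h c :
  comul (hbar_act h c) = tprod hbar_act hbar_act (comul h) (comul c).
Proof.
have pL := hbar_proj_linear; have B := amul_bilin (s := H).
have [aB _ _] := hbar_act_lmodule.
elim/hbar_ind: c => l; rewrite hbar_actE.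
rewrite -![comul (hbar_proj _)]/(hbar_comul (hbar_proj _)) !hbar_comulE comulM.
rewrite -[comul h in RHS]kmap_id tprod_kmap // kmap_tprod //.
by apply: eq_tprod => x y; rewrite hbar_actE.
Qed.

Lemma hbar_act_counit h c : counit (hbar_act h c) = counit h * counit c.
Proof.
elim/hbar_ind: c => l; rewrite hbar_actE.
rewrite -![counit (hbar_proj _)]/(hbar_counit (hbar_proj _)).
by rewrite !hbar_counitE counitM.
Qed.

Lemma hbar_proj_act h l : hbar_proj (h ∙ l) = hbar_act h (hbar_proj l).
Proof. by rewrite hbar_actE. Qed.

Lemma hbar_proj_surj c : exists h, hbar_proj h = c.
Proof. by elim/hbar_ind: c => h; exists h. Qed.

Definition hbar_quot : hquot H :=
  HQuot hbar_act_lmodule hbar_act_comul hbar_act_counit hbar_proj_linear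
    hbar_proj_act hbar_comulE hbar_counitE hbar_proj_surj.

End HQuotient.

Section HopfModules.
Variables (k : fieldType) (H : hopfAlgType k).

Definition is_comodalg (A : kalgType k) (rho : A -> A ⊗ H) :=
  [/\ is_comodule rho, rho 𝟙 = 𝟙 ⊗ 𝟙 &
      forall a b, rho (a ∙ b) = tprod amul amul (rho a) (rho b)].

Record comodalg := Comodalg {
  ca_sort :> kalgType k;
  ca_coact : ca_sort -> ca_sort ⊗ H;
  ca_ax : is_comodalg ca_coact }.

Lemma ca_cm (A : comodalg) : is_comodule (@ca_coact A).
Proof. by case: (ca_ax A). Qed.

Definition ca_comod (A : comodalg) : comodule H := Comodule (ca_cm A).

(* [bicomod A B] is the class of objects of _A M_B^H. *)
Definition is_bicomod (A B : comodalg) (M : bimodule A B) (rho : M -> M ⊗ H) :=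
  [/\ is_comodule rho,
      forall a m, rho (bm_lact a m) =
        tprod (@bm_lact _ _ _ M) amul (ca_coact a) (rho m) &
      forall m b, rho (bm_ract m b) =
        tprod (@bm_ract _ _ _ M) amul (rho m) (ca_coact b)].

Record bicomod (A B : comodalg) := Bicomod {
  bc_bimod :> bimodule A B;
  bc_coact : bc_bimod -> bc_bimod ⊗ H;
  bc_ax : is_bicomod bc_coact }.

Lemma bc_cm A B (M : bicomod A B) : is_comodule (@bc_coact _ _ M).
Proof. by case: (bc_ax M). Qed.

Definition bc_comod A B (M : bicomod A B) : comodule H := Comodule (bc_cm M).

(* [dkmod A C] is the class of objects of _A M(H)^C. *)
Definition is_dkmod (A : comodalg) (C : hquot H) (U : lmodule A)
    (rho : U -> U ⊗ C) :=
  is_comodule rho /\ forall a u, rho (lact a u) =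
    tprod (@lact _ _ U) (@hq_act _ _ C) (ca_coact a) (rho u).

Record dkmod (A : comodalg) (C : hquot H) := Dkmod {
  dk_lmod :> lmodule A;
  dk_coact : dk_lmod -> dk_lmod ⊗ C;
  dk_ax : is_dkmod dk_coact }.

Lemma dk_cm A C (U : dkmod A C) : is_comodule (@dk_coact _ _ U).
Proof. by case: (dk_ax U). Qed.

Definition dk_comod A C (U : dkmod A C) : comodule C := Comodule (dk_cm U).

End HopfModules.

Section Coinvariants.
Variables (k : fieldType) (H : hopfAlgType k) (C : hquot H).

Lemma via_ax (M : comodule H) :
  is_comodule (fun m : M => kmap id (hq_proj C) (coact m)).
Proof.
have [rL rA r1] := cm_ax M; have pL := hq_proj_linear C.
have dL := @comul_linear k C; have dHL := @comul_linear k H.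
have ppL := kmap_linear pL pL.
split=> [|m|m].
- exact: (lin_comp (kmap_linear (@lin_id _ M) pL) rL).
- have ipL := kmap_linear (@lin_id _ M) pL.
  have irL := lin_comp ipL rL.
  rewrite !kmap_comp //.
  rewrite (eq_kmap (f' := id) _ (fun _ => erefl) (@hq_proj_comul _ _ C)).
  rewrite -(kmap_comp _ (@lin_id _ M) ppL (@lin_id _ _) dHL) -rA.
  rewrite -(kmap_comp _ ipL pL rL (@lin_id _ _)).
  move: (kmap (@coact _ _ M) id _); apply: kext3 => [||x y z].
  + by apply: lin_comp; [apply: tassoc_linear | apply: kmap_linear].
  + by apply: lin_comp; [apply: kmap_linear | apply: tassoc_linear].
  by rewrite !(kmapE, tassocE).
rewrite -[RHS]r1; move: (coact m).
have B := counit_scale_bilin H M; have B' := counit_scale_bilin C M.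
apply: kext => [||x y].
- by apply: lin_comp; [apply: klift_linear | apply: kmap_linear].
- exact: klift_linear.
by rewrite kmapE // !kliftE // hq_proj_counit.
Qed.

(* The H-comodule M viewed as a C-comodule along the projection H -> C. *)
Definition via (M : comodule H) : comodule C := Comodule (via_ax M).

Section Coinv.
Variable U : comodule C.

(* The projection of 𝟙 is the class of 1 in C. *)
Definition coinv_pred : {pred U} := fun u => coact u == u ⊗ hq_proj C 𝟙.

Lemma coinv_submod : submod_closed coinv_pred.
Proof.
have [rL _ _] := cm_ax U.
split=> [|a u v /eqP eu /eqP ev]; apply/eqP.
  by rewrite (lin0 rL) (lin0 (kpureL _)).
by rewrite rL eu ev kpureL.
Qed.
HB.instance Definition _ :=
  GRing.isSubmodClosed.Build k U coinv_pred coinv_submod.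

Record coinv := Coinv { coinv_val :> U; _ : coinv_val \in coinv_pred }.
HB.instance Definition _ := [isSub for coinv_val].
HB.instance Definition _ := [Choice of coinv by <:].
HB.instance Definition _ := [SubChoice_isSubLmodule of coinv by <:].

Lemma coinvE (u : coinv) : coact (val u) = val u ⊗ hq_proj C 𝟙.
Proof. exact/eqP/(valP u). Qed.

Lemma val_linear : linear (val : coinv -> U).
Proof. exact: linearP. Qed.

End Coinv.
End Coinvariants.

Section CoinvariantModules.
Variables (k : fieldType) (H : hopfAlgType k) (C : hquot H).

Let aB : bilin (@hq_act _ _ C). Proof. by case: (hq_lmod C). Qed.

Section Mul.
Variables (X : comodule H) (Y Z : comodule C) (f : X -> Y -> Z).
Hypotheses (fB : bilin f) (f_coact : forall x y,
  coact (f x y) = tprod f (@hq_act _ _ C) (coact x) (coact y)).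

Lemma coinv_mul_subproof (x : coinv (via C X)) (y : coinv Y) :
  f (val x) (val y) \in @coinv_pred _ _ _ Z.
Proof.
apply/eqP; rewrite f_coact (coinvE y) tprod_pureR //.
have := coinvE x; rewrite /= => ex.
rewrite (eq_kmap (f' := fun z => f (id z) (val y)) (g' := fun h => id (hq_proj C h)))
  //; last by move=> h; rewrite -hq_proj_act amul1r.
have pL := hq_proj_linear C.
rewrite -(kmap_comp (g' := hq_proj C) _ (fB.1 _) (@lin_id _ _) (@lin_id _ _) pL).
by rewrite ex kmapE //; apply: fB.1.
Qed.

Definition coinv_mul x y : coinv Z := Coinv (coinv_mul_subproof x y).

Lemma coinv_mul_bilin : bilin coinv_mul.
Proof.
split=> u a x y; apply: val_inj; rewrite [RHS]val_linear.
  by rewrite /= fB.1.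
by rewrite /= fB.2.
Qed.
End Mul.

Lemma via_coact (X Y Z : comodule H) (f : X -> Y -> Z) : bilin f ->
  (forall x y, coact (f x y) = tprod f amul (coact x) (coact y)) ->
  forall x y, coact (f x y : via C Z) =
    tprod f (@hq_act _ _ C) (coact x) (coact (y : via C Y)).
Proof.
move=> fB fc x y; have pL := hq_proj_linear C; have mB := amul_bilin (s := H).
rewrite /= fc kmap_tprod // -[coact x in RHS]kmap_id tprod_kmap //.
by apply: eq_tprod => // h l; rewrite hq_proj_act.
Qed.

Section Algebra.
Variable A : comodalg H.

Definition coinv_alg := coinv (via C (ca_comod A)).
HB.instance Definition _ := GRing.Lmodule.on coinv_alg.

Lemma coinv_alg_coact (a b : A) :
  coact (a ∙ b : via C (ca_comod A)) =
  tprod amul (@hq_act _ _ C) (ca_coact a) (coact (b : via C (ca_comod A))).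
Proof.
have [_ _ cM] := ca_ax A.
exact: (@via_coact (ca_comod A) (ca_comod A) (ca_comod A) amul (@amul_bilin _ A)).
Qed.

Definition coinv_amul : coinv_alg -> coinv_alg -> coinv_alg :=
  @coinv_mul (ca_comod A) (via C (ca_comod A)) (via C (ca_comod A)) (@amul _ A)
    (@amul_bilin _ A) coinv_alg_coact.

Lemma coinv_aone_subproof :
  (𝟙 : A) \in @coinv_pred _ _ _ (via C (ca_comod A)).
Proof.
have [_ c1 _] := ca_ax A.
by apply/eqP; rewrite /= c1 kmapE //; apply: hq_proj_linear.
Qed.

Definition coinv_aone : coinv_alg := Coinv coinv_aone_subproof.

Lemma coinv_amulA : associative coinv_amul.
Proof. by move=> x y z; apply: val_inj; rewrite /= amulA. Qed.
Lemma coinv_amul1l : left_id coinv_aone coinv_amul.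
Proof. by move=> x; apply: val_inj; rewrite /= amul1l. Qed.
Lemma coinv_amul1r : right_id coinv_aone coinv_amul.
Proof. by move=> x; apply: val_inj; rewrite /= amul1r. Qed.

HB.instance Definition _ := isKAlgebra.Build k coinv_alg
  (coinv_mul_bilin _ _) coinv_amulA coinv_amul1l coinv_amul1r.

End Algebra.

Section LModule.
Variables (A : comodalg H) (U : dkmod A C).

Let lB : bilin (@lact _ _ U). Proof. by case: (lm_ax U). Qed.
Let lC : forall (a : A) (u : U), dk_coact (lact a u) =
    tprod (@lact _ _ U) (@hq_act _ _ C) (ca_coact a) (dk_coact u).
Proof. by case: (dk_ax U). Qed.

Definition coinv_lact : coinv_alg A -> coinv (dk_comod U) -> coinv (dk_comod U) :=
  @coinv_mul (ca_comod A) (dk_comod U) (dk_comod U) (@lact _ _ U) lB lC.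

Lemma coinv_lact_ax : is_lmodule coinv_lact.
Proof.
have [_ l1 lA] := lm_ax U.
split=> [|x|r s x]; first exact: coinv_mul_bilin.
  by apply: val_inj; apply: l1.
by apply: val_inj; apply: lA.
Qed.

Definition coinv_lmod : lmodule (coinv_alg A) := LModule coinv_lact_ax.
End LModule.

Section Bimodule.
Variables (A B : comodalg H) (M : bicomod A B).

Definition coinv_bc := coinv (via C (bc_comod M)).
HB.instance Definition _ := GRing.Lmodule.on coinv_bc.

Let lB : bilin (@bm_lact _ _ _ M). Proof. by case: (bm_lax M). Qed.
Let rB : bilin (@bm_ract _ _ _ M). Proof. by case: (bm_rax M). Qed.
Let lC (a : A) (m : M) : coact (bm_lact a m : via C (bc_comod M)) =
  tprod (@bm_lact _ _ _ M) (@hq_act _ _ C) (ca_coact a)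
    (coact (m : via C (bc_comod M))).
Proof.
case: (bc_ax M) => _ e _.
exact: (@via_coact (ca_comod A) (bc_comod M) (bc_comod M) _ lB).
Qed.
Let rC (m : M) (b : B) : coact (bm_ract m b : via C (bc_comod M)) =
  tprod (@bm_ract _ _ _ M) (@hq_act _ _ C) (bc_coact m)
    (coact (b : via C (ca_comod B))).
Proof.
case: (bc_ax M) => _ _ e.
exact: (@via_coact (bc_comod M) (ca_comod B) (bc_comod M) _ rB).
Qed.

Definition coinv_bm_lact : coinv_alg A -> coinv_bc -> coinv_bc :=
  @coinv_mul (ca_comod A) (via C (bc_comod M)) (via C (bc_comod M))
    (@bm_lact _ _ _ M) lB lC.
Definition coinv_bm_ract : coinv_bc -> coinv_alg B -> coinv_bc :=
  @coinv_mul (bc_comod M) (via C (ca_comod B)) (via C (bc_comod M))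
    (@bm_ract _ _ _ M) rB rC.

Lemma coinv_bm_lax : is_lmodule coinv_bm_lact.
Proof.
have [_ l1 lA] := bm_lax M.
split=> [|x|r s x]; first exact: coinv_mul_bilin.
  by apply: val_inj; apply: l1.
by apply: val_inj; apply: lA.
Qed.

Lemma coinv_bm_rax : is_rmodule coinv_bm_ract.
Proof.
have [_ l1 lA] := bm_rax M.
split=> [|x|r s x]; first exact: coinv_mul_bilin.
  by apply: val_inj; apply: l1.
by apply: val_inj; apply: lA.
Qed.

Lemma coinv_bm_assoc a m b :
  coinv_bm_ract (coinv_bm_lact a m) b = coinv_bm_lact a (coinv_bm_ract m b).
Proof. by apply: val_inj; apply: bm_assoc. Qed.

Definition coinv_bimod : bimodule (coinv_alg A) (coinv_alg B) :=
  Bimodule coinv_bm_lax coinv_bm_rax coinv_bm_assoc.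
End Bimodule.

(* A as a bimodule over A and its subalgebra of coinvariants. *)
Section Extension.
Variable A : comodalg H.

Definition ext_ract (a : A) (b : coinv_alg A) : A := a ∙ val b.

Lemma ext_rax : is_rmodule ext_ract.
Proof.
have [mL mR] := amul_bilin (s := A).
split=> [|x|r s x]; last by rewrite /ext_ract amulA.
  by split=> u a x y; rewrite /ext_ract ?mL // val_linear mR.
exact: amul1r.
Qed.

Lemma ext_assoc (a : A) m b : ext_ract (a ∙ m) b = a ∙ ext_ract m b.
Proof. by rewrite /ext_ract amulA. Qed.

Definition ext_bimod : bimodule A (coinv_alg A) :=
  Bimodule (amul_lmodule A) ext_rax ext_assoc.

Definition ext_lact (b : coinv_alg A) (a : A) : A := val b ∙ a.

Lemma ext_lax : is_lmodule ext_lact.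
Proof.
have [mL mR] := amul_bilin (s := A).
split=> [|x|r s x]; last by rewrite /ext_lact amulA.
  by split=> u a x y; rewrite /ext_lact ?mR // val_linear mL.
exact: amul1l.
Qed.

Definition ext_lmod : lmodule (coinv_alg A) := LModule ext_lax.
Definition ext_rmod : rmodule (coinv_alg A) := RModule ext_rax.
End Extension.

End CoinvariantModules.

(* For C = H one recovers {a | rho a = a ⊗ 1}. *)
Lemma coinv_idP (k : fieldType) (H : hopfAlgType k) (A : comodalg H)
    (a : coinv_alg (hquot_id H) A) :
  ca_coact (val a) = val a ⊗ 𝟙.
Proof. by have := coinvE a; rewrite /= kmap_id. Qed.

Section TensorModules.
Variables (k : fieldType) (A B : kalgType k).

Section Left.
Variables (P : bimodule A B) (X : lmodule B).
Notation T := (rtens (bm_right P) X).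

Let lB : bilin (@bm_lact _ _ _ P). Proof. by case: (bm_lax P). Qed.

Definition tens_lact (a : A) : T -> T := rmap (bm_lact a) id.

Lemma tens_lactE a (p : P) (x : X) :
  tens_lact a (rpure (bm_right P) X p x) = rpure (bm_right P) X (bm_lact a p) x.
Proof.
by apply: rmapE => //; [apply: lB.2 | move=> m r; rewrite /= bm_assoc].
Qed.

Lemma tens_lact_linear a : linear (tens_lact a).
Proof.
by apply: rmap_linear => //; [apply: lB.2 | move=> m r; rewrite /= bm_assoc].
Qed.

Lemma tens_lax : is_lmodule tens_lact.
Proof.
have [_ l1 lA] := bm_lax P.
have pL := (pure_bilin (@ract _ _ (bm_right P)) (@lact _ _ X)).1.
split.
- split=> [z|a]; last exact: tens_lact_linear.
  move=> c a b; elim/tens_ind: z => [|z z' e e'|p x].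
  + by rewrite !(lin0 (tens_lact_linear _)) scaler0 addr0.
  + by rewrite !(linD (tens_lact_linear _)) e e' scalerDr addrACA.
  + by rewrite !tens_lactE lB.1 pL.
- by apply: tens_ext => [||p x] //; rewrite ?tens_lactE ?l1 //; apply: tens_lact_linear.
- move=> r s; apply: tens_ext => [||p x]; rewrite ?tens_lactE ?lA //.
    exact: tens_lact_linear.
  by apply: lin_comp; apply: tens_lact_linear.
Qed.

Definition tens_lmod : lmodule A := LModule tens_lax.
End Left.

End TensorModules.

Section TensorBimodule.
Variables (k : fieldType) (A B D : kalgType k).
Variables (P : bimodule A B) (Q : bimodule B D).
Notation T := (rtens (bm_right P) (bm_left Q)).

Let rB : bilin (@bm_ract _ _ _ Q). Proof. by case: (bm_rax Q). Qed.

Definition tens_ract (t : T) (d : D) : T := rmap id ((@bm_ract _ _ _ Q)^~ d) t.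

Lemma tens_ractE (p : P) (q : Q) d :
  tens_ract (rpure (bm_right P) (bm_left Q) p q) d =
  rpure (bm_right P) (bm_left Q) p (bm_ract q d).
Proof.
by apply: rmapE => //; [apply: rB.1 | move=> r n; rewrite /= bm_assoc].
Qed.

Lemma tens_ract_linear d : linear (tens_ract^~ d).
Proof.
by apply: rmap_linear => //; [apply: rB.1 | move=> r n; rewrite /= bm_assoc].
Qed.

Lemma tens_rax : is_rmodule tens_ract.
Proof.
have [_ r1 rA] := bm_rax Q.
have pL := (pure_bilin (@ract _ _ (bm_right P)) (@lact _ _ (bm_left Q))).2.
split.
- split=> [d|z]; first exact: tens_ract_linear.
  move=> c a b; elim/tens_ind: z => [|z z' e e'|p x].
  + by rewrite !(lin0 (tens_ract_linear _)) scaler0 addr0.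
  + by rewrite !(linD (tens_ract_linear _)) e e' scalerDr addrACA.
  + by rewrite !tens_ractE rB.2 pL.
- by apply: tens_ext => [||p x] //; rewrite ?tens_ractE ?r1 //; apply: tens_ract_linear.
- move=> r s; apply: tens_ext => [||p x]; rewrite ?tens_ractE ?rA //.
    exact: tens_ract_linear.
  exact: (lin_comp (tens_ract_linear _) (tens_ract_linear _)).
Qed.

Lemma tens_bm_assoc a (t : T) d :
  tens_ract (tens_lact a t) d = tens_lact a (tens_ract t d).
Proof.
have lL := @tens_lact_linear _ _ _ P (bm_left Q) a.
move: t; apply: tens_ext => [||p q].
- exact: (lin_comp (tens_ract_linear d) lL).
- exact: (lin_comp lL (tens_ract_linear d)).
by rewrite tens_lactE !tens_ractE tens_lactE.
Qed.

Definition tens_bimod : bimodule A D :=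
  Bimodule (tens_lax P (bm_left Q)) tens_rax tens_bm_assoc.
End TensorBimodule.

Section TensorCoaction.
Variables (k : fieldType) (H : hopfAlgType k) (C : hquot H) (B : comodalg H).
Variables (P : rmodule B) (rhoP : P -> P ⊗ H).
Variables (X : lmodule B) (rhoX : X -> X ⊗ C).
Hypotheses (cP : is_comodule rhoP) (cX : is_comodule rhoX).
Hypothesis cPB : forall p b, rhoP (ract p b) =
  tprod (@ract _ _ P) amul (rhoP p) (ca_coact b).
Hypothesis cXB : forall b x, rhoX (lact b x) =
  tprod (@lact _ _ X) (@hq_act _ _ C) (ca_coact b) (rhoX x).
Notation T := (rtens P X).

Let aB : bilin (@hq_act _ _ C). Proof. by case: (hq_lmod C). Qed.
Let pB : bilin (rpure P X). Proof. exact: pure_bilin. Qed.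
Let rB : bilin (@ract _ _ P). Proof. by case: (rm_ax P). Qed.
Let lB : bilin (@lact _ _ X). Proof. by case: (lm_ax X). Qed.
Let PL : linear rhoP. Proof. by case: cP. Qed.
Let XL : linear rhoX. Proof. by case: cX. Qed.

Definition tens_coact : T -> T ⊗ C :=
  tlift (fun p x => tprod (rpure P X) (@hq_act _ _ C) (rhoP p) (rhoX x)).

Let cB : bilin (fun p x => tprod (rpure P X) (@hq_act _ _ C) (rhoP p) (rhoX x)).
Proof. exact: (bilin_comp (tprod_bilin pB aB)). Qed.

Let cBal : balanced (@ract _ _ P) (@lact _ _ X)
  (fun p x => tprod (rpure P X) (@hq_act _ _ C) (rhoP p) (rhoX x)).
Proof.
move=> p b x; rewrite cPB cXB; have mB := amul_bilin (s := H).
have [_ _ aA] := hq_lmod C.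
apply: tprod_assoc => //; exact: pure_balanced.
Qed.

Lemma tens_coactE p x : tens_coact (rpure P X p x) =
  tprod (rpure P X) (@hq_act _ _ C) (rhoP p) (rhoX x).
Proof. exact: tliftE. Qed.

Lemma tens_coact_linear : linear tens_coact.
Proof. exact: tlift_linear. Qed.

Lemma tens_coact_ax : is_comodule tens_coact.
Proof.
have tL := tens_coact_linear; have dL := @comul_linear k C.
have dHL := @comul_linear k H.
have [_ pA p1] := cP; have [_ xA x1] := cX.
have tB := tprod_bilin pB aB; have aaB := tprod_bilin aB aB.
have t2B := tprod_bilin tB aB; have ttB := tprod_bilin pB aaB.
have iL (V : lmodType k) := @lin_id k V.
split=> //.
- apply: tens_ext => [||p x].
  + exact: (lin_comp (@tassoc_linear _ _ _ _)
      (lin_comp (kmap_linear tL (iL _)) tL)).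
  + exact: (lin_comp (kmap_linear (iL _) dL) tL).
  rewrite tens_coactE kmap_tprod //.
  transitivity (tassoc (tprod (tprod (rpure P X) (@hq_act _ _ C)) (@hq_act _ _ C)
    (kmap rhoP id (rhoP p)) (kmap rhoX id (rhoX x)))).
    congr tassoc; rewrite tprod_kmap //.
    by apply: eq_tprod => // m n; rewrite tens_coactE.
  rewrite tassoc_tprod // pA xA tprod_kmap // kmap_tprod //.
  by apply: eq_tprod => // h c; rewrite hq_comul.
have eB (V : lmodType k) := counit_scale_bilin C V.
have eHB (V : lmodType k) := counit_scale_bilin H V.
apply: tens_ext => [||p x].
- exact: (lin_comp (klift_linear (eB _)) tL).
- by [].
rewrite tens_coactE -[in RHS](p1 p) -[in RHS](x1 x).
apply: (kext2 (F := fun u v => tlift (fun y c => counit c *: y)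
    (tprod (rpure P X) (@hq_act _ _ C) u v))
  (F' := fun u v => rpure P X (tlift (fun y c => counit c *: y) u)
    (tlift (fun y c => counit c *: y) v))).
- exact: (lin_bilin (klift_linear (eB _)) tB).
- exact: (bilin_comp pB (klift_linear (eHB _)) (klift_linear (eB _))).
move=> m h n c; rewrite tprodE // !kliftE // hq_counit.
by rewrite (linZ (pB.1 _)) (linZ (pB.2 _)) scalerA.
Qed.

End TensorCoaction.

Section TensorHopf.
Variables (k : fieldType) (H : hopfAlgType k) (A B : comodalg H).
Variable M : bicomod A B.

Lemma bc_lcoact a m : bc_coact (bm_lact a m) =
  tprod (@bm_lact _ _ _ M) amul (ca_coact a) (bc_coact m).
Proof. by case: (bc_ax M). Qed.

Lemma bc_rcoact m b : bc_coact (bm_ract m b) =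
  tprod (@bm_ract _ _ _ M) amul (bc_coact m) (ca_coact b).
Proof. by case: (bc_ax M). Qed.

Section DK.
Variables (C : hquot H) (V : dkmod B C).

Lemma dk_lcoact b v : dk_coact (lact b v) =
  tprod (@lact _ _ V) (@hq_act _ _ C) (ca_coact b) (dk_coact v).
Proof. by case: (dk_ax V). Qed.

Definition tens_dk_coact :=
  tens_coact (P := bm_right M) (@bc_coact _ _ _ _ M) (@dk_coact _ _ _ _ V).

Lemma tens_dk_coactE m v :
  tens_dk_coact (rpure (bm_right M) V m v) =
  tprod (rpure (bm_right M) V) (@hq_act _ _ C) (bc_coact m) (dk_coact v).
Proof.
exact: (tens_coactE (P := bm_right M) (bc_cm M) (dk_cm V) bc_rcoact dk_lcoact).
Qed.

Lemma tens_dk_ax :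
  is_dkmod (U := tens_lmod M V) tens_dk_coact.
Proof.
split; first exact: (tens_coact_ax (P := bm_right M) (bc_cm M) (dk_cm V) bc_rcoact dk_lcoact).
move=> a; have [aB _ aA] := hq_lmod C; have [lB _ _] := bm_lax M.
have tL := tens_coact_linear (P := bm_right M) (bc_cm M) (dk_cm V) bc_rcoact dk_lcoact.
have [tB _ _] := tens_lax M V.
have pB := pure_bilin (@ract _ _ (bm_right M)) (@lact _ _ V).
have mB := amul_bilin (s := H).
apply: tens_ext => [||m v].
- exact: (lin_comp tL (tB.2 a)).
- exact: (lin_comp ((tprod_bilin tB aB).2 _) tL).
rewrite [lact _ _]tens_lactE !tens_dk_coactE bc_lcoact.
by apply: tprod_assoc => // *; rewrite [lact _ _]tens_lactE.
Qed.

Definition tens_dk : dkmod A C := Dkmod tens_dk_ax.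
End DK.
End TensorHopf.

Section TensorBicomodule.
Variables (k : fieldType) (H : hopfAlgType k) (A B D : comodalg H).
Variables (M : bicomod A B) (N : bicomod B D).
Notation T := (tens_bimod M N).

Lemma bc_dk_ax : is_dkmod (C := hquot_id H) (U := bm_left N) (@bc_coact _ _ _ _ N).
Proof. by split; [exact: bc_cm | exact: bc_lcoact]. Qed.

Definition bc_dk : dkmod B (hquot_id H) := Dkmod bc_dk_ax.

Definition tens_bc_coact : T -> T ⊗ H := tens_dk_coact (M := M) (V := bc_dk).

Lemma tens_bc_coactE m n :
  tens_bc_coact (rpure (bm_right M) (bm_left N) m n) =
  tprod (rpure (bm_right M) (bm_left N)) amul (bc_coact m) (bc_coact n).
Proof. exact: (@tens_dk_coactE _ _ _ _ M _ bc_dk). Qed.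

Lemma tens_bc_ax : is_bicomod tens_bc_coact.
Proof.
have [c l] := tens_dk_ax M bc_dk; split=> //.
move=> t d; move: t; have [rB _ _] := bm_rax N.
have [tL _ _] := c; have [tB _ _] := tens_rax M N; have mB := amul_bilin (s := H).
have pB := pure_bilin (@ract _ _ (bm_right M)) (@lact _ _ (bm_left N)).
apply: tens_ext => [||m n].
- exact: (lin_comp tL (tB.1 d)).
- exact: (lin_comp ((tprod_bilin tB mB).1 _) tL).
rewrite [bm_ract _ _]tens_ractE !tens_bc_coactE bc_rcoact.
apply: esym; apply: tprod_assoc => // *; first by rewrite [bm_ract _ _]tens_ractE.
by rewrite -amulA.
Qed.

Definition tens_bc : bicomod A D := Bicomod tens_bc_ax.
End TensorBicomodule.

Section Regular.
Variables (k : fieldType) (H : hopfAlgType k) (A : comodalg H).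

Lemma reg_assoc (a m b : A) : (a ∙ m) ∙ b = a ∙ (m ∙ b).
Proof. by rewrite amulA. Qed.

Definition reg_bimod : bimodule A A :=
  Bimodule (amul_lmodule A) (amul_rmodule A) reg_assoc.

Lemma reg_ax : is_bicomod (M := reg_bimod) (@ca_coact _ _ A).
Proof. by case: (ca_ax A) => c _ cM; split. Qed.

Definition reg_bc : bicomod A A := Bicomod reg_ax.
End Regular.

(* A ⊗_{A^co C} Q, with the coaction induced by that of A. *)
Section Induction.
Variables (k : fieldType) (H : hopfAlgType k) (C : hquot H) (A : comodalg H).
Variable Q : lmodule (coinv_alg C A).
Notation E := (ext_bimod C A).
Notation T := (rtens (bm_right E) Q).
Notation rhoC := (@coact _ _ (via C (ca_comod A))).

Definition ind_coact : T -> T ⊗ C :=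
  tlift (fun (a : A) q => kmap (fun a' : A => rpure (bm_right E) Q a' q) id (rhoC a)).

Let pB := pure_bilin (@ract _ _ (bm_right E)) (@lact _ _ Q).
Let rC : is_comodule rhoC. Proof. exact: cm_ax. Qed.
Let rL : linear rhoC. Proof. by case: rC. Qed.
Let aB : bilin (@hq_act _ _ C). Proof. by case: (hq_lmod C). Qed.
Let mB := amul_bilin (s := A).

Let iB : bilin (fun (a : A) q =>
  kmap (fun a' : A => rpure (bm_right E) Q a' q) (@id C) (rhoC a)).
Proof.
have kL q := kmap_linear (pB.1 q) (@lin_id _ C).
split=> [q|a]; first exact: (lin_comp (kL q) rL).
move=> u x y; elim/tens_ind: (rhoC a) => [|z z' e e'|m c].
- by rewrite !(lin0 (kL _)) scaler0 addr0.
- by rewrite !(linD (kL _)) e e' scalerDr addrACA.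
by rewrite !kmapE ?pB.2 ?kpureL //; apply: pB.1.
Qed.

Let iBal : balanced (@ract _ _ (bm_right E)) (@lact _ _ Q) (fun (a : A) q =>
  kmap (fun a' : A => rpure (bm_right E) Q a' q) (@id C) (rhoC a)).
Proof.
move=> a b q; have bE := coinvE b; have pL := hq_proj_linear C.
rewrite [rhoC _](@coinv_alg_coact _ _ C A a (val b)) bE tprod_pureR //.
rewrite (kmap_comp _ (pB.1 q) (@lin_id _ _) (mB.1 _) (aB.1 _)).
rewrite [rhoC _]/= (kmap_comp _ (pB.1 _) (@lin_id _ _) (@lin_id _ _) pL).
apply: eq_kmap => [a'|h]; last by rewrite -hq_proj_act amul1r.
exact: (@pure_balanced _ _ _ _ (@ract _ _ (bm_right E)) (@lact _ _ Q) a' b q).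
Qed.

Lemma ind_coactE (a : A) q : ind_coact (rpure (bm_right E) Q a q) =
  kmap (fun a' : A => rpure (bm_right E) Q a' q) id (rhoC a).
Proof. exact: tliftE. Qed.

Lemma ind_coact_linear : linear ind_coact.
Proof. exact: tlift_linear. Qed.

Lemma ind_ax : is_dkmod (U := tens_lmod E Q) ind_coact.
Proof.
have [_ rA r1] := rC; have tL := ind_coact_linear.
have dL := @comul_linear k C; have iL (V : lmodType k) := @lin_id k V.
have kL q := kmap_linear (pB.1 q) (iL C).
have pL q := pB.1 q.
split; [split=> // | ].
- apply: tens_ext => [||a q].
  + exact: (lin_comp (@tassoc_linear _ _ _ _)
      (lin_comp (kmap_linear tL (iL _)) tL)).
  + exact: (lin_comp (kmap_linear (iL _) dL) tL).
  rewrite ind_coactE.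
  transitivity (tassoc (kmap (kmap (fun a' : A => rpure (bm_right E) Q a' q) id)
      id (kmap rhoC id (rhoC a)))).
    congr tassoc; rewrite (kmap_comp _ tL (iL _) (pL q) (iL _)).
    rewrite (kmap_comp _ (kL q) (iL _) rL (iL _)).
    by apply: eq_kmap => // a'; apply: ind_coactE.
  transitivity (kmap (fun a' : A => rpure (bm_right E) Q a' q) id
      (kmap id comul (rhoC a))).
    have kkL := kmap_linear (kL q) (iL C).
    have klL := kmap_linear (pL q) (iL (C ⊗ C)%type).
    rewrite -rA; move: (kmap rhoC id (rhoC a)); apply: kext3 => [||x y z].
    + exact: (lin_comp (@tassoc_linear _ _ _ _) kkL).
    + exact: (lin_comp klL (@tassoc_linear _ _ _ _)).
    by rewrite tassocE !kmapE // tassocE.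
  rewrite (kmap_comp _ (pL q) (iL _) (iL _) dL).
  by rewrite (kmap_comp _ (iL _) dL (pL q) (iL _)).
- have eB (V : lmodType k) := counit_scale_bilin C V.
  apply: tens_ext => [||a q].
  + exact: (lin_comp (klift_linear (eB _)) tL).
  + by [].
  rewrite ind_coactE -[in RHS](r1 a); move: (rhoC a).
  apply: kext => [||x c].
  + exact: (lin_comp (klift_linear (eB _)) (kL q)).
  + exact: (lin_comp (pL q) (klift_linear (eB _))).
  by rewrite kmapE // !kliftE // (linZ (pL q)).
move=> a; have [tB _ _] := tens_lax E Q.
apply: tens_ext => [||b q].
- exact: (lin_comp tL (tB.2 a)).
- exact: (lin_comp ((tprod_bilin tB aB).2 _) tL).
rewrite [lact _ _]tens_lactE !ind_coactE.
have pLq := pL q.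
rewrite [rhoC _](@coinv_alg_coact _ _ C A a b) kmap_tprod //.
rewrite -[ca_coact a in RHS]kmap_id tprod_kmap //.
by apply: eq_tprod => // x y; rewrite [lact _ _]tens_lactE.
Qed.

Definition ind_dk : dkmod A C := Dkmod ind_ax.
End Induction.

Record category := Category {
  obj :> Type;
  hom : obj -> obj -> Type;
  idm : forall x, hom x x;
  compm : forall x y z, hom y z -> hom x y -> hom x z;
  compA : forall x y z t (f : hom z t) (g : hom y z) (h : hom x y),
    compm f (compm g h) = compm (compm f g) h;
  comp1m : forall x y (f : hom x y), compm (idm y) f = f;
  compm1 : forall x y (f : hom x y), compm f (idm x) = f }.

Record functor (C D : category) := Functor {
  fobj :> C -> D;
  fmap : forall x y : C, hom x y -> hom (fobj x) (fobj y);
  fmap1 : forall x, fmap (idm x) = idm (fobj x);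
  fmapM : forall (x y z : C) (f : hom y z) (g : hom x y),
    fmap (compm f g) = compm (fmap f) (fmap g) }.

Definition idF (C : category) : functor C C :=
  @Functor C C id (fun _ _ => id) (fun _ => erefl) (fun _ _ _ _ _ => erefl).

Section CompF.
Variables (C D E : category) (G : functor D E) (F : functor C D).
Lemma compF_1 x : fmap G (fmap F (idm x)) = idm (G (F x)).
Proof. by rewrite !fmap1. Qed.
Lemma compF_M (x y z : C) (f : hom y z) (g : hom x y) :
  fmap G (fmap F (compm f g)) = compm (fmap G (fmap F f)) (fmap G (fmap F g)).
Proof. by rewrite !fmapM. Qed.
Definition compF : functor C E :=
  @Functor C E (fun x => G (F x)) (fun x y f => fmap G (fmap F f)) compF_1 compF_M.
End CompF.

Definition is_iso (C : category) (x y : C) (f : hom x y) : Prop :=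
  exists g : hom y x, compm g f = idm x /\ compm f g = idm y.

Definition nat_iso (C D : category) (F G : functor C D) : Prop :=
  exists eta : forall x, hom (F x) (G x),
    (forall x y (f : hom x y),
       compm (eta y) (fmap F f) = compm (fmap G f) (eta x)) /\
    (forall x, is_iso (eta x)).

Definition inverse_equivalences (C D : category) (F : functor C D)
    (G : functor D C) : Prop :=
  nat_iso (compF F G) (idF D) /\ nat_iso (compF G F) (idF C).

Section ConcreteCategory.
Variables (T : Type) (car : T -> Type).
Variable P : forall x y : T, (car x -> car y) -> Prop.
Hypothesis P1 : forall x, P (@id (car x)).
Hypothesis PM : forall x y z (f : car y -> car z) (g : car x -> car y),
  P f -> P g -> P (fun u => f (g u)).

Record chom (x y : T) := CHom {
  chom_fun :> car x -> car y;
  chom_ax : P chom_fun }.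

Lemma chom_eq x y (f g : chom x y) : f =1 g -> f = g.
Proof.
case: f g => [f fP] [g gP] /= /funext e; case: g / e gP => gP.
by congr CHom; apply: Prop_irrelevance.
Qed.

Definition chom_comp x y z (f : chom y z) (g : chom x y) : chom x z :=
  CHom (PM (chom_ax f) (chom_ax g)).

Lemma chom_compA x y z t (f : chom z t) (g : chom y z) (h : chom x y) :
  chom_comp f (chom_comp g h) = chom_comp (chom_comp f g) h.
Proof. exact: chom_eq. Qed.
Lemma chom_comp1m x y (f : chom x y) : chom_comp (CHom (P1 y)) f = f.
Proof. exact: chom_eq. Qed.
Lemma chom_compm1 x y (f : chom x y) : chom_comp f (CHom (P1 x)) = f.
Proof. exact: chom_eq. Qed.

Definition concrete_cat : category :=
  Category chom_compA chom_comp1m chom_compm1.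
End ConcreteCategory.

Section LModCategory.
Variables (k : fieldType) (R : kalgType k).

Definition lmod_mor (X Y : lmodule R) (f : X -> Y) : Prop :=
  linear f /\ forall r x, f (lact r x) = lact r (f x).

Lemma lmod_mor1 X : lmod_mor (@id (X : lmodule R)).
Proof. by []. Qed.

Lemma lmod_morM (X Y Z : lmodule R) (f : Y -> Z) (g : X -> Y) :
  lmod_mor f -> lmod_mor g -> lmod_mor (fun x => f (g x)).
Proof.
move=> [fL fR] [gL gR]; split; first exact: lin_comp.
by move=> r x; rewrite gR fR.
Qed.

Definition lmod_cat : category := concrete_cat lmod_mor1 lmod_morM.
End LModCategory.

Section DKCategory.
Variables (k : fieldType) (H : hopfAlgType k) (A : comodalg H) (C : hquot H).

Definition dk_mor (U V : dkmod A C) (f : U -> V) : Prop :=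
  lmod_mor f /\ forall u, dk_coact (f u) = kmap f id (dk_coact u).

Lemma dk_mor1 U : dk_mor (@id (U : dkmod A C)).
Proof. by split=> // u; rewrite kmap_id. Qed.

Lemma dk_morM (U V W : dkmod A C) (f : V -> W) (g : U -> V) :
  dk_mor f -> dk_mor g -> dk_mor (fun u => f (g u)).
Proof.
move=> [fL fC] [gL gC]; split; first exact: lmod_morM.
move=> u; rewrite fC gC; case: fL gL => [fL _] [gL _].
by rewrite kmap_comp.
Qed.

Definition dk_cat : category := concrete_cat dk_mor1 dk_morM.
End DKCategory.

Section BicomodCategory.
Variables (k : fieldType) (H : hopfAlgType k) (A B : comodalg H).

Definition bicomod_mor (M N : bicomod A B) (f : M -> N) : Prop :=
  [/\ linear f, forall a m, f (bm_lact a m) = bm_lact a (f m),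
      forall m b, f (bm_ract m b) = bm_ract (f m) b &
      forall m, bc_coact (f m) = kmap f id (bc_coact m)].

Lemma bicomod_mor1 M : bicomod_mor (@id (M : bicomod A B)).
Proof. by split=> // m; rewrite kmap_id. Qed.

Lemma bicomod_morM (M N P : bicomod A B) (f : N -> P) (g : M -> N) :
  bicomod_mor f -> bicomod_mor g -> bicomod_mor (fun m => f (g m)).
Proof.
move=> [fL fl fr fC] [gL gl gr gC]; split.
- exact: lin_comp.
- by move=> a m; rewrite gl fl.
- by move=> m b; rewrite gr fr.
by move=> m; rewrite fC gC kmap_comp.
Qed.

Definition bicomod_cat : category := concrete_cat bicomod_mor1 bicomod_morM.
End BicomodCategory.

Section TensorFunctor.
Variables (k : fieldType) (A B : kalgType k) (P : bimodule A B).

Definition tens_fmap (X Y : lmodule B) (f : X -> Y) :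
    rtens (bm_right P) X -> rtens (bm_right P) Y :=
  rmap id f.

Section Mor.
Variables (X Y : lmodule B) (f : X -> Y).
Hypothesis fM : lmod_mor f.

Lemma tens_fmapE p x :
  tens_fmap f (rpure (bm_right P) X p x) = rpure (bm_right P) Y p (f x).
Proof. by case: fM => fL fR; apply: rmapE. Qed.

Lemma tens_fmap_linear : linear (tens_fmap f).
Proof. by case: fM => fL fR; apply: rmap_linear. Qed.

Lemma tens_fmap_mor :
  lmod_mor (X := tens_lmod P X) (Y := tens_lmod P Y) (tens_fmap f).
Proof.
have L := tens_fmap_linear; split=> // r.
apply: tens_ext => [||p x].
- exact: (lin_comp L (tens_lact_linear _)).
- exact: (lin_comp (tens_lact_linear _) L).
by rewrite [lact _ _]tens_lactE !tens_fmapE [lact _ _]tens_lactE.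
Qed.
End Mor.

Lemma tens_fmap_id X : tens_fmap (@id (X : lmodule B)) =1 id.
Proof.
have L := tens_fmap_linear (@lmod_mor1 _ _ X).
by apply: (tens_ext L) => // p x; rewrite tens_fmapE //; apply: lmod_mor1.
Qed.

Lemma tens_fmap_comp (X Y Z : lmodule B) (f : Y -> Z) (g : X -> Y) :
  lmod_mor f -> lmod_mor g ->
  tens_fmap (fun x => f (g x)) =1 (fun t => tens_fmap f (tens_fmap g t)).
Proof.
move=> fM gM; have fgM := lmod_morM fM gM.
apply: (tens_ext (tens_fmap_linear fgM)).
  exact: (lin_comp (tens_fmap_linear fM) (tens_fmap_linear gM)).
by move=> p x; rewrite !tens_fmapE.
Qed.

Definition tensF : functor (lmod_cat B) (lmod_cat A).
Proof.
refine (@Functor (lmod_cat B) (lmod_cat A) (tens_lmod P)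
  (fun X Y f => CHom (tens_fmap_mor (chom_ax f))) _ _).
- by move=> X; apply: chom_eq; apply: tens_fmap_id.
- move=> X Y Z f g; apply: chom_eq.
  exact: (tens_fmap_comp (chom_ax f) (chom_ax g)).
Defined.
End TensorFunctor.

Section HopfFunctors.
Variables (k : fieldType) (H : hopfAlgType k) (C : hquot H).

Let aB : bilin (@hq_act _ _ C). Proof. by case: (hq_lmod C). Qed.

Section TensDK.
Variables (A B : comodalg H) (M : bicomod A B).

Lemma tens_dk_mor (U V : dkmod B C) (f : U -> V) : dk_mor f ->
  dk_mor (U := tens_dk M U) (V := tens_dk M V) (tens_fmap (P := M) f).
Proof.
move=> [fM fC]; have [fL _] := fM; split; first exact: tens_fmap_mor.
have L := tens_fmap_linear (P := M) fM.
have [uL _ _] := dk_cm (tens_dk M U); have [vL _ _] := dk_cm (tens_dk M V).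
have pB (X : lmodule B) := pure_bilin (@ract _ _ (bm_right M)) (@lact _ _ X).
apply: tens_ext => [||m u].
- exact: (lin_comp vL L).
- exact: (lin_comp (kmap_linear L (@lin_id _ _)) uL).
rewrite tens_fmapE // [dk_coact _]tens_dk_coactE [dk_coact _ in RHS]tens_dk_coactE.
rewrite fC kmap_tprod // -[bc_coact m in LHS]kmap_id tprod_kmap //.
by apply: eq_tprod => // x y; rewrite tens_fmapE.
Qed.

Definition tens_dkF : functor (dk_cat B C) (dk_cat A C).
Proof.
refine (@Functor (dk_cat B C) (dk_cat A C) (@tens_dk _ _ _ _ M C)
  (fun X Y f => CHom (tens_dk_mor (chom_ax f))) _ _).
- by move=> X; apply: chom_eq; apply: tens_fmap_id.
- move=> X Y Z f g; apply: chom_eq.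
  exact: (tens_fmap_comp (proj1 (chom_ax f)) (proj1 (chom_ax g))).
Defined.
End TensDK.

Variable A : comodalg H.

Section CoinvMor.
Variables (U V : dkmod A C) (f : U -> V).
Hypothesis fM : dk_mor f.

Lemma coinv_fmap_subproof (u : coinv (dk_comod U)) :
  f (val u) \in @coinv_pred _ _ _ (dk_comod V).
Proof.
case: fM => [[fL _] fC]; apply/eqP; rewrite /= fC.
by rewrite [dk_coact _](coinvE u) kmapE.
Qed.

Definition coinv_fmap (u : coinv_lmod U) : coinv_lmod V :=
  Coinv (coinv_fmap_subproof u).

Lemma coinv_fmap_mor : lmod_mor coinv_fmap.
Proof.
case: fM => [[fL fR] _]; split=> [a x y|r x]; apply: val_inj.
  by rewrite val_linear /= fL.
by rewrite /= fR.
Qed.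
End CoinvMor.

Lemma coinv_fmap1 (U : dkmod A C) :
  coinv_fmap (dk_mor1 U) =1 @id (coinv_lmod U).
Proof. by move=> u; apply: val_inj. Qed.

Lemma coinv_fmapM (U V W : dkmod A C) (f : V -> W) (g : U -> V)
    (fM : dk_mor f) (gM : dk_mor g) :
  coinv_fmap (dk_morM fM gM) =1 (fun u => coinv_fmap fM (coinv_fmap gM u)).
Proof. by move=> u; apply: val_inj. Qed.

Definition coinvF : functor (dk_cat A C) (lmod_cat (coinv_alg C A)).
Proof.
refine (@Functor (dk_cat A C) (lmod_cat (coinv_alg C A)) (@coinv_lmod _ _ C A)
  (fun X Y f => CHom (coinv_fmap_mor (chom_ax f))) _ _).
- by move=> X; apply: chom_eq; apply: coinv_fmap1.
- move=> X Y Z f g; apply: chom_eq.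
  exact: (coinv_fmapM (chom_ax f) (chom_ax g)).
Defined.

Lemma ind_mor (X Y : lmodule (coinv_alg C A)) (f : X -> Y) : lmod_mor f ->
  dk_mor (U := ind_dk X) (V := ind_dk Y) (tens_fmap (P := ext_bimod C A) f).
Proof.
move=> fM; split; first exact: tens_fmap_mor.
have L := tens_fmap_linear (P := ext_bimod C A) fM.
have [uL _ _] := dk_cm (ind_dk X); have [vL _ _] := dk_cm (ind_dk Y).
have pB (Z : lmodule (coinv_alg C A)) :=
  pure_bilin (@ract _ _ (bm_right (ext_bimod C A))) (@lact _ _ Z).
apply: tens_ext => [||m u].
- exact: (lin_comp vL L).
- exact: (lin_comp (kmap_linear L (@lin_id _ _)) uL).
rewrite tens_fmapE // [dk_coact _]ind_coactE [dk_coact _ in RHS]ind_coactE.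
rewrite (kmap_comp _ L (@lin_id _ _) ((pB X).1 u) (@lin_id _ _)).
by apply: eq_kmap => // x; rewrite tens_fmapE.
Qed.

Definition indF : functor (lmod_cat (coinv_alg C A)) (dk_cat A C).
Proof.
refine (@Functor (lmod_cat (coinv_alg C A)) (dk_cat A C) (@ind_dk _ _ C A)
  (fun X Y f => CHom (ind_mor (chom_ax f))) _ _).
- by move=> X; apply: chom_eq; apply: tens_fmap_id.
- move=> X Y Z f g; apply: chom_eq.
  exact: (tens_fmap_comp (chom_ax f) (chom_ax g)).
Defined.

End HopfFunctors.

Section FaithfullyFlat.
Variables (k : fieldType) (R : kalgType k).

Definition exact_pair (X Y Z : lmodType k) (f : X -> Y) (g : Y -> Z) : Prop :=
  forall y, g y = 0 <-> exists x, f x = y.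

Definition rmod_mor (X Y : rmodule R) (f : X -> Y) : Prop :=
  linear f /\ forall x r, f (ract x r) = ract (f x) r.

Definition right_faithfully_flat (P : rmodule R) : Prop :=
  forall (X Y Z : lmodule R) (f : X -> Y) (g : Y -> Z),
    lmod_mor f -> lmod_mor g ->
    (exact_pair f g <->
     exact_pair (rmap id f : rtens P X -> rtens P Y)
           (rmap id g : rtens P Y -> rtens P Z)).

Definition left_faithfully_flat (P : lmodule R) : Prop :=
  forall (X Y Z : rmodule R) (f : X -> Y) (g : Y -> Z),
    rmod_mor f -> rmod_mor g ->
    (exact_pair f g <->
     exact_pair (rmap f id : rtens X P -> rtens Y P)
           (rmap g id : rtens Y P -> rtens Z P)).
End FaithfullyFlat.

Section Restriction.
Variables (k : fieldType) (K H : hopfAlgType k) (j : hopf_emb K H).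

Definition res_lact (x : K) (h : H) : H := j x ∙ h.

Lemma res_lax : is_lmodule res_lact.
Proof.
have [mL mR] := amul_bilin (s := H).
split=> [|h|r s h]; last by rewrite /res_lact heM amulA.
  by split=> u a x y; rewrite /res_lact ?he_linear ?mL ?mR.
by rewrite /res_lact he1 amul1l.
Qed.

Definition res_lmod : lmodule K := LModule res_lax.

(* The K-coaction rho on X^co C is the restriction of the H-coaction of X; rho
   is unique with this property, since val ⊗ j is injective over a field. *)
Definition restricts_coact (C : hquot H) (X : comodule H)
    (rho : coinv (via C X) -> coinv (via C X) ⊗ K) : Prop :=
  forall x, kmap val j (rho x) = coact (val x : X).

End Restriction.

Section Galois.
Variables (k : fieldType) (H : hopfAlgType k) (A : comodalg H).

(* a ⊗ b |-> a_[0] b ⊗ a_[1] *)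
Definition galois_can :
    rtens (ext_rmod (hquot_id H) A) (ext_lmod (hquot_id H) A) -> A ⊗ H :=
  tlift (fun a b : A => kmap (fun x => x ∙ b) id (ca_coact a)).

Lemma galois_canE (a b : A) :
  galois_can (rpure (ext_rmod (hquot_id H) A) (ext_lmod (hquot_id H) A) a b) =
  kmap (fun x => x ∙ b) id (ca_coact a).
Proof.
have mB := amul_bilin (s := A); have mHB := amul_bilin (s := H).
have [rL _ _] := ca_cm A; have [_ _ rM] := ca_ax A.
have kL c := kmap_linear (mB.1 c) (@lin_id _ H).
apply: (tliftE (f := fun a b : A => kmap (fun x => x ∙ b) id (ca_coact a))).
  split=> [c|{}a]; first exact: (lin_comp (kL c) rL).
  move=> u x y; elim/tens_ind: (ca_coact a) => [|z z' e e'|m h].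
  - by rewrite !(lin0 (kL _)) scaler0 addr0.
  - by rewrite !(linD (kL _)) e e' scalerDr addrACA.
  by rewrite !kmapE ?mB.2 ?kpureL //; apply: mB.1.
move=> x r y; rewrite rM (coinv_idP r).
rewrite tprod_pureR // (kmap_comp _ (mB.1 y) (@lin_id _ _) (mB.1 _) (mHB.1 _)).
by apply: eq_kmap => [z|h]; rewrite ?amul1r // -amulA.
Qed.

Definition right_ff_galois : Prop :=
  right_faithfully_flat (ext_rmod (hquot_id H) A) /\ bijective galois_can.
End Galois.

Section Morita.
Variables (k : fieldType) (H : hopfAlgType k) (A B : comodalg H).
Variables (M : bicomod A B) (N : bicomod B A).

Record morita_context := MoritaContext {
  mc_alpha : chom (@bicomod_mor _ _ A A) (tens_bc M N) (reg_bc A);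
  mc_beta : chom (@bicomod_mor _ _ B B) (tens_bc N M) (reg_bc B);
  mc_alphaP : forall (m m' : M) (n : N),
    bm_lact (mc_alpha (rpure (bm_right M) (bm_left N) m n)) m' =
    bm_ract m (mc_beta (rpure (bm_right N) (bm_left M) n m'));
  mc_betaP : forall (n n' : N) (m : M),
    bm_lact (mc_beta (rpure (bm_right N) (bm_left M) n m)) n' =
    bm_ract n (mc_alpha (rpure (bm_right M) (bm_left N) m n')) }.

Definition strict (c : morita_context) : Prop :=
  is_iso (mc_alpha c : hom (c := bicomod_cat A A) _ _) /\
  is_iso (mc_beta c : hom (c := bicomod_cat B B) _ _).
End Morita.

(* Main.v *)
Require Import Defs.
From HB Require Import structures.
From mathcomp Require Import all_boot all_algebra.
From mathcomp Require Import boolp.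
From mathcomp Require classical_sets.
Set Implicit Arguments. Unset Strict Implicit. Unset Printing Implicit Defensive.
Import GRing.Theory.
Local Open Scope ring_scope.

(** Write C for the quotient H/HK^+, R for the H-coinvariants of A, A0 for its
    C-coinvariants, and U^co for the C-coinvariants of U.

    The theorem rests on a structure theorem, for A and for B: A ⊗_A0 - and
    (-)^co are inverse equivalences between the left A0-modules and the
    Doi-Hopf modules over A and C.  It has two ingredients, both built from the
    translation map γ(h) = l(h) ⊗ r(h) in A ⊗_R A, the preimage of 𝟙 ⊗ h under
    the Galois map.

    - For each A-module V the map a ⊗ v |-> a_[0] v ⊗ a_[1] from A ⊗_A0 V to
      V ⊗ C is bijective [canC_bijective].  Its inverse sends v ⊗ h to
      l(h) ⊗ r(h) v; that this only depends on the class of h comes from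
      γ(x) being in A ⊗_R A0 for x in K, which is where A is flat over R.
    - A is faithfully flat over A0 [ext_faithfully_flat].  Through γ, the
      algebra K acts on A ⊗_R X from the right, and (A ⊗_R X) ⊗_K H is
      A ⊗_R (A ⊗_A0 X), naturally in the A0-module X.  So exactness over A0 is
      tested by tensoring with A over R and with H over K.

    Now U^co is the kernel of u |-> ρ(u) - u ⊗ 𝟙, a map which is A0-linear for
    the diagonal action on U ⊗ C.  Tensoring with A and using the Galois
    bijections turns it into the kernel of the cobar differential of U, which
    is U itself; thus A ⊗_A0 U^co = U [coinv_counit_bijective].  The unit is
    then bijective by the triangle identity and faithful flatness
    [coinv_unit_bijective].

    The squares follow.  As N is B ⊗_B0 N^co by the structure theorem for B,
    N ⊗_A (A ⊗_A0 Q) = N ⊗_A0 Q = B ⊗_B0 (N^co ⊗_A0 Q) [lambda_bijective]; the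
    square with coinvariants is this one conjugated by the equivalences
    [coinv_tens_nat_iso].  The second assertion is
    M ⊗_B (N ⊗_A U) = (M ⊗_B N) ⊗_A U = U, through α [morita_bijective].

    For the first assertion, faithfully flat descent along K -> H gives
    H^co = K [coinv_hopf_subalgebra], so that the coaction of H sends
    coinvariants into X ⊗ K, and in fact into X^co ⊗ K.  All axioms of the
    restricted structures hold because they hold after the injection of
    X^co ⊗ K into X ⊗ H.  The restriction of α is bijective because
    A ⊗_A0 - turns it into α [coinv_alpha_bijective]. *)

(** * Linear algebra over a field *)

Section PartialLinear.
Variables (k : fieldType) (W V : lmodType k).
Implicit Types X Y : W * V -> Prop.

(** Partial linear maps are represented by their graphs, subspaces of W * V. *)
Definition lin_closed X := forall a x y, X x -> X y ->
  X (a *: x.1 + y.1, a *: x.2 + y.2).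
Definition partial_fun X := forall v, X (0, v) -> v = 0.

(** Zorn's lemma on the graphs contained in P. Allowing P to be a relation
    gives both the extension of a partial map (P total) and the existence of a
    linear section (P the converse of a linear map). *)
Lemma partial_linear_extension (P G : W * V -> Prop) :
  lin_closed P -> lin_closed G -> partial_fun G -> G (0, 0) ->
  (forall x, G x -> P x) ->
  exists G', [/\ lin_closed G', partial_fun G', forall x, G x -> G' x,
    forall x, G' x -> P x & forall w v, P (w, v) -> exists v', G' (w, v')].
Proof.
move=> PL GL Gf G0 GP.
(* The union with G keeps the empty chain harmless. *)
pose U X x := X x \/ G x.
pose good X := [/\ lin_closed (U X), partial_fun (U X) & forall x, X x -> P x].
have [F Fgood Ftot|X [[XL Xf XP] Xmax]] :=
    @classical_sets.Zorn_bigcup (W * V)%type good.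
  have pick x y : U (classical_sets.bigcup F id) x ->
      U (classical_sets.bigcup F id) y ->
      (G x /\ G y) \/ exists2 X, F X & U X x /\ U X y.
    move=> [[X FX Xx]|Gx] [[Y FY Yy]|Gy].
    - right; case: (Ftot X Y FX FY) => s.
        by exists Y => //; split; left=> //; apply: s.
      by exists X => //; split; left=> //; apply: s.
    - by right; exists X => //; split; [left|right].
    - by right; exists Y => //; split; [right|left].
    - by left.
  split=> [a x y Ux Uy|v Uv|x [X /Fgood [_ _ XP] /XP //]].
    case: (pick x y Ux Uy) => [[Gx Gy]|[X FX [Xx Xy]]]; first by right; apply: GL.
    have [XL _ _] := Fgood _ FX.
    by case: (XL a x y Xx Xy) => ?; [left; exists X|right].
  case: (pick _ _ Uv Uv) => [[Gx _]|[X FX [Xx _]]]; first exact: Gf.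
  by have [_ Xf _] := Fgood _ FX; apply: Xf.
exists (U X); split=> //; [by right | by move=> x [/XP|/GP] | move=> w v Pwv].
apply: contrapT => now; pose Y x := exists a y, U X y /\
  x = (a *: w + y.1, a *: v + y.2).
have XY x : U X x -> Y x.
  by case: x => x1 x2 Xx; exists 0, (x1, x2); rewrite !scale0r !add0r.
have UX0 : U X (0, 0) by right.
apply: (Xmax Y).
  rewrite classical_sets.properEneq; split; last by move=> x Xx; apply: XY; left.
  apply/eqP => e; apply: now; exists v; left; rewrite e.
  by exists 1, (0, 0); rewrite !scale1r !addr0.
have YL : lin_closed Y.
  move=> a x y [b [x' [Xx ->]]] [c [y' [Xy ->]]] /=.
  exists (a * b + c), (a *: x'.1 + y'.1, a *: x'.2 + y'.2); split; first exact: XL.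
  by rewrite /= !scalerDr !scalerDl !scalerA ![_ + (c *: _ + _)]addrACA.
have UY x : U Y x -> Y x by case=> // Gx; apply: XY; right.
split=> [a x y /UY Yx /UY Yy|u /UY [a [[y1 y2] [Xy]]] [] ew ev|_ [a [y [Xy ->]]]].
- by left; apply: YL.
- have [a0|a0] := eqVneq a 0.
    by move: ew ev; rewrite a0 !scale0r !add0r => ew ->; apply: Xf; rewrite ew.
  case: now; exists (- a^-1 *: y2).
  have := XL (- a^-1) _ _ Xy UX0; rewrite /= !addr0.
  suff -> : - a^-1 *: y1 = w by [].
  have -> : y1 = - (a *: w) by apply/eqP; rewrite -addr_eq0 addrC -ew.
  by rewrite scalerN scaleNr opprK scalerA mulVf // scale1r.
apply: (PL a (w, v) y Pwv); by case: Xy => [/XP|/GP].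
Qed.
End PartialLinear.

(** [id - g f] is then a projection onto the kernel of f, and this is preserved
    by tensoring with any space: it is how kernels and images are handled in
    tensor products below. *)
Lemma linear_generalized_inverse (k : fieldType) (V W : lmodType k) (f : V -> W) :
  linear f -> exists2 g : W -> V, linear g & forall v, f (g (f v)) = f v.
Proof.
move=> fL.
(* first a section of f on its image, then an extension of it to W *)
have [|||||G [GL Gf G0 GP Gd]] := @partial_linear_extension k W V
    (fun x => f x.2 = x.1) (fun x => x = (0, 0)).
- by move=> a x y ex ey; rewrite /= fL ex ey.
- by move=> a x y -> ->; rewrite /= !scaler0 !addr0.
- by move=> v [].
- by [].
- by move=> x ->; apply: lin0 fL.
have [|||||G' [GL' Gf' GG' _ Gd']] := @partial_linear_extension k W V
    (fun=> True) G => //; first exact: G0.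
have /choice [g gP] (w : W) : exists v, G' (w, v) by apply: (Gd' w 0).
have guniq w v : G' (w, v) -> v = g w.
  move=> Gwv; apply/eqP; rewrite -subr_eq0 addrC -scaleN1r.
  apply/eqP/Gf'; have := GL' (-1) _ _ (gP w) Gwv; by rewrite /= !scaleN1r addNr.
exists g.
  move=> a x y; exact/esym/guniq/(GL' a _ _ (gP x) (gP y)).
move=> v;have [v' Gv'] := Gd (f v) v erefl.
by rewrite -(guniq _ _ (GG' _ Gv')) (GP _ Gv').
Qed.

Lemma linear_retraction (k : fieldType) (V W : lmodType k) (f : V -> W) :
  linear f -> injective f -> exists2 g : W -> V, linear g & cancel f g.
Proof.
move=> fL fI; have [g gL gE] := linear_generalized_inverse fL.
by exists g => // v; apply: fI.
Qed.

Lemma kmap_inj (k : fieldType) (M N P Q : lmodType k) (f : M -> P) (g : N -> Q) :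
  linear f -> linear g -> injective f -> injective g -> injective (kmap f g).
Proof.
move=> fL gL fI gI.
have [f' fL' fK] := linear_retraction fL fI.
have [g' gL' gK] := linear_retraction gL gI.
apply: (can_inj (g := kmap f' g')) => x; rewrite kmap_comp //.
by rewrite (eq_kmap (f' := id) (g' := id)) ?kmap_id.
Qed.

(** * Sweedler's calculus *)

(** Sweedler sums: [Σ_(m ⊗ n <- x) f m n] is f(m, n) summed over a presentation
    of x as a sum of pure tensors.  An identity is proved by rewriting the
    summand, once the summands are known to be multilinear. *)
Notation "Σ_( m ⊗ n <- x ) E" := (tlift (fun m n => E) x)
  (at level 41, m name, n name, x at level 100, E at level 41,
   format "Σ_( m  ⊗  n  <-  x )  E") : ring_scope.

Section LinearRules.
Variable k : fieldType.
Implicit Types M N U V W : lmodType k.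

Lemma linear_add U V (f g : U -> V) :
  linear f -> linear g -> linear (fun x => f x + g x).
Proof. by move=> fL gL a x y; rewrite fL gL scalerDr addrACA. Qed.

Lemma linear_opp U V (f : U -> V) : linear f -> linear (fun x => - f x).
Proof. by move=> fL a x y; rewrite fL opprD scalerN. Qed.

Lemma linear_scale U V b (f : U -> V) : linear f -> linear (fun x => b *: f x).
Proof. by move=> fL a x y; rewrite fL scalerDr !scalerA mulrC. Qed.

Lemma linear_counit_scale (C : coalgType k) U V (f : U -> C) (v : V) :
  linear f -> linear (fun x => counit (f x) *: v).
Proof. by move=> fL; apply: (lin_comp ((counit_scalel_bilin C V).1 v) fL). Qed.

Lemma linear_tlift_param (T : Type) U M N V (ra : M -> T -> M) (la : T -> N -> N)
    (F : U -> M -> N -> V) (t : tens ra la) :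
  (forall x, bilin (F x)) -> (forall x, balanced ra la (F x)) ->
  (forall m n, linear (fun x => F x m n)) -> linear (fun x => tlift (F x) t).
Proof.
move=> FB Fb FL a x y; have L u := tlift_linear (FB u) (Fb u).
elim/tens_ind: t => [|t t' e e'|m n].
- by rewrite !(lin0 (L _)) scaler0 addr0.
- by rewrite !(linD (L _)) e e' scalerDr addrACA.
by rewrite !tliftE // FL.
Qed.

Lemma linear_klift_param U M N V (F : U -> M -> N -> V) (t : M ⊗ N) :
  (forall x, bilin (F x)) -> (forall m n, linear (fun x => F x m n)) ->
  linear (fun x => tlift (F x) t).
Proof. by move=> FB; apply: linear_tlift_param => // x; apply: bilin_balanced. Qed.
End LinearRules.

Section BilinearOperations.
Variables (k : fieldType) (R S : kalgType k).
Lemma lact_bilin (X : lmodule R) : bilin (@lact _ _ X).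
Proof. by case: (lm_ax X). Qed.
Lemma lact1 (X : lmodule R) (x : X) : lact 𝟙 x = x.
Proof. by case: (lm_ax X). Qed.
Lemma lactA (X : lmodule R) r s (x : X) : lact (r ∙ s) x = lact r (lact s x).
Proof. by case: (lm_ax X) => _ _ ->. Qed.
Lemma ract_bilin (X : rmodule R) : bilin (@ract _ _ X).
Proof. by case: (rm_ax X). Qed.
Lemma bm_lact_bilin (X : bimodule R S) : bilin (@bm_lact _ _ _ X).
Proof. by case: (bm_lax X). Qed.
Lemma bm_ract_bilin (X : bimodule R S) : bilin (@bm_ract _ _ _ X).
Proof. by case: (bm_rax X). Qed.
End BilinearOperations.

Section CoactionLinear.
Variables (k : fieldType) (H : hopfAlgType k) (A B : comodalg H) (C : hquot H).
Lemma hq_act_bilin : bilin (@hq_act _ _ C).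
Proof. by case: (hq_lmod C). Qed.
Lemma hq_act1 c : hq_act (𝟙 : H) c = c :> C.
Proof. by case: (hq_lmod C). Qed.
Lemma hq_actA g h c : hq_act (g ∙ h) c = hq_act g (hq_act h c) :> C.
Proof. by case: (hq_lmod C) => _ _ ->. Qed.
Lemma coact_linear (D : coalgType k) (X : comodule D) : linear (@coact _ _ X).
Proof. by case: (cm_ax X). Qed.
Lemma ca_coact_linear : linear (@ca_coact _ _ A).
Proof. by case: (ca_cm A). Qed.
Lemma bc_coact_linear (M : bicomod A B) : linear (@bc_coact _ _ _ _ M).
Proof. by case: (bc_cm M). Qed.
Lemma dk_coact_linear (U : dkmod A C) : linear (@dk_coact _ _ _ _ U).
Proof. by case: (dk_cm U). Qed.
End CoactionLinear.

Create HintDb lin.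
#[local] Hint Resolve lin_id : lin.
#[local] Hint Extern 1 (GRing.linear_for _ antipode) => exact: antipode_linear : lin.
#[local] Hint Extern 1 (GRing.linear_for _ comul) => exact: comul_linear : lin.
#[local] Hint Extern 1 (GRing.linear_for _ (hq_proj _)) => exact: hq_proj_linear : lin.
#[local] Hint Extern 1 (GRing.linear_for _ (he_fun _)) => exact: he_linear : lin.
#[local] Hint Extern 1 (GRing.linear_for _ (@coact _ _ _)) => exact: coact_linear : lin.
#[local] Hint Extern 1 (GRing.linear_for _ (@ca_coact _ _ _)) => exact: ca_coact_linear : lin.
#[local] Hint Extern 1 (GRing.linear_for _ (@bc_coact _ _ _ _ _)) => exact: bc_coact_linear : lin.
#[local] Hint Extern 1 (GRing.linear_for _ (@dk_coact _ _ _ _ _)) => exact: dk_coact_linear : lin.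
#[local] Hint Extern 1 (GRing.linear_for _ (@tassoc _ _ _ _)) => exact: tassoc_linear : lin.
#[local] Hint Extern 1 (GRing.linear_for _ \val) => exact: val_linear : lin.
#[local] Hint Extern 1 (GRing.linear_for _ (kmap _ _)) => apply: kmap_linear : lin.
#[local] Hint Extern 1 (bilin amul) => exact: amul_bilin : lin.
#[local] Hint Extern 1 (bilin (@lact _ _ _)) => exact: lact_bilin : lin.
#[local] Hint Extern 1 (bilin (@ract _ _ _)) => exact: ract_bilin : lin.
#[local] Hint Extern 1 (bilin (@bm_lact _ _ _ _)) => exact: bm_lact_bilin : lin.
#[local] Hint Extern 1 (bilin (@bm_ract _ _ _ _)) => exact: bm_ract_bilin : lin.
#[local] Hint Extern 1 (bilin (@hq_act _ _ _)) => exact: hq_act_bilin : lin.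
#[local] Hint Extern 1 (bilin (pure _ _)) => exact: pure_bilin : lin.
#[local] Hint Extern 1 (bilin (tprod _ _)) => apply: tprod_bilin : lin.

(** [lin] proves that an expression is linear in a variable, or bilinear in two,
    by descending through its head symbols. *)
Ltac lin_app :=
  match goal with
  | |- @GRing.linear_for _ _ _ _ (fun x => ?g (@?E x)) =>
      refine (@lin_comp _ _ _ _ g E _ _);
      [first [solve [auto with lin nocore]
             | match g with ?op ?a =>
                 let B := fresh "B" in
                 have B : bilin op; [solve [auto with lin nocore] | exact: (proj2 B a)] end
             | idtac] |]
  | |- @GRing.linear_for _ _ _ _ (fun x => ?op (@?E x) ?b) =>
      let B := fresh "B" in
      have B : bilin op; [solve [auto with lin nocore]|];
      refine (@lin_comp _ _ _ _ (fun y => op y b) E (proj1 B b) _); clear B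
  | |- @GRing.linear_for _ _ _ _ _ => solve [auto with lin nocore]
  end.

Ltac lin_step :=
  match goal with
  | |- forall _, _ => intro
  | |- bilin ?f => first [solve [auto with lin nocore] | split; intro; cbv beta]
  | |- @GRing.linear_for _ _ _ _ (fun x => x) => exact: lin_id
  | |- @GRing.linear_for _ _ _ _ (fun x => @?f x + @?g x) =>
      refine (@linear_add _ _ _ f g _ _)
  | |- @GRing.linear_for _ _ _ _ (fun x => - @?f x) => refine (@linear_opp _ _ _ f _)
  | |- @GRing.linear_for _ _ _ _ (fun x => ?a *: @?f x) =>
      refine (@linear_scale _ _ _ a f _)
  | |- @GRing.linear_for _ _ _ _ (fun x => counit (@?f x) *: ?v) =>
      refine (@linear_counit_scale _ _ _ _ f v _)
  | |- @GRing.linear_for _ _ _ _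
        (fun x => @tlift _ _ _ _ (@rscale _ _) (@lscale _ _) _ ?F (@?E x)) =>
      refine (@lin_comp _ _ _ _ (tlift F) E (klift_linear _) _)
  | |- @GRing.linear_for _ _ _ _
        (fun x => @tlift _ _ _ _ (@rscale _ _) (@lscale _ _) _ (@?F x) ?t) =>
      refine (@linear_klift_param _ _ _ _ _ F t _ _)
  | |- @GRing.linear_for _ _ _ _ (fun x => kmap (@?F x) (@?G x) ?t) => unfold kmap
  | |- @GRing.linear_for _ _ _ _ (fun x => @tlift _ _ _ _ _ _ _ ?F (@?E x)) =>
      refine (@lin_comp _ _ _ _ (tlift F) E (tlift_linear _ _) _)
  | |- @GRing.linear_for _ _ _ _ (fun x => @tlift _ _ _ _ _ _ _ (@?F x) ?t) =>
      refine (@linear_tlift_param _ _ _ _ _ _ _ _ F t _ _ _)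
  | |- _ => lin_app
  end.
Ltac lin := do ?lin_step; auto with lin nocore.


Section SumRules.
Variable k : fieldType.
Implicit Types M N P Q U V W : lmodType k.

Section Any.
Variables (T : Type) (M N P Q : lmodType k) (ra : M -> T -> M) (la : T -> N -> N).
Implicit Types (f : M -> N -> P) (t : tens ra la).

Lemma eq_tlift f f' t : (forall m n, f m n = f' m n) -> tlift f t = tlift f' t.
Proof. by move=> e; congr tlift; apply/funext => m; apply/funext => n; exact: e. Qed.

Lemma tlift_lin f (h : P -> Q) t : bilin f -> balanced ra la f -> linear h ->
  h (tlift f t) = Σ_(m ⊗ n <- t) h (f m n).
Proof.
move=> fB fb hL; have hB := lin_bilin hL fB.
have hb : balanced ra la (fun m n => h (f m n)) by move=> m r n; rewrite fb.
move: t; apply: tens_ext => [||m n]; last by rewrite !tliftE.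
  exact: (lin_comp hL (tlift_linear fB fb)).
exact: tlift_linear.
Qed.

Lemma tlift_pure t : Σ_(m ⊗ n <- t) pure ra la m n = t.
Proof.
have pB := pure_bilin ra la; have pb := pure_balanced ra la.
move: t; apply: tens_ext => [||m n]; [exact: tlift_linear|exact: lin_id|].
by rewrite tliftE.
Qed.
End Any.

Lemma tlift_rmap (T : Type) M N P M' N' (ra : M -> T -> M) (la : T -> N -> N)
    (ra' : M' -> T -> M') (la' : T -> N' -> N') (u : M -> M') (v : N -> N')
    (f : M' -> N' -> P) (t : tens ra la) :
  linear u -> linear v -> (forall m r, u (ra m r) = ra' (u m) r) ->
  (forall r n, v (la r n) = la' r (v n)) ->
  bilin f -> balanced ra' la' f ->
  Σ_(m ⊗ n <- (rmap u v t : tens ra' la')) f m n = Σ_(m ⊗ n <- t) f (u m) (v n).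
Proof.
move=> uL vL ur vr fB fb.
have B : bilin (fun m n => pure ra' la' (u m) (v n)) by exact: (bilin_comp (pure_bilin _ _)).
have b : balanced ra la (fun m n => pure ra' la' (u m) (v n)).
  by move=> m r n; rewrite ur vr pure_balanced.
rewrite /rmap (tlift_lin _ B b (tlift_linear fB fb)).
by apply: eq_tlift => m n; rewrite tliftE.
Qed.

Lemma klift_lin M N P Q (f : M -> N -> P) (h : P -> Q) (x : M ⊗ N) :
  bilin f -> linear h -> h (tlift f x) = Σ_(m ⊗ n <- x) h (f m n).
Proof. by move=> fB; apply: tlift_lin => //; apply: bilin_balanced. Qed.

Lemma klift_kmap M N M' N' P (u : M -> M') (v : N -> N') (f : M' -> N' -> P)
    (x : M ⊗ N) :
  linear u -> linear v -> bilin f ->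
  Σ_(m ⊗ n <- kmap u v x) f m n = Σ_(m ⊗ n <- x) f (u m) (v n).
Proof.
move=> uL vL fB; rewrite /kmap (klift_lin (h := tlift f)); first last.
- exact: klift_linear.
- by lin.
by apply: eq_tlift => m n; rewrite kliftE.
Qed.

Lemma klift_tprod M N P Q U V W (u : M -> N -> P) (v : Q -> U -> V)
    (f : P -> V -> W) (x : M ⊗ Q) (y : N ⊗ U) :
  bilin u -> bilin v -> bilin f ->
  Σ_(p ⊗ w <- tprod u v x y) f p w =
  Σ_(m ⊗ q <- x) Σ_(n ⊗ z <- y) f (u m n) (v q z).
Proof.
move=> uB vB fB; have L := klift_linear fB.
have B2 m q : bilin (fun n z => u m n ⊗ v q z) by lin.
rewrite /tprod (klift_lin (h := tlift f)) //; last by lin.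
apply: eq_tlift => m q; rewrite (klift_lin (h := tlift f)) //.
by apply: eq_tlift => n z; rewrite kliftE.
Qed.

Lemma klift_klift M N P Q U (g : M -> N -> P ⊗ Q) (f : P -> Q -> U)
    (x : M ⊗ N) :
  bilin g -> bilin f ->
  Σ_(p ⊗ q <- Σ_(m ⊗ n <- x) g m n) f p q =
  Σ_(m ⊗ n <- x) Σ_(p ⊗ q <- g m n) f p q.
Proof. by move=> gB fB; apply: klift_lin => //; apply: klift_linear. Qed.

Lemma klift_swap M N P Q W (F : M -> N -> P -> Q -> W) (x : M ⊗ N) (y : P ⊗ Q) :
  (forall m n, bilin (F m n)) -> (forall p q, bilin (fun m n => F m n p q)) ->
  Σ_(m ⊗ n <- x) Σ_(p ⊗ q <- y) F m n p q =
  Σ_(p ⊗ q <- y) Σ_(m ⊗ n <- x) F m n p q.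
Proof.
move=> B1 B2.
have l m p q : linear (fun n => F m n p q) := (B2 p q).2 m.
have l' n p q : linear (fun m => F m n p q) := (B2 p q).1 n.
have l1 m n q : linear (fun p => F m n p q) := (B1 m n).1 q.
have l2 m n p : linear (fun q => F m n p q) := (B1 m n).2 p.
move: x; apply: tens_ext => [||m n].
- apply: klift_linear; split=> ?; apply: linear_klift_param => //.
- apply: linear_klift_param => // ?; last by move=> ?; apply: klift_linear.
  split=> ?; apply: linear_klift_param => //.
rewrite kliftE; last by split=> ?; apply: linear_klift_param.
by apply: eq_tlift => p q; rewrite kliftE.
Qed.

Definition trilin M N P Q (F : M -> N -> P -> Q) : Prop :=
  [/\ forall n p, linear (fun m => F m n p), forall m p, linear (fun n => F m n p) &
      forall m n, linear (fun p => F m n p)].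

Lemma klift_tassoc M N P Q (F : M -> N -> P -> Q) (x : (M ⊗ N) ⊗ P) :
  trilin F ->
  Σ_(y ⊗ p <- x) Σ_(m ⊗ n <- y) F m n p =
  Σ_(m ⊗ z <- tassoc x) Σ_(n ⊗ p <- z) F m n p.
Proof.
move=> [F1 F2 F3].
have B1 p : bilin (fun m n => F m n p) by split.
have B2 m : bilin (fun n p => F m n p) by split.
have L1 : linear (fun x : (M ⊗ N) ⊗ P => Σ_(y ⊗ p <- x) Σ_(m ⊗ n <- y) F m n p).
  by lin.
have B3 : bilin (fun m (z : N ⊗ P) => Σ_(n ⊗ p <- z) F m n p) by lin.
move: x; apply: kext3 => //; first by lin.
move=> m n p; rewrite tassocE !kliftE //.
by lin.
Qed.

(** Coassociativity, in the form that justifies writing x_[0] ⊗ x_[1] ⊗ x_[2]. *)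
Lemma coact_sum (C : coalgType k) (X : comodule C) P (F : X -> C -> C -> P) (x : X) :
  trilin F ->
  Σ_(y ⊗ c <- coact x) Σ_(y0 ⊗ y1 <- coact y) F y0 y1 c =
  Σ_(y ⊗ c <- coact x) Σ_(c1 ⊗ c2 <- comul c) F y c1 c2.
Proof.
move=> F3; have [rL rA _] := cm_ax X; have [F1 F2 F3'] := F3.
have e := klift_tassoc (kmap (@coact _ _ X) id (coact x)) F3.
rewrite rA in e.
by rewrite !klift_kmap // in e; lin.
Qed.

Lemma coact_counit (C : coalgType k) (X : comodule C) P (f : X -> P) (x : X) :
  linear f -> Σ_(y ⊗ c <- coact x) counit c *: f y = f x.
Proof.
move=> fL; have [_ _ r1] := cm_ax X; rewrite -[in RHS](r1 x).
rewrite (klift_lin (h := f)) //; last exact: counit_scale_bilin.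
by apply: eq_tlift => y c; rewrite (linZ fL).
Qed.

Section Comul.
Variables (C : coalgType k) (P : lmodType k).
Implicit Types (f : C -> P) (c : C).

Lemma comul_sum (F : C -> C -> C -> P) c : trilin F ->
  Σ_(d ⊗ e <- comul c) Σ_(d1 ⊗ d2 <- comul d) F d1 d2 e =
  Σ_(d ⊗ e <- comul c) Σ_(e1 ⊗ e2 <- comul e) F d e1 e2.
Proof.
have cax : is_comodule (@comul _ C).
  by split; [exact: comul_linear | exact: comulA | exact: counitr].
exact: (@coact_sum C (Comodule cax)).
Qed.

Lemma comul_counitl f c : linear f -> Σ_(d ⊗ e <- comul c) counit d *: f e = f c.
Proof.
move=> fL; rewrite -[in RHS](counitl c).
rewrite (klift_lin (h := f)) //; last exact: counit_scalel_bilin.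
by apply: eq_tlift => y d; rewrite (linZ fL).
Qed.

Lemma comul_counitr f c : linear f -> Σ_(d ⊗ e <- comul c) counit e *: f d = f c.
Proof.
move=> fL; rewrite -[in RHS](counitr c).
rewrite (klift_lin (h := f)) //; last exact: counit_scale_bilin.
by apply: eq_tlift => y d; rewrite (linZ fL).
Qed.
End Comul.
End SumRules.

Lemma klift_sub (k : fieldType) (M N P : lmodType k) (f g : M -> N -> P) (x : M ⊗ N) :
  bilin f -> bilin g ->
  Σ_(m ⊗ n <- x) (f m n - g m n) = Σ_(m ⊗ n <- x) f m n - Σ_(m ⊗ n <- x) g m n.
Proof.
move=> fB gB; have L := klift_linear fB; have L' := klift_linear gB.
have BB : bilin (fun m n => f m n - g m n).
  by split=> ?; apply: linear_add; [exact: fB.1|exact/linear_opp/gB.1|exact: fB.2|exact/linear_opp/gB.2].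
move: x; apply: kext => [||m n]; [exact: klift_linear| |by rewrite !kliftE].
exact: (linear_add L (linear_opp L')).
Qed.

Lemma tassoc_kmap (k : fieldType) (M N P M' N' P' : lmodType k) (f : M -> M')
    (g : N -> N') (h : P -> P') (x : (M ⊗ N) ⊗ P) : linear f -> linear g -> linear h ->
  kmap f (kmap g h) (tassoc x) = tassoc (kmap (kmap f g) h x).
Proof.
move=> fL gL hL; have fgL := kmap_linear fL gL; have ghL := kmap_linear gL hL.
move: x; apply: kext3 => [||y z t].
- exact: (lin_comp (kmap_linear fL ghL) (@tassoc_linear _ _ _ _)).
- exact: (lin_comp (@tassoc_linear _ _ _ _) (kmap_linear fgL hL)).
by rewrite tassocE !kmapE // tassocE.
Qed.

(** * The antipode is an anti-morphism *)
Section Antipode.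
Variables (k : fieldType) (H : hopfAlgType k).
Implicit Types g h : H.

Lemma amulZl (A : kalgType k) a (x y : A) : (a *: x) ∙ y = a *: (x ∙ y).
Proof. exact: (linZ ((amul_bilin (s := A)).1 y)). Qed.

Lemma antipode_sum (P : lmodType k) (f : H -> P) h : linear f ->
  Σ_(h1 ⊗ h2 <- comul h) f (antipode h1 ∙ h2) = counit h *: f 𝟙.
Proof.
move=> fL; rewrite -(linZ fL) -(antipodel h) (klift_lin (h := f)) //.
by lin.
Qed.

Lemma sum_antipode (P : lmodType k) (f : H -> P) h : linear f ->
  Σ_(h1 ⊗ h2 <- comul h) f (h1 ∙ antipode h2) = counit h *: f 𝟙.
Proof.
move=> fL; rewrite -(linZ fL) -(antipoder h) (klift_lin (h := f)) //.
by lin.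
Qed.

Lemma antipode1 : antipode (𝟙 : H) = 𝟙.
Proof.
have := antipodel (𝟙 : H); rewrite comul1 kliftE; last by lin.
by rewrite amul1r counit1 scale1r.
Qed.

(** Insert h_(2) S(h_(3)) behind g_(2): what precedes S(h_(3)) becomes
    S(g_(1) h_(1)) g_(2) h_(2). *)
Lemma antipode_mul_cancel g h :
  Σ_(g1 ⊗ g2 <- comul g) antipode (g1 ∙ h) ∙ g2 = counit g *: antipode h.
Proof.
transitivity (Σ_(h1 ⊗ h2 <- comul h) Σ_(h11 ⊗ h12 <- comul h1)
   Σ_(g1 ⊗ g2 <- comul g) (antipode (g1 ∙ h11) ∙ (g2 ∙ h12)) ∙ antipode h2).
  rewrite comul_sum; last by split; lin.
  transitivity (Σ_(h1 ⊗ h2 <- comul h) counit h2 *: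
    Σ_(g1 ⊗ g2 <- comul g) (antipode (g1 ∙ h1) ∙ g2)).
    by rewrite comul_counitr //; lin.
  apply: eq_tlift => h1 h2; rewrite klift_swap; try by lin.
  rewrite (klift_lin (h := fun x => counit h2 *: x)); try by lin.
  apply: eq_tlift => g1 g2; rewrite -{1}[g2]amul1r.
  rewrite -(sum_antipode (f := fun x => antipode (g1 ∙ h1) ∙ (g2 ∙ x))); last by lin.
  by apply: eq_tlift => x y; rewrite !amulA.
transitivity (Σ_(h1 ⊗ h2 <- comul h) counit h1 *: (counit g *: antipode h2)).
  apply: eq_tlift => h1 h2; rewrite klift_swap; try by lin.
  rewrite scalerA mulrC -counitM -[in RHS](amul1l (antipode h2)).
  rewrite -(antipode_sum (f := fun x => x ∙ antipode h2)); last by lin.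
  by rewrite comulM klift_tprod //; lin.
by rewrite (comul_counitl (f := fun h => counit g *: antipode h)) //; lin.
Qed.

(** Insert g_(2) S(g_(3)) behind S(g_(1) h) and use [antipode_mul_cancel]. *)
Lemma antipodeM g h : antipode (g ∙ h) = antipode h ∙ antipode g.
Proof.
transitivity (Σ_(g1 ⊗ g2 <- comul g) Σ_(g11 ⊗ g12 <- comul g1)
   (antipode (g11 ∙ h) ∙ g12) ∙ antipode g2).
  rewrite comul_sum; last by split; lin.
  rewrite -[LHS](comul_counitr (f := fun g => antipode (g ∙ h))); last by lin.
  apply: eq_tlift => g1 g2.
  rewrite -{1}[antipode (g1 ∙ h)]amul1r -(sum_antipode (f := fun x => antipode (g1 ∙ h) ∙ x)).
    by apply: eq_tlift => x y; rewrite amulA.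
  by lin.
rewrite -[RHS](comul_counitl (f := fun g => antipode h ∙ antipode g)); last by lin.
apply: eq_tlift => g1 g2.
rewrite -amulZl -antipode_mul_cancel (klift_lin (h := fun x => x ∙ antipode g2)) //; lin.
Qed.
End Antipode.

(** * Faithfully flat modules *)
Section LinearMaps.
Variables (k : fieldType) (V W : lmodType k) (f : V -> W).
Hypothesis fL : linear f.
Lemma linB x y : f (x - y) = f x - f y.
Proof. by rewrite (linD fL) (linN fL). Qed.
Lemma linear_injective : (forall x, f x = 0 -> x = 0) -> injective f.
Proof.
move=> f0 x y e; apply/eqP; rewrite -subr_eq0; apply/eqP/f0.
by rewrite linB e subrr.
Qed.
Lemma linear_inverse g : cancel f g -> cancel g f -> linear g.
Proof. by move=> fK gK a x y; apply: (can_inj fK); rewrite fL !gK. Qed.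
End LinearMaps.

Lemma inj_surj_bij (T U : Type) (f : T -> U) :
  injective f -> (forall y, exists x, f x = y) -> bijective f.
Proof.
move=> fI /choice [g gK]; exists g => // x.
by apply: fI; rewrite gK.
Qed.

Section FaithfullyFlatMaps.
Variables (k : fieldType) (R : kalgType k) (P : rmodule R) (X Y : lmodule R).
Variable f : X -> Y.
Hypothesis fM : lmod_mor f.

Lemma rmapidE p x :
  rmap id f (rpure P X p x) = rpure P Y p (f x).
Proof. by case: fM => fL fR; apply: rmapE. Qed.

Lemma rmapid_linear : linear (rmap id f : rtens P X -> rtens P Y).
Proof. by case: fM => fL fR; apply: rmap_linear. Qed.

Lemma rmap0 (Z : lmodule R) t : rmap id (fun=> 0 : Z) (t : rtens P X) = 0 :> rtens P Z.
Proof.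
have L : linear (fun=> 0 : rtens P Z) by move=> V a x y; rewrite scaler0 addr0.
have pB := pure_bilin (@ract _ _ P) (@lact _ _ Z).
have zM : lmod_mor (fun=> 0 : Z) (X := X).
  split=> [a x y|r x]; first by rewrite scaler0 addr0.
  by rewrite (lin0 ((lact_bilin Z).2 r)).
move: t; apply: tens_ext => [||p x].
- by case: zM => *; apply: rmap_linear.
- by move=> a x y; rewrite scaler0 addr0.
by case: zM => *; rewrite rmapE // (lin0 (pB.2 p)).
Qed.

End FaithfullyFlatMaps.

Lemma lmod_mor_inverse (k : fieldType) (R : kalgType k) (X Y : lmodule R)
    (f : X -> Y) (g : Y -> X) :
  lmod_mor f -> cancel f g -> cancel g f -> lmod_mor g.
Proof.
move=> [fL fR] fK gK; split; first exact: (linear_inverse fL fK gK).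
by move=> r x; apply: (can_inj fK); rewrite fR !gK.
Qed.

Lemma rmapid_bijective (k : fieldType) (R : kalgType k) (P : rmodule R)
    (X Y : lmodule R) (f : X -> Y) :
  lmod_mor f -> bijective f -> bijective (rmap id f : rtens P X -> rtens P Y).
Proof.
move=> fM [g fK gK]; have gM := lmod_mor_inverse fM fK gK.
have fL := rmapid_linear (P := P) fM; have gL := rmapid_linear (P := P) gM.
exists (rmap id g); apply: tens_ext => [||p x] //.
- exact: (lin_comp gL fL).
- by rewrite (rmapidE fM) (rmapidE gM) fK.
- exact: (lin_comp fL gL).
- by rewrite (rmapidE gM) (rmapidE fM) gK.
Qed.

Lemma exact_pair_iso (k : fieldType) (X Y Z X' Y' Z' : lmodType k)
    (f : X -> Y) (g : Y -> Z) (f' : X' -> Y') (g' : Y' -> Z')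
    (e1 : X -> X') (e2 : Y -> Y') (e3 : Z -> Z') :
  bijective e1 -> bijective e2 -> bijective e3 -> linear e3 ->
  (forall x, e2 (f x) = f' (e1 x)) -> (forall y, e3 (g y) = g' (e2 y)) ->
  exact_pair f g <-> exact_pair f' g'.
Proof.
move=> [i1 k1 k1'] [i2 k2 k2'] [i3 k3 k3'] L3 ef eg.
have e30 z : e3 z = 0 <-> z = 0.
  split=> [e|->]; last exact: lin0.
  by apply: (can_inj k3); rewrite e lin0.
split=> ex y.
- rewrite -(k2' y) -eg e30 ex; split=> -[x ex'].
    by exists (e1 x); rewrite -ef ex'.
  by exists (i1 x); apply: (can_inj k2); rewrite ef k1' ex'.
rewrite -e30 eg ex; split=> -[x ex'].
  by exists (i1 x); apply: (can_inj k2); rewrite ef k1' ex'.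
by exists (e1 x); rewrite -ef ex'.
Qed.

Section FaithfullyFlat.
Variables (k : fieldType) (R : kalgType k) (P : rmodule R).
Hypothesis Pff : right_faithfully_flat P.

Lemma lmod_mor0 (X Y : lmodule R) : lmod_mor (fun=> 0 : Y) (X := X).
Proof.
split=> [a x y|r x]; first by rewrite scaler0 addr0.
by rewrite (lin0 ((lact_bilin Y).2 r)).
Qed.

Lemma exact_injective (U V W : lmodType k) (f : V -> W) : linear f ->
  exact_pair (fun=> 0 : V) f (X := U) <-> injective f.
Proof.
move=> fL; split=> [e|fI v]; first by apply: linear_injective => // x /e [_ <-].
split=> [f0|[_ <-]]; last exact: lin0.
by exists 0; apply: fI; rewrite f0 lin0.
Qed.

Lemma exact_surjective (U V W : lmodType k) (f : U -> V) :
  exact_pair f (fun=> 0 : W) (Y := V) <-> (forall y, exists x, f x = y).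
Proof. by split=> [e y|e y]; [apply/e | split]. Qed.

(** A map is injective if it is exact with a zero map on its left; the
    definition of faithful flatness speaks of exact pairs only. *)
Lemma ff_injective (X Y : lmodule R) (f : X -> Y) : lmod_mor f ->
  injective f <-> injective (rmap id f : rtens P X -> rtens P Y).
Proof.
move=> fM; have z := lmod_mor0 X X; have [fL _] := fM.
rewrite -(exact_injective X fL) (Pff z fM).
rewrite -(exact_injective (rtens P X) (rmapid_linear (P := P) fM)).
by split=> e t; rewrite e; split=> -[x <-]; exists x; rewrite rmap0.
Qed.

Lemma ff_surjective (X Y : lmodule R) (f : X -> Y) : lmod_mor f ->
  (forall y, exists x, f x = y) <->
  (forall y : rtens P Y, exists x : rtens P X, rmap id f x = y).
Proof.
move=> fM; have z := lmod_mor0 Y Y; have [fL _] := fM.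
rewrite -(exact_surjective Y) (Pff fM z).
rewrite -(exact_surjective (rtens P Y)).
by split=> e t; rewrite -e rmap0.
Qed.
End FaithfullyFlat.

(** * Restriction of scalars and the diagonal module structure *)

Record kalg_mor (k : fieldType) (R S : kalgType k) := KAlgMor {
  km_fun :> R -> S;
  km_linear : linear km_fun;
  km1 : km_fun 𝟙 = 𝟙;
  kmM : forall x y, km_fun (x ∙ y) = km_fun x ∙ km_fun y }.
#[local] Hint Extern 1 (GRing.linear_for _ (km_fun _)) => exact: km_linear : lin.

Section Restrict.
Variables (k : fieldType) (R S : kalgType k) (f : kalg_mor R S) (X : lmodule S).

Definition restr_lact (r : R) (x : X) : X := lact (f r) x.

Lemma restr_lax : is_lmodule restr_lact.
Proof.
split=> [|x|r s x]; rewrite /restr_lact; [lin | by rewrite km1 lact1 |].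
by rewrite kmM lactA.
Qed.

Definition restr_lmod : lmodule R := LModule restr_lax.
End Restrict.

Section RestrictedAlgebra.
Variables (k : fieldType) (R S : kalgType k) (f : kalg_mor R S).

Definition reg_lmod : lmodule S := LModule (amul_lmodule S).

Lemma restr_lbimod_assoc (r : R) (x b : S) :
  restr_lact f (X := reg_lmod) r x ∙ b = restr_lact f (X := reg_lmod) r (x ∙ b).
Proof. by rewrite /restr_lact /= amulA. Qed.
Definition restr_lbimod : bimodule R S :=
  @Bimodule k R S S _ _ (restr_lax f reg_lmod) (amul_rmodule S) restr_lbimod_assoc.

Definition restr_ract (x : S) (r : R) : S := x ∙ f r.
Lemma restr_rax : is_rmodule restr_ract.
Proof.
split=> [|x|r s x]; rewrite /restr_ract; [lin|by rewrite km1 amul1r|].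
by rewrite kmM amulA.
Qed.
Lemma restr_rbimod_assoc (a x : S) (r : R) : restr_ract (a ∙ x) r = a ∙ restr_ract x r.
Proof. by rewrite /restr_ract amulA. Qed.
Definition restr_rbimod : bimodule S R :=
  Bimodule (amul_lmodule S) restr_rax restr_rbimod_assoc.
End RestrictedAlgebra.
Arguments reg_lmod {k} S.

Lemma restr_mor (k : fieldType) (R S : kalgType k) (f : kalg_mor R S)
    (X Y : lmodule S) (g : X -> Y) :
  lmod_mor g -> lmod_mor (X := restr_lmod f X) (Y := restr_lmod f Y) g.
Proof. by case=> gL gR; split=> // r x; apply: gR. Qed.

Section Coinvariants.
Variables (k : fieldType) (H : hopfAlgType k) (A : comodalg H) (C : hquot H).

Definition coinv_val_mor : kalg_mor (coinv_alg C A) A :=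
  @KAlgMor k (coinv_alg C A) A \val (@val_linear _ _ _ _) erefl (fun _ _ => erefl).

(** The form in which coinvariance enters Sweedler sums: x_[1] may be replaced
    by 𝟙 as soon as it is only seen through its class in C. *)
Lemma coinv_via_sum (X : comodule H) (P : lmodType k) (f : X -> C -> P) (x : coinv (via C X)) :
  bilin f -> Σ_(x0 ⊗ h <- @coact _ _ X (val x)) f x0 (hq_proj C h) = f (val x) (hq_proj C 𝟙).
Proof.
move=> fB; rewrite -(kliftE fB).
have e : kmap id (hq_proj C) (@coact _ _ X (val x)) = val x ⊗ hq_proj C 𝟙 := coinvE x.
by rewrite -e klift_kmap //; lin.
Qed.

Lemma ca_coact_sum (P : lmodType k) (F : A -> H -> H -> P) a : trilin F ->
  Σ_(x ⊗ c <- ca_coact a) Σ_(y0 ⊗ y1 <- ca_coact x) F y0 y1 c =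
  Σ_(x ⊗ c <- ca_coact a) Σ_(c1 ⊗ c2 <- comul c) F x c1 c2.
Proof. exact: (@coact_sum _ _ (ca_comod A)). Qed.

Lemma ca_coactM (P : lmodType k) (f : A -> H -> P) a b : bilin f ->
  Σ_(x ⊗ h <- ca_coact (a ∙ b)) f x h =
  Σ_(a0 ⊗ a1 <- ca_coact a) Σ_(b0 ⊗ b1 <- ca_coact b) f (a0 ∙ b0) (a1 ∙ b1).
Proof. by move=> fB; have [_ _ ->] := ca_ax A; rewrite klift_tprod //; lin. Qed.

Lemma ca_coact1 (P : lmodType k) (f : A -> H -> P) : bilin f ->
  Σ_(x ⊗ h <- ca_coact (𝟙 : A)) f x h = f 𝟙 𝟙.
Proof. by move=> fB; have [_ -> _] := ca_ax A; rewrite kliftE. Qed.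

Lemma ca_coact_counit (P : lmodType k) (f : A -> P) a : linear f ->
  Σ_(x ⊗ h <- ca_coact a) counit h *: f x = f a.
Proof. exact: (@coact_counit _ _ (ca_comod A)). Qed.

Lemma ca_coactM_bilin (P : lmodType k) (f : A -> H -> P) b : bilin f ->
  bilin (fun a0 a1 => Σ_(b0 ⊗ b1 <- ca_coact b) f (a0 ∙ b0) (a1 ∙ b1)).
Proof. by move=> fB; have fl x := fB.1 x; have fr x := fB.2 x; lin. Qed.

Section Diagonal.
Variable U : lmodule A.
(** The diagonal action, not the action on the left factor: for it the coaction
    of a Doi-Hopf module is A-linear, and u |-> u ⊗ 𝟙 is linear over the
    C-coinvariants. *)
Definition diag_lact (a : A) (y : U ⊗ C) : U ⊗ C :=
  tprod (@lact _ _ U) (@hq_act _ _ C) (ca_coact a) y.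

Lemma diag_lax : is_lmodule diag_lact.
Proof.
have aB := hq_act_bilin C; have lB := lact_bilin U.
have mB := amul_bilin (s := A); have hB := amul_bilin (s := H).
have tB := tprod_bilin lB aB.
split=> [|y|r s y]; rewrite /diag_lact.
- by lin.
- have [_ -> _] := ca_ax A; rewrite tprod_pureL //.
  rewrite (eq_kmap (f' := id) (g' := id)) ?kmap_id // => x; first exact: lact1.
  exact: hq_act1.
- have [_ _ ->] := ca_ax A.
  by apply: tprod_assoc => // *; rewrite ?lactA ?hq_actA.
Qed.
Definition diag_lmod : lmodule A := LModule diag_lax.

Lemma diag_lactE a u c : @lact _ _ diag_lmod a (u ⊗ c) =
  Σ_(a0 ⊗ a1 <- ca_coact a) lact a0 u ⊗ hq_act a1 c.
Proof.
by rewrite [lact _ _]tprod_pureR //; [exact: lact_bilin | exact: hq_act_bilin].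
Qed.
End Diagonal.
End Coinvariants.

(** * The Galois map *)
Section CanV.
Variables (k : fieldType) (H : hopfAlgType k) (A : comodalg H) (C : hquot H).
Variable V : lmodule A.
Notation AV := (rtens (ext_rmod C A) (restr_lmod (coinv_val_mor A C) V)).

(** The Galois map of the quotient C, with coefficients in V. For V = A and
    C = H it is the Galois map a ⊗ b |-> a_[0] b ⊗ a_[1] itself. *)
Definition canV : AV -> V ⊗ C :=
  tlift (fun a v => Σ_(a0 ⊗ a1 <- ca_coact a) lact a0 v ⊗ hq_proj C a1).

Let cB : bilin (fun (a : A) (v : V) =>
  Σ_(a0 ⊗ a1 <- ca_coact a) lact a0 v ⊗ hq_proj C a1).
Proof. by lin. Qed.

Let cb : balanced (@ract _ _ (ext_rmod C A))
  (@lact _ _ (restr_lmod (coinv_val_mor A C) V))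
  (fun (a : A) (v : V) => Σ_(a0 ⊗ a1 <- ca_coact a) lact a0 v ⊗ hq_proj C a1).
Proof.
move=> a r v; rewrite [ract _ _]/(a ∙ val r) [lact r v]/(lact (val r) v).
rewrite ca_coactM; last by lin.
apply: eq_tlift => a0 a1.
transitivity (Σ_(r0 ⊗ h <- ca_coact (val r))
   lact (a0 ∙ r0) v ⊗ hq_act a1 (hq_proj C h)).
  by apply: eq_tlift => r0 r1; rewrite -hq_proj_act.
rewrite (coinv_via_sum (X := ca_comod A)
   (f := fun r0 c => lact (a0 ∙ r0) v ⊗ hq_act a1 c)); last by lin.
by rewrite -hq_proj_act amul1r lactA.
Qed.

Lemma canVE (a : A) (v : V) : canV (rpure (ext_rmod C A) (restr_lmod (coinv_val_mor A C) V) a v) =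
  Σ_(a0 ⊗ a1 <- ca_coact a) lact a0 v ⊗ hq_proj C a1.
Proof. exact: (tliftE cB cb). Qed.

Lemma canV_linear : linear canV.
Proof. exact: tlift_linear. Qed.
End CanV.
#[local] Hint Extern 1 (GRing.linear_for _ (@canV _ _ _ _ _)) => exact: canV_linear : lin.

Section CanVTheory.
Variables (k : fieldType) (H : hopfAlgType k) (A : comodalg H) (D : hquot H).
Notation AV V := (rtens (ext_rmod D A) (restr_lmod (coinv_val_mor A D) V)).

Lemma ext_balanced (X : lmodule (coinv_alg D A)) (a : A) (s : coinv_alg D A) (x : X) :
  rpure (ext_rmod D A) X (a ∙ val s) x = rpure (ext_rmod D A) X a (lact s x).
Proof. exact: (pure_balanced (@ract _ _ (ext_rmod D A)) (@lact _ _ X) a s x). Qed.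

Lemma canV_lact (V : lmodule A) (a : A) (t : AV V) :
  canV (tens_lact (P := ext_bimod D A) a t) = @lact _ _ (diag_lmod D V) a (canV t).
Proof.
have cL := @canV_linear k H A D V.
move: t; apply: tens_ext => [||b v].
- exact: (lin_comp cL (@tens_lact_linear _ _ _ (ext_bimod D A) (restr_lmod (coinv_val_mor A D) V) a)).
- exact: (lin_comp ((lact_bilin (diag_lmod D V)).2 a) cL).
rewrite tens_lactE [LHS]canVE canVE ca_coactM; last by lin.
rewrite (klift_lin (h := @lact _ _ (diag_lmod D V) a)); first last.
- exact: ((lact_bilin (diag_lmod D V)).2 a).
- by lin.
rewrite klift_swap; try by lin.
apply: eq_tlift => b0 b1; rewrite diag_lactE.
by apply: eq_tlift => a0 a1; rewrite lactA hq_proj_act.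
Qed.

Lemma canV_map (V W : lmodule A) (f : V -> W) (t : AV V) : lmod_mor f ->
  canV (rmap id f t : AV W) = kmap f id (canV t).
Proof.
move=> fM; have [fL fA] := fM; have fM' := restr_mor (coinv_val_mor A D) fM.
move: t; apply: tens_ext => [||b v].
- exact: (lin_comp (@canV_linear k H A D W) (rmapid_linear fM')).
- exact: (lin_comp (kmap_linear fL (@lin_id _ _)) (@canV_linear k H A D V)).
rewrite (rmapidE fM') !canVE /kmap klift_klift; [|by lin|by lin].
apply: eq_tlift => a0 a1; rewrite kliftE; [by rewrite fA | by lin].
Qed.
End CanVTheory.

Section HquotMor.
Variables (k : fieldType) (H : hopfAlgType k).
(** Used for the identity of C and for the projection of H onto C, the two cases
    in which coinvariants for D are coinvariants for C. *)
Record hquot_mor (D C : hquot H) := HquotMor {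
  hm_fun :> D -> C;
  hm_linear : linear hm_fun;
  hm_proj : forall h, hm_fun (hq_proj D h) = hq_proj C h }.

Definition hm_id (C : hquot H) : hquot_mor C C := HquotMor (@lin_id _ C) (fun=> erefl).
Definition hm_of_id (C : hquot H) : hquot_mor (hquot_id H) C :=
  @HquotMor (hquot_id H) C (hq_proj C) (@hq_proj_linear _ _ C) (fun=> erefl).

Variables (D C : hquot H) (q : hquot_mor D C) (A : comodalg H).

Lemma coinv_sub_subproof (r : coinv_alg D A) :
  (val r : A) \in @coinv_pred _ _ _ (via C (ca_comod A)).
Proof.
apply/eqP; rewrite /=.
have qL := hm_linear q; have pL := hq_proj_linear D.
have e : kmap id (hq_proj D) (ca_coact (val r)) = val r ⊗ hq_proj D 𝟙 := coinvE r.
transitivity (kmap id q (kmap id (hq_proj D) (ca_coact (val r)))).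
  by rewrite kmap_comp //; apply: eq_kmap => // h; rewrite hm_proj.
by rewrite e kmapE // hm_proj.
Qed.

Definition coinv_sub_fun (r : coinv_alg D A) : coinv_alg C A :=
  Coinv (coinv_sub_subproof r).

Definition coinv_sub : kalg_mor (coinv_alg D A) (coinv_alg C A).
Proof.
refine (@KAlgMor k _ _ coinv_sub_fun _ _ _).
- by move=> a x y; apply: val_inj; rewrite [RHS]val_linear /= [LHS]val_linear.
- exact: val_inj.
- by move=> x y; apply: val_inj.
Defined.
End HquotMor.
#[local] Hint Extern 1 (GRing.linear_for _ (hm_fun _)) => exact: hm_linear : lin.

(** * The translation map *)

Section ExtendedAlgebra.
Variables (k : fieldType) (H : hopfAlgType k) (A : comodalg H).
Notation R := (coinv_alg (hquot_id H) A).
Variables (S : kalgType k) (m : kalg_mor R S).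

Definition ext_tens : bimodule A S := tens_bimod (ext_bimod (hquot_id H) A) (restr_lbimod m).
Notation AS := (rtens (ext_rmod (hquot_id H) A) (restr_lmod m (reg_lmod S))).

Section Sums.
Variables (P : lmodType k) (f : A -> S -> P).
Hypotheses (fB : bilin f).
Hypothesis fb : forall a (r : R) s, f (a ∙ val r) s = f a (m r ∙ s).

Lemma sum_lact a (t : ext_tens) :
  tlift f (bm_lact a t : AS) = tlift (fun (l : A) (r : S) => f (a ∙ l) r) (t : AS).
Proof.
have L := (amul_bilin (s := A)).2 a.
apply: (tlift_rmap (u := fun x : A => a ∙ x) (v := @id S)) => //.
by move=> x r; rewrite [LHS]amulA.
Qed.

Lemma sum_ract s (t : ext_tens) :
  tlift f (bm_ract t s : AS) = tlift (fun (l : A) (r : S) => f l (r ∙ s)) (t : AS).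
Proof.
have L := (amul_bilin (s := S)).1 s.
apply: (tlift_rmap (u := @id A) (v := fun x : S => x ∙ s)) => //.
by move=> r x; rewrite /= /restr_lact /= amulA.
Qed.
End Sums.
End ExtendedAlgebra.

Section Translation.
Variables (k : fieldType) (H : hopfAlgType k) (A : comodalg H).
Notation D0 := (hquot_id H).
Notation R := (coinv_alg D0 A).
Notation AA := (rtens (ext_rmod D0 A) (restr_lmod (coinv_val_mor A D0) (reg_lmod A))).
Notation AV V := (rtens (ext_rmod D0 A) (restr_lmod (coinv_val_mor A D0) V)).
Notation pureA := (rpure (ext_rmod D0 A) (restr_lmod (coinv_val_mor A D0) (reg_lmod A))).
Notation can := (@canV k H A D0 (reg_lmod A)).

(** What a bilinear f must satisfy to induce a map on A ⊗_R A. *)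
Definition Rbal (P : Type) (f : A -> A -> P) : Prop :=
  forall a (r : R) b, f (a ∙ val r) b = f a (val r ∙ b).

(** The translation map of the extension, written γ(h) = l(h) ⊗ r(h) in
    comments. *)
Definition is_translation (g : H -> AA) := linear g /\ forall h, can (g h) = 𝟙 ⊗ h.

Lemma translation_exists : bijective can -> exists g, is_translation g.
Proof.
case=> ci cK ciK; exists (fun h => ci (𝟙 ⊗ h)); split=> [|h]; last by rewrite ciK.
have L := linear_inverse (@canV_linear k H A D0 (reg_lmod A)) cK ciK.
exact: (lin_comp L (kpureR _)).
Qed.

Hypothesis canI : injective can.
Variable gamma : H -> AA.
Hypothesis gammaP : is_translation gamma.
Notation "Σγ_( l ⊗ r <- h ) E" := (tlift (fun l r : A => E) (gamma h))
  (at level 41, l name, r name, h at level 100, E at level 41).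

Let gL : linear gamma := gammaP.1.
Let gE h : can (gamma h) = 𝟙 ⊗ h := gammaP.2 h.

Lemma gamma_sum_linear (P : lmodType k) (f : A -> A -> P) :
  bilin f -> Rbal f -> linear (fun h => Σγ_(l ⊗ r <- h) f l r).
Proof. by move=> fB fb; apply: (lin_comp (tlift_linear fB fb) gL). Qed.

(** A map on A ⊗_R A that factors through the Galois map is known on γ. *)
Lemma gamma_elim (P : lmodType k) (f : A -> A -> P) (F : A ⊗ H -> P) h :
  bilin f -> Rbal f -> linear F ->
  (forall a b, F (Σ_(a0 ⊗ a1 <- ca_coact a) (a0 ∙ b) ⊗ a1) = f a b) ->
  Σγ_(l ⊗ r <- h) f l r = F (𝟙 ⊗ h).
Proof.
move=> fB fb FL e; rewrite -gE.
have : tlift f =1 (fun t : AA => F (can t)); last exact.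
apply: tens_ext => [||a b]; first exact: tlift_linear.
  exact: (lin_comp FL (@canV_linear k H A D0 (reg_lmod A))).
by rewrite tliftE // canVE -e.
Qed.

(** Apply ε to the second factor of l_[0] r ⊗ l_[1] = 𝟙 ⊗ h. *)
Lemma gamma_mul (P : lmodType k) (f : A -> P) h : linear f ->
  Σγ_(l ⊗ r <- h) f (l ∙ r) = counit h *: f 𝟙.
Proof.
move=> fL.
rewrite (gamma_elim (F := fun z => Σ_(x ⊗ h <- z) counit h *: f x)).
- by rewrite kliftE //; apply: (bilin_comp (counit_scale_bilin H P)); lin.
- by lin.
- by move=> a r b; rewrite amulA.
- by apply: klift_linear; apply: (bilin_comp (counit_scale_bilin H P)); lin.
move=> a b; have B : bilin (fun x (h : H) => counit h *: f x).
  by apply: (bilin_comp (counit_scale_bilin H P)); lin.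
rewrite klift_klift //; last by lin.
rewrite -(ca_coact_counit (f := fun a => f (a ∙ b))); last by lin.
by apply: eq_tlift => a0 a1; rewrite kliftE.
Qed.

(** l r_[0] ⊗ S(r_[1]) = 𝟙 ⊗ h: the map x ⊗ h |-> x_[0] ⊗ S(x_[1]) h sends
    a_[0] b ⊗ a_[1] to a b_[0] ⊗ S(b_[1]). *)
Lemma gamma_coact_right (P : lmodType k) (f : A -> H -> P) h : bilin f ->
  Σγ_(l ⊗ r <- h) Σ_(r0 ⊗ r1 <- ca_coact r) f (l ∙ r0) (antipode r1) = f 𝟙 h.
Proof.
move=> fB; have fl x := fB.1 x; have fr x := fB.2 x.
pose F z := Σ_(x ⊗ h <- (z : A ⊗ H)) Σ_(x0 ⊗ x1 <- ca_coact x) f x0 (antipode x1 ∙ h).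
have BF : bilin (fun x h => Σ_(x0 ⊗ x1 <- ca_coact x) f x0 (antipode x1 ∙ h)) by lin.
rewrite (gamma_elim (F := F)).
- rewrite /F kliftE // ca_coact1; last by lin.
  by rewrite antipode1 amul1l.
- by lin.
- move=> a r b; rewrite ca_coactM; last by lin.
  rewrite coinv_idP kliftE; last by lin.
  by apply: eq_tlift => b0 b1; rewrite amul1l amulA.
- exact: klift_linear.
move=> a b; rewrite /F klift_klift //; last by lin.
transitivity (Σ_(b0 ⊗ b1 <- ca_coact b) Σ_(a0 ⊗ a1 <- ca_coact a)
  Σ_(a10 ⊗ a11 <- comul a1) f (a0 ∙ b0) (antipode b1 ∙ (antipode a10 ∙ a11))).
  rewrite klift_swap; try by lin.
  transitivity (Σ_(a0 ⊗ a1 <- ca_coact a) Σ_(a00 ⊗ a01 <- ca_coact a0)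
     Σ_(b0 ⊗ b1 <- ca_coact b) f (a00 ∙ b0) (antipode b1 ∙ (antipode a01 ∙ a1))).
    apply: eq_tlift => a0 a1; rewrite kliftE //.
    rewrite ca_coactM; last by lin.
    by do 2!apply: eq_tlift => ? ?; rewrite antipodeM amulA.
  rewrite ca_coact_sum; last by split; lin.
  by apply: eq_tlift => a0 a1; rewrite klift_swap; lin.
apply: eq_tlift => b0 b1.
rewrite -[RHS](ca_coact_counit (f := fun a => f (a ∙ b0) (antipode b1))); last by lin.
apply: eq_tlift => a0 a1.
rewrite (antipode_sum (f := fun x => f (a0 ∙ b0) (antipode b1 ∙ x))); last by lin.
by rewrite amul1r.
Qed.


Definition AAbim : bimodule A A := ext_tens (coinv_val_mor A D0).

Lemma can_lact a (t : AAbim) :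
  can (bm_lact a t) = @lact _ _ (diag_lmod D0 (reg_lmod A)) a (can t).
Proof. exact: canV_lact. Qed.

Lemma can_ract b (t : AAbim) : can (bm_ract t b) = kmap (fun x => x ∙ b) id (can t).
Proof.
apply: (@canV_map _ _ _ D0 (reg_lmod A) (reg_lmod A) (fun x : A => x ∙ b)).
split=> [|r x]; first exact: ((amul_bilin (s := A)).1 b).
exact/esym/(amulA r x b).
Qed.

Lemma can_pure1r a : can (pureA a 𝟙) = ca_coact a.
Proof.
rewrite canVE -[RHS]tlift_pure.
by apply: eq_tlift => x h; rewrite [lact _ _]amul1r.
Qed.

Lemma can_pure1l a : can (pureA 𝟙 a) = a ⊗ 𝟙.
Proof. by rewrite canVE ca_coact1; [rewrite [lact _ _]amul1l | lin]. Qed.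

(** Both sides have image r ⊗ h under the Galois map, since r is coinvariant.
    This makes a ⊗ x |-> a l(h) ⊗ r(h) x compatible with ⊗_R. *)
Lemma gamma_central (r : R) h :
  bm_lact (val r : A) (gamma h : AAbim) = bm_ract (gamma h : AAbim) (val r).
Proof.
apply: canI; rewrite can_lact can_ract gE diag_lactE coinv_idP kliftE; last by lin.
rewrite kmapE; [|exact: ((amul_bilin (s := A)).1 (val r))|exact: lin_id].
by rewrite [lact _ _]amul1r amul1l [hq_act _ _]amul1l.
Qed.

Lemma gamma_central_sum (P : lmodType k) (f : A -> A -> P) (r : R) h :
  bilin f -> Rbal f ->
  Σγ_(l ⊗ s <- h) f (val r ∙ l) s = Σγ_(l ⊗ s <- h) f l (s ∙ val r).
Proof. by move=> fB fb; rewrite -sum_lact // -sum_ract // gamma_central. Qed.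

(** Both sides have image ρ(a) under the Galois map. *)
Lemma gamma_coact_tens a :
  Σ_(a0 ⊗ a1 <- ca_coact a) bm_ract (gamma a1 : AAbim) a0 = pureA a 𝟙.
Proof.
have rB := bm_ract_bilin AAbim.
have B : bilin (fun a0 a1 => bm_ract (gamma a1 : AAbim) a0).
  split=> [y|x]; first exact: (rB.2 _).
  exact: (lin_comp (rB.1 x) gL).
apply: canI; rewrite can_pure1r (klift_lin (h := can)) //; last exact: canV_linear.
rewrite -[RHS]tlift_pure; apply: eq_tlift => a0 a1.
rewrite can_ract gE kmapE; [|exact: ((amul_bilin (s := A)).1 a0)|exact: lin_id].
by rewrite amul1l.
Qed.

Lemma gamma_coact (P : lmodType k) (f : A -> A -> P) a : bilin f -> Rbal f ->
  Σ_(a0 ⊗ a1 <- ca_coact a) Σγ_(l ⊗ r <- a1) f l (r ∙ a0) = f a 𝟙.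
Proof.
move=> fB fb; have rB := bm_ract_bilin AAbim.
have B : bilin (fun a0 a1 => bm_ract (gamma a1 : AAbim) a0).
  split=> [y|x]; first exact: (rB.2 _).
  exact: (lin_comp (rB.1 x) gL).
transitivity (tlift f (pureA a 𝟙)); last by rewrite tliftE.
rewrite -gamma_coact_tens (klift_lin (h := tlift f : AA -> P)) //; last exact: tlift_linear.
by apply: eq_tlift => a0 a1; rewrite sum_ract.
Qed.

Lemma gamma_antipode_bilin :
  bilin (fun (a0 : A) h => bm_lact a0 (gamma (antipode h) : AAbim)).
Proof.
have lB := bm_lact_bilin AAbim; split=> [y|x]; first exact: (lB.1 _).
exact: (lin_comp (lB.2 x) (lin_comp gL (@antipode_linear _ _))).
Qed.

(** Both sides have image a ⊗ 𝟙 under the Galois map: on the left it is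
    a_[0] ⊗ a_[1] S(a_[2]). *)
Lemma gamma_antipode_tens a :
  Σ_(a0 ⊗ a1 <- ca_coact a) bm_lact a0 (gamma (antipode a1) : AAbim) = pureA 𝟙 a.
Proof.
have B := gamma_antipode_bilin; apply: canI.
rewrite can_pure1l (klift_lin (h := can)) //; last exact: canV_linear.
transitivity (Σ_(a0 ⊗ a1 <- ca_coact a) Σ_(a00 ⊗ a01 <- ca_coact a0)
   a00 ⊗ (a01 ∙ antipode a1)).
  apply: eq_tlift => a0 a1; rewrite can_lact gE diag_lactE.
  by apply: eq_tlift => x y; rewrite [lact _ _]amul1r.
rewrite ca_coact_sum; last by split; lin.
rewrite -[RHS](ca_coact_counit (f := fun a => a ⊗ (𝟙 : H))); last by lin.
by apply: eq_tlift => a0 a1; rewrite (sum_antipode (f := fun y => a0 ⊗ y)); lin.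
Qed.

Lemma gamma_antipode (P : lmodType k) (f : A -> A -> P) a : bilin f -> Rbal f ->
  Σ_(a0 ⊗ a1 <- ca_coact a) Σγ_(l ⊗ r <- antipode a1) f (a0 ∙ l) r = f 𝟙 a.
Proof.
move=> fB fb; have B := gamma_antipode_bilin.
transitivity (tlift f (pureA 𝟙 a)); last by rewrite tliftE.
rewrite -gamma_antipode_tens (klift_lin (h := tlift f : AA -> P)) //; last exact: tlift_linear.
by apply: eq_tlift => a0 a1; rewrite sum_lact.
Qed.

(** The element l(h') ⊗ r(h'), inserted between l and r. *)
Definition gamma_nest h' (l r : A) : AA := bm_lact l (bm_ract (gamma h' : AAbim) r).

Lemma gamma_nest_bilin h' : bilin (gamma_nest h').
Proof.
have lB := bm_lact_bilin AAbim; have rB := bm_ract_bilin AAbim.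
split=> [r|l]; first exact: (lB.1 _).
exact: (lin_comp (lB.2 l) (rB.2 _)).
Qed.

Lemma gamma_nest_bal h' : Rbal (gamma_nest h').
Proof.
have [_ _ lM] := bm_lax AAbim; have [_ _ rM] := bm_rax AAbim.
move=> l s r; rewrite /gamma_nest lM -[bm_lact (val s) _]bm_assoc gamma_central.
by rewrite -rM.
Qed.

(** Both sides have image 𝟙 ⊗ h h' under the Galois map; the order of the
    right factors is reversed. *)
Lemma gammaM_tens h h' : Σγ_(l ⊗ r <- h) gamma_nest h' l r = gamma (h ∙ h').
Proof.
have GB := gamma_nest_bilin h'; have Gb := @gamma_nest_bal h'.
apply: canI; rewrite gE.
rewrite (tlift_lin (h := can)) //; last exact: canV_linear.
have mL := (amul_bilin (s := H)).1 h'.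
rewrite (gamma_elim (F := kmap id (fun y => y ∙ h'))).
- by rewrite kmapE.
- exact: (lin_bilin (@canV_linear k H A D0 (reg_lmod A)) GB).
- by move=> a r b; rewrite Gb.
- exact: kmap_linear.
move=> a b; rewrite can_lact can_ract gE kmapE; [|exact: ((amul_bilin (s := A)).1 b)|exact: lin_id].
rewrite amul1l diag_lactE /kmap klift_klift; [|by lin|by lin].
by apply: eq_tlift => a0 a1; rewrite kliftE //; lin.
Qed.

Lemma gammaM (P : lmodType k) (f : A -> A -> P) h h' : bilin f -> Rbal f ->
  Σγ_(l ⊗ r <- h ∙ h') f l r =
  Σγ_(l ⊗ r <- h) Σγ_(l' ⊗ r' <- h') f (l ∙ l') (r' ∙ r).
Proof.
move=> fB fb; have GB := gamma_nest_bilin h'; have Gb := @gamma_nest_bal h'.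
rewrite -gammaM_tens (tlift_lin (h := tlift f : AA -> P)) //; last exact: tlift_linear.
apply: eq_tlift => l r; rewrite /gamma_nest sum_lact // sum_ract //.
  by split=> ?; [exact: (lin_comp (fB.1 _) ((amul_bilin (s := A)).2 _))|exact: fB.2].
by move=> a s b; rewrite amulA fb.
Qed.

Lemma gamma1 : gamma 𝟙 = pureA 𝟙 𝟙.
Proof. by apply: canI; rewrite gE can_pure1l. Qed.

End Translation.

(** C is only known through the surjection from H; bilinear maps descend to it. *)
Lemma bilin_factor (k : fieldType) (H : hopfAlgType k) (C : hquot H)
    (V P : lmodType k) (F : V -> H -> P) :
  bilin F -> (forall v h, hq_proj C h = 0 -> F v h = 0) ->
  exists2 G : V -> C -> P, bilin G & forall v h, G v (hq_proj C h) = F v h.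
Proof.
move=> FB F0; have [sec secK] := choice (@hq_proj_surj _ _ C).
have pL := hq_proj_linear C.
have FE v h h' : hq_proj C h = hq_proj C h' -> F v h = F v h'.
  move=> e; apply/eqP; rewrite -subr_eq0 -(linB (FB.2 v)); apply/eqP/F0.
  by rewrite (linB pL) e subrr.
exists (fun v c => F v (sec c)) => [|v h]; last by apply: FE; rewrite secK.
split=> [c|v a x y]; first exact: FB.1.
by rewrite -(FB.2 v); apply: FE; rewrite pL !secK.
Qed.

(** * The Galois map of a quotient coalgebra *)
Section QuotientGalois.
Variables (k : fieldType) (H : hopfAlgType k) (A : comodalg H) (C : hquot H).
Notation D0 := (hquot_id H).
Hypothesis canI : injective (@canV k H A D0 (reg_lmod A)).
Variable gamma : H ->
  rtens (ext_rmod D0 A) (restr_lmod (coinv_val_mor A D0) (reg_lmod A)).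
Hypothesis gammaP : is_translation gamma.
Notation "Σγ_( l ⊗ r <- h ) E" := (tlift (fun l r : A => E) (gamma h))
  (at level 41, l name, r name, h at level 100, E at level 41).
Notation pureC V := (rpure (ext_rmod C A) (restr_lmod (coinv_val_mor A C) V)).

Lemma pureC_bal (X : lmodule (coinv_alg C A)) (a : A) (r : coinv_alg D0 A) (x : X) :
  rpure (ext_rmod C A) X (a ∙ val r) x =
  rpure (ext_rmod C A) X a (lact (coinv_sub (hm_of_id C) A r) x).
Proof. exact: (ext_balanced a (coinv_sub (hm_of_id C) A r) x). Qed.

Section V.
Variable V : lmodule A.

Lemma pureC_lact_bilin (v : V) : bilin (fun l r : A => pureC V l (lact r v)).
Proof.
have pB := pure_bilin (@ract _ _ (ext_rmod C A))
  (@lact _ _ (restr_lmod (coinv_val_mor A C) V)).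
by split=> ?; [exact: pB.1|exact: (lin_comp (pB.2 _) ((lact_bilin V).1 v))].
Qed.

Lemma pureC_lact_bal (v : V) : Rbal (fun l r : A => pureC V l (lact r v)).
Proof.
by move=> a r b; rewrite [LHS]pureC_bal [lact _ _]/(lact (val r) (lact b v)) lactA.
Qed.

(** The inverse of [canV], before it is known to only depend on the class
    of h. *)
Definition canV_inv (v : V) (h : H) := Σγ_(l ⊗ r <- h) pureC V l (lact r v).

Lemma canV_inv_bilin : bilin canV_inv.
Proof.
have fB v := pureC_lact_bilin v; have fb v := pureC_lact_bal v.
split=> [h|v]; last exact: (gamma_sum_linear gammaP).
apply: linear_tlift_param => // l r.
exact: (lin_comp ((pure_bilin _ _).2 _) ((lact_bilin V).2 _)).
Qed.

Lemma canV_invK v h : canV (canV_inv v h) = v ⊗ hq_proj C h.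
Proof.
have fB := pureC_lact_bilin v; have fb := @pureC_lact_bal v.
have cL := @canV_linear k H A C V; have pL := hq_proj_linear C.
have lL := (lact_bilin V).1 v.
rewrite /canV_inv (tlift_lin _ fB fb cL).
rewrite (gamma_elim gammaP (F := kmap (fun x => lact x v) (hq_proj C))).
- by rewrite kmapE // lact1.
- exact: (lin_bilin cL fB).
- by move=> a r b; rewrite fb.
- exact: kmap_linear.
move=> a b; rewrite canVE /kmap klift_klift; [|by lin|by lin].
by apply: eq_tlift => a0 a1; rewrite kliftE ?lactA //; lin.
Qed.
End V.

Hypothesis gammaC : forall h, hq_proj C h = 0 ->
  forall (V : lmodule A) (v : V), canV_inv v h = 0.

(** One composite is [canV_invK]; the other sends a ⊗ v to
    l(a_[1]) ⊗ r(a_[1]) a_[0] v, which is a ⊗ v by [gamma_coact]. *)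
Lemma canV_bijective V : bijective (@canV k H A C V).
Proof.
have cL := @canV_linear k H A C V; have iB := canV_inv_bilin V.
have [G GB GE] := bilin_factor iB (fun v h h0 => gammaC h0 v).
exists (tlift G).
  move=> t; have := tens_ext (f := fun t => tlift G (canV t)) (f' := id); apply => {t}.
  - exact: (lin_comp (klift_linear GB) cL).
  - exact: lin_id.
  move=> a v; rewrite canVE klift_klift //; last by lin.
  transitivity (Σ_(a0 ⊗ a1 <- ca_coact a) Σγ_(l ⊗ r <- a1)
     pureC V l (lact (r ∙ a0) v)).
    apply: eq_tlift => a0 a1; rewrite kliftE // GE.
    by apply: eq_tlift => l r; rewrite lactA.
  rewrite (gamma_coact canI gammaP (f := fun l r => pureC V l (lact r v))).
  - by rewrite lact1.
  - exact: pureC_lact_bilin.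
  - exact: pureC_lact_bal.
move=> y; have := kext (f := fun y => canV (tlift G y)) (f' := @id (V ⊗ C)); apply => {y}.
- exact: (lin_comp cL (klift_linear GB)).
- exact: lin_id.
move=> v c; have [h <-] := hq_proj_surj c.
by rewrite kliftE // GE canV_invK.
Qed.
End QuotientGalois.

(** * Coinvariants as a kernel, and descent along it *)
Section Descent.
Variables (k : fieldType) (H : hopfAlgType k) (A : comodalg H) (C : hquot H).
Variable U : dkmod A C.

(** U^co is the kernel of this A0-linear map, so that it commutes with flat base
    change. *)
Definition coinv_diff (u : U) : U ⊗ C := dk_coact u - u ⊗ hq_proj C 𝟙.

Lemma coinv_diff_linear : linear coinv_diff.
Proof. by rewrite /coinv_diff; lin. Qed.

Lemma coinv_diff_eq0 u : coinv_diff u = 0 <-> u \in @coinv_pred _ _ _ (dk_comod U).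
Proof.
rewrite /coinv_diff; split=> [e|/eqP e]; first by apply/eqP/eqP; rewrite -subr_eq0 e.
by apply/eqP; rewrite subr_eq0; apply/eqP.
Qed.

Lemma coinv_diff_mor : lmod_mor
  (X := restr_lmod (coinv_val_mor A C) U)
  (Y := restr_lmod (coinv_val_mor A C) (diag_lmod C U)) coinv_diff.
Proof.
split=> [|r u]; first exact: coinv_diff_linear.
rewrite [lact r u]/(lact (val r) u) /coinv_diff.
apply: etrans (esym (linB ((lact_bilin (diag_lmod C U)).2 (val r)) _ _)).
congr (_ - _); first exact: dk_lcoact.
rewrite diag_lactE.
transitivity (Σ_(a0 ⊗ a1 <- ca_coact (val r)) @lact _ _ U a0 u ⊗ hq_proj C a1).
  rewrite (coinv_via_sum (X := ca_comod A) (f := fun a0 c => @lact _ _ U a0 u ⊗ c)) //.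
  by lin.
by apply: eq_tlift => a0 a1; rewrite -hq_proj_act amul1r.
Qed.

Lemma coinv_exact : exact_pair (fun u : coinv_lmod U => val u : U) coinv_diff.
Proof.
move=> u; rewrite coinv_diff_eq0; split=> [uP|[v <-]]; last exact: valP.
by exists (Coinv uP).
Qed.

Variables (D : hquot H) (q : hquot_mor D C).

Lemma coinv_diff_mor_sub : lmod_mor
  (X := restr_lmod (coinv_val_mor A D) U)
  (Y := restr_lmod (coinv_val_mor A D) (diag_lmod C U)) coinv_diff.
Proof.
split=> [|r u]; first exact: coinv_diff_linear.
exact: (coinv_diff_mor.2 (coinv_sub q A r)).
Qed.

(** Under the Galois maps of U and of U ⊗ C, the base change of [coinv_diff]
    becomes ρ ⊗ id minus the coproduct of D, a cobar differential. *)
Lemma canV_coinv_diff (t : rtens (ext_rmod D A) (restr_lmod (coinv_val_mor A D) U)) :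
  canV (rmap id coinv_diff t :
    rtens (ext_rmod D A) (restr_lmod (coinv_val_mor A D) (diag_lmod C U))) =
  Σ_(u ⊗ d <- canV t) dk_coact u ⊗ d -
  Σ_(u ⊗ d <- canV t) Σ_(d1 ⊗ d2 <- comul d) (u ⊗ q d1) ⊗ d2.
Proof.
have cL := @canV_linear k H A D U; have EM := coinv_diff_mor_sub.
have pL := hq_proj_linear D; have pCL := hq_proj_linear C.
have L1 : bilin (fun (u : U) (d : D) => dk_coact u ⊗ d) by lin.
have L2 : bilin (fun (u : U) d => Σ_(d1 ⊗ d2 <- comul d) (u ⊗ q d1) ⊗ d2) by lin.
move: t; apply: tens_ext => [||a u].
- exact: (lin_comp (@canV_linear k H A D (diag_lmod C U)) (rmapid_linear EM)).
- apply: linear_add; first exact: (lin_comp (klift_linear L1) cL).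
  exact: (linear_opp (lin_comp (klift_linear L2) cL)).
rewrite (rmapidE EM) !canVE !klift_klift; [|by lin..].
transitivity (Σ_(a0 ⊗ a1 <- ca_coact a) (dk_coact (@lact _ _ U a0 u) ⊗ hq_proj D a1 -
   Σ_(a00 ⊗ a01 <- ca_coact a0) (@lact _ _ U a00 u ⊗ hq_proj C a01) ⊗ hq_proj D a1)).
  apply: eq_tlift => a0 a1; rewrite /coinv_diff.
  have -> : @lact _ _ (diag_lmod C U) a0 (dk_coact u - u ⊗ hq_proj C 𝟙) =
    dk_coact (@lact _ _ U a0 u) - @lact _ _ (diag_lmod C U) a0 (u ⊗ hq_proj C 𝟙).
    rewrite dk_lcoact; exact: (linB ((lact_bilin (diag_lmod C U)).2 a0)).
  rewrite (linB (kpureL _)); congr (_ - _).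
  rewrite diag_lactE (klift_lin (h := fun y => y ⊗ hq_proj D a1)); [|by lin|by lin].
  by apply: eq_tlift => x y; rewrite -hq_proj_act amul1r.
rewrite klift_sub; [|by lin|by lin]; congr (_ - _).
  by apply: eq_tlift => a0 a1; rewrite kliftE.
rewrite (ca_coact_sum (F := fun a0 h1 h2 => (@lact _ _ U a0 u ⊗ hq_proj C h1) ⊗ hq_proj D h2)).
  apply: eq_tlift => a0 a1; rewrite kliftE // hq_proj_comul klift_kmap //; last by lin.
  by apply: eq_tlift => h1 h2; rewrite hm_proj.
by split; lin.
Qed.

Hypothesis Dff : right_faithfully_flat (ext_rmod D A).
Hypothesis canI : injective (@canV k H A D (diag_lmod C U)).
Variables (X : lmodule (coinv_alg D A)) (i : X -> U).
Hypothesis iM : lmod_mor (Y := restr_lmod (coinv_val_mor A D) U) i.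
Hypothesis iE : exact_pair i coinv_diff.

(** X stands for the coinvariants of U; it is left free because their elements
    occur in several types and over several algebras. *)
Lemma coinv_descent (t : rtens (ext_rmod D A) (restr_lmod (coinv_val_mor A D) U)) :
  Σ_(u ⊗ d <- canV t) dk_coact u ⊗ d =
    Σ_(u ⊗ d <- canV t) Σ_(d1 ⊗ d2 <- comul d) (u ⊗ q d1) ⊗ d2 ->
  exists t' : rtens (ext_rmod D A) X, rmap id i t' = t.
Proof.
move=> e; have /(Dff iM coinv_diff_mor_sub) ex := iE; apply/ex.
apply: canI; rewrite canV_coinv_diff e subrr.
by rewrite (lin0 (@canV_linear k H A D _)).
Qed.
End Descent.

(** * Intermediate algebras: faithful flatness *)
Section RegDk.
Variables (k : fieldType) (H : hopfAlgType k) (A : comodalg H) (C : hquot H).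
Lemma reg_dk_ax : is_dkmod (C := C) (U := reg_lmod A) (@coact _ _ (via C (ca_comod A))).
Proof. by split; [exact: (@cm_ax _ _ (via C (ca_comod A))) | move=> a u; exact: coinv_alg_coact]. Qed.
Definition reg_dk : dkmod A C := Dkmod reg_dk_ax.
End RegDk.

(** S is an algebra between R and A, for which γ(K) is in A ⊗_R S and the
    coaction of A sends S into A ⊗ K.  It is later the algebra of
    C-coinvariants; being abstract keeps the terms small. *)
Section IntermediateAlgebra.
Variables (k : fieldType) (K H : hopfAlgType k) (j : hopf_emb K H).
Variables (A : comodalg H).
Notation D0 := (hquot_id H).
Notation R := (coinv_alg D0 A).
Variables (S : kalgType k) (m : kalg_mor R S) (v : kalg_mor S A).
Hypothesis vm : forall r, v (m r) = val r.
Hypothesis vI : injective v.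
Hypothesis Aff : right_faithfully_flat (ext_rmod D0 A).
Hypothesis canI : injective (@canV k H A D0 (reg_lmod A)).
Notation AA := (rtens (ext_rmod D0 A) (restr_lmod (coinv_val_mor A D0) (reg_lmod A))).
Variable gamma : H -> AA.
Hypothesis gammaP : is_translation gamma.
Notation "Σγ_( l ⊗ r <- h ) E" := (tlift (fun l r : A => E) (gamma h))
  (at level 41, l name, r name, h at level 100, E at level 41).
Notation AS := (rtens (ext_rmod D0 A) (restr_lmod m (reg_lmod S))).
Notation pureS := (rpure (ext_rmod D0 A) (restr_lmod m (reg_lmod S))).
Notation ASbim := (ext_tens m).
Definition tens_val : AS -> AA := rmap id (fun s : S => v s : A).

Lemma v_mor : lmod_mor (X := restr_lmod m (reg_lmod S)) (Y := restr_lmod (coinv_val_mor A D0) (reg_lmod A))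
  v.
Proof. by split=> [|r s]; [exact: km_linear|exact: etrans (kmM v _ _) (congr1 (fun x => x ∙ v s) (vm r))]. Qed.

Lemma tens_val_linear : linear tens_val.
Proof. exact: (rmapid_linear v_mor). Qed.

Lemma tens_valI : injective tens_val.
Proof.
apply/(ff_injective Aff v_mor) => x y; exact: vI.
Qed.

Lemma tens_val_lact a (t : ASbim) :
  tens_val (bm_lact a t) = bm_lact a (tens_val t : AAbim A).
Proof.
have iL := tens_val_linear.
have l1 := (bm_lact_bilin ASbim).2 a; have l2 := (bm_lact_bilin (AAbim A)).2 a.
move: t; apply: tens_ext => [||b s].
- exact: (lin_comp iL l1).
- exact: (lin_comp l2 iL).
by rewrite [bm_lact _ _]tens_lactE /tens_val !(rmapidE v_mor) [RHS]tens_lactE.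
Qed.

Lemma tens_val_ract s (t : ASbim) :
  tens_val (bm_ract t s) = bm_ract (tens_val t : AAbim A) (v s).
Proof.
have iL := tens_val_linear.
have l1 := (bm_ract_bilin ASbim).1 s; have l2 := (bm_ract_bilin (AAbim A)).1 (v s).
move: t; apply: tens_ext => [||b r].
- exact: (lin_comp iL l1).
- exact: (lin_comp l2 iL).
rewrite [bm_ract _ _]tens_ractE /tens_val !(rmapidE v_mor) [RHS]tens_ractE.
congr (pure _ _ _ _); exact: kmM.
Qed.

Variable gammaK : K -> AS.
Hypothesis gammaKL : linear gammaK.
Hypothesis gammaKE : forall x, tens_val (gammaK x) = gamma (j x).
Notation "ΣK_( l ⊗ r <- h ) E" := (tlift (fun (l : A) (r : S) => E) (gammaK h))
  (at level 41, l name, r name, h at level 100, E at level 41).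

Lemma gammaK_sum (P : lmodType k) (f : A -> A -> P) x : bilin f -> Rbal f ->
  ΣK_(l ⊗ s <- x) f l (v s) = Σγ_(l ⊗ r <- j x) f l r.
Proof.
move=> fB fb; have [vL vR] := v_mor; rewrite -gammaKE /tens_val tlift_rmap //.
Qed.

Lemma gammaK1 : gammaK 𝟙 = pureS 𝟙 𝟙.
Proof. apply: tens_valI; rewrite gammaKE he1 (gamma1 canI gammaP) /tens_val (rmapidE v_mor).
by congr (pure _ _ _ _); rewrite km1.
Qed.

(** What a bilinear f must satisfy to induce a map on A ⊗_R S. *)
Definition Kbal (P : Type) (f : A -> S -> P) : Prop :=
  forall a (r : R) s, f (a ∙ val r) s = f a (m r ∙ s).

(** As for γ, from which these rules are inherited along the injection of
    A ⊗_R S into A ⊗_R A. *)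
Lemma gammaK_central (r : R) x :
  bm_lact (val r : A) (gammaK x : ASbim) = bm_ract (gammaK x : ASbim) (m r).
Proof.
by apply: tens_valI; rewrite tens_val_lact tens_val_ract !gammaKE (gamma_central canI gammaP) vm.
Qed.

Lemma gammaKM (P : lmodType k) (f : A -> S -> P) x y : bilin f -> Kbal f ->
  ΣK_(l ⊗ r <- x ∙ y) f l r = ΣK_(l ⊗ r <- x) ΣK_(l' ⊗ r' <- y) f (l ∙ l') (r' ∙ r).
Proof.
move=> fB fb; have lB := bm_lact_bilin ASbim; have rB := bm_ract_bilin ASbim.
have [_ _ lM] := bm_lax ASbim; have [_ _ rM] := bm_rax ASbim.
pose G (l : A) (s : S) : AS := bm_lact l (bm_ract (gammaK y : ASbim) s).
have GB : bilin G.
  by split=> ?; [exact: (lB.1 _)|exact: (lin_comp (lB.2 _) (rB.2 _))].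
have Gb : Kbal G.
  move=> l s r; rewrite /G lM -[bm_lact (val s) _]bm_assoc gammaK_central.
  by rewrite -rM.
have <- : ΣK_(l ⊗ s <- x) G l s = gammaK (x ∙ y).
  apply: tens_valI; rewrite gammaKE heM (tlift_lin _ GB Gb tens_val_linear).
  rewrite -(gammaM_tens canI gammaP) -gammaK_sum; first last.
  - exact: (gamma_nest_bal canI gammaP).
  - exact: gamma_nest_bilin.
  by apply: eq_tlift => l s; rewrite tens_val_lact tens_val_ract gammaKE.
rewrite (tlift_lin (h := tlift f : AS -> P)) //; last exact: tlift_linear.
apply: eq_tlift => l r; rewrite /G sum_lact // sum_ract //.
  by split=> ?; [exact: (lin_comp (fB.1 _) ((amul_bilin (s := A)).2 _))|exact: fB.2].
by move=> a s b; rewrite amulA fb.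
Qed.


Notation sub_ext := (restr_rbimod v).

Section Theta.
Variable X : lmodule S.
Notation Y := (rtens (ext_rmod D0 A) (restr_lmod m X)).
Notation pureY := (rpure (ext_rmod D0 A) (restr_lmod m X)).
Notation T := (rtens (bm_right sub_ext) X).
Notation pureT := (rpure (bm_right sub_ext) X).
Notation Tmod := (restr_lmod (coinv_val_mor A D0) (tens_lmod sub_ext X)).
Notation Z := (rtens (ext_rmod D0 A) Tmod).
Notation pureZ := (rpure (ext_rmod D0 A) Tmod).

Let YB : bilin pureY. Proof. exact: pure_bilin. Qed.
Let TB : bilin pureT. Proof. exact: pure_bilin. Qed.
Let ZB : bilin pureZ. Proof. exact: pure_bilin. Qed.
Let AB := amul_bilin (s := A).
Let XB := lact_bilin X.

Lemma pureY_bal (a : A) (r : R) x : pureY (a ∙ val r) x = pureY a (lact (m r) x).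
Proof. exact: (ext_balanced a r (x : restr_lmod m X)). Qed.
Lemma pureT_bal (a : A) (s : S) x : pureT (a ∙ v s) x = pureT a (lact s x).
Proof. exact: (pure_balanced (@ract _ _ (bm_right sub_ext)) (@lact _ _ X) a s x). Qed.
Lemma pureZ_bal (a : A) (r : R) b x : pureZ (a ∙ val r) (pureT b x) = pureZ a (pureT (val r ∙ b) x).
Proof.
rewrite (ext_balanced a r (pureT b x : Tmod)); congr pureZ.
exact: (tens_lactE (val r : A) (b : sub_ext) x).
Qed.

(** The right action of K on A ⊗_R X. It makes sense because r(x) is in S, and
    it comes from the action of K on the second factor of A ⊗ H. *)
Definition kact1 (x : K) (a : A) (z : X) : Y := ΣK_(l ⊗ s <- x) pureY (a ∙ l) (lact s z).

Lemma kact_bilin a z : bilin (fun (l : A) (s : S) => pureY (a ∙ l) (lact s z)).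
Proof. by split=> ?; [exact: (lin_comp (YB.1 _) (AB.2 _))|exact: (lin_comp (YB.2 _) (XB.1 _))]. Qed.
Lemma kact_bal a z : Kbal (fun (l : A) (s : S) => pureY (a ∙ l) (lact s z)).
Proof. by move=> b r s; rewrite amulA pureY_bal lactA. Qed.

Lemma kact1_bilin x : bilin (kact1 x).
Proof.
have fB := kact_bilin; have fb := kact_bal.
split=> [z|a]; apply: linear_tlift_param => [y|y|l s];
  try by [exact: fB|exact: fb].
  exact: (lin_comp (YB.1 _) (AB.1 _)).
exact: (lin_comp (YB.2 _) (XB.2 _)).
Qed.
Lemma kact1_bal x a (r : R) z : kact1 x (a ∙ val r) z = kact1 x a (lact (m r) z).
Proof.
have fB := kact_bilin a z; have fb := @kact_bal a z; rewrite /kact1.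
transitivity (tlift (fun (l : A) (s : S) => pureY (a ∙ l) (lact s z))
   (bm_lact (val r : A) (gammaK x : ASbim) : AS)).
  by rewrite sum_lact //; apply: eq_tlift => l s; rewrite amulA.
by rewrite gammaK_central sum_ract //; apply: eq_tlift => l s; rewrite lactA.
Qed.
Definition kact (y : Y) (x : K) : Y := tlift (kact1 x) y.
Lemma kactE (a : A) (z : X) x : kact (pureY a z) x = kact1 x a z.
Proof. by apply: (tliftE (f := kact1 x)); [exact: kact1_bilin|exact: kact1_bal]. Qed.
Lemma kact_linear x : linear (kact^~ x).
Proof. by apply: tlift_linear; [exact: kact1_bilin|exact: kact1_bal]. Qed.

Lemma kact_rax : is_rmodule kact.
Proof.
have kL := kact_linear.
split.
- split=> // y a x x'; move: y; apply: tens_ext => [||b z].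
  + exact: kL.
  + exact: (linear_add (linear_scale a (kL x)) (kL x')).
  rewrite !kactE /kact1.
  exact: (lin_comp (tlift_linear (kact_bilin b z) (@kact_bal b z)) gammaKL).
- apply: tens_ext => [||a z] //; rewrite kactE /kact1 gammaK1.
  by rewrite tliftE; [rewrite amul1r lact1|exact: kact_bilin|exact: kact_bal].
move=> x x' y; move: y; apply: tens_ext => [||a z].
- exact: kL.
- exact: (lin_comp (kL _) (kL _)).
rewrite !kactE {1}/kact1 gammaKM; [|exact: kact_bilin|exact: kact_bal].
rewrite {1}/kact1 (tlift_lin _ (kact_bilin a z) (@kact_bal a z) (kL x')).
apply: eq_tlift => l s; rewrite kactE.
by apply: eq_tlift => l' s'; rewrite amulA lactA.
Qed.
Definition kact_rmod : rmodule K := RModule kact_rax.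

Notation YH := (rtens kact_rmod (res_lmod j)).
Notation pureYH := (rpure kact_rmod (res_lmod j)).

(** The isomorphism [theta] from (A ⊗_R X) ⊗_K H to A ⊗_R (A ⊗_S X), first on
    pure tensors, then on A ⊗_R X, then on the whole.  For X = S its
    target is A ⊗_R A, identified with A ⊗ H by the Galois map; it says that this
    right H-module is induced from the K-submodule A ⊗_R S.
    The maps with suffixes 2 and 1 below are stages of this kind. *)
Definition theta2 (a : A) (z : X) (h : H) : Z :=
  Σγ_(l ⊗ r <- h) pureZ (a ∙ l) (pureT r z).
Lemma theta2_bilin a z : bilin (fun l r : A => pureZ (a ∙ l) (pureT r z)).
Proof. by split=> ?; [exact: (lin_comp (ZB.1 _) (AB.2 _))|exact: (lin_comp (ZB.2 _) (TB.1 _))]. Qed.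
Lemma theta2_Rbal a z : Rbal (fun l r : A => pureZ (a ∙ l) (pureT r z)).
Proof. by move=> l r b; rewrite amulA pureZ_bal. Qed.

Lemma theta2_bilin1 h : bilin (fun a z => theta2 a z h).
Proof.
have fB := theta2_bilin; have fb := theta2_Rbal.
split=> [z|a]; apply: linear_tlift_param => [y|y|l s];
  try by [exact: fB|exact: fb].
  exact: (lin_comp (ZB.1 _) (AB.1 _)).
exact: (lin_comp (ZB.2 _) (TB.2 _)).
Qed.
Lemma theta2_bal a (r : R) z h : theta2 (a ∙ val r) z h = theta2 a (lact (m r) z) h.
Proof.
rewrite /theta2.
transitivity (Σγ_(l ⊗ s <- h) pureZ (a ∙ (val r ∙ l)) (pureT s z)).
  by apply: eq_tlift => l s; rewrite amulA.
rewrite (gamma_central_sum canI gammaP (f := fun l s : A => pureZ (a ∙ l) (pureT s z))).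
- by apply: eq_tlift => l s; rewrite -vm pureT_bal.
- exact: theta2_bilin.
- exact: theta2_Rbal.
Qed.
Definition theta1 (y : Y) (h : H) : Z := tlift (fun (a : A) (z : X) => theta2 a z h) y.
Lemma theta1E (a : A) (z : X) h : theta1 (pureY a z) h = theta2 a z h.
Proof.
apply: (tliftE (f := fun (a : A) (z : X) => theta2 a z h)); first exact: theta2_bilin1.
by move=> b r z'; apply: theta2_bal.
Qed.
Lemma theta1_linear h : linear (theta1^~ h).
Proof.
apply: tlift_linear; first exact: theta2_bilin1.
by move=> b r z'; apply: theta2_bal.
Qed.
Lemma theta1_bilin : bilin theta1.
Proof.
have kL := theta1_linear; split=> // y c h h'; move: y; apply: tens_ext => [||b z].
- exact: kL.
- exact: (linear_add (linear_scale c (kL h)) (kL h')).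
rewrite !theta1E /theta2.
exact: (gamma_sum_linear gammaP (theta2_bilin b z) (@theta2_Rbal b z)).
Qed.
(** By [gammaM], the left side involves l(x) l(h) ⊗ r(h) r(x); as r(x) is in S
    it moves across ⊗_S. *)
Lemma theta1_bal (y : Y) (x : K) h : theta1 (kact y x) h = theta1 y (j x ∙ h).
Proof.
move: y; apply: tens_ext => [||a z].
- exact: (lin_comp (theta1_linear h) (kact_linear x)).
- exact: theta1_linear.
have gB l r : bilin (fun l' r' : A => pureZ (a ∙ (l ∙ l')) (pureT (r' ∙ r) z)).
  split=> ?; first exact: (lin_comp (ZB.1 _) (lin_comp (AB.2 a) (AB.2 l))).
  exact: (lin_comp (ZB.2 _) (lin_comp (TB.1 z) (AB.1 r))).
have gb l r : Rbal (fun l' r' : A => pureZ (a ∙ (l ∙ l')) (pureT (r' ∙ r) z)).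
  by move=> b s c; rewrite !amulA pureZ_bal amulA.
pose f (l r : A) := Σγ_(l' ⊗ r' <- h) pureZ (a ∙ (l ∙ l')) (pureT (r' ∙ r) z).
have fB : bilin f.
  split=> [r|l]; apply: linear_tlift_param => [y|y|l' r'];
    try by [exact: gB|exact: gb].
    exact: (lin_comp (ZB.1 _) (lin_comp (AB.2 a) (AB.1 l'))).
  exact: (lin_comp (ZB.2 _) (lin_comp (TB.1 z) (AB.2 r'))).
have fb : Rbal f.
  move=> l s r; rewrite /f.
  transitivity (Σγ_(l' ⊗ r' <- h) pureZ (a ∙ (l ∙ (val s ∙ l'))) (pureT (r' ∙ r) z)).
    by apply: eq_tlift => l' r'; rewrite !amulA.
  rewrite (gamma_central_sum canI gammaP s h (gB l r) (gb l r)).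
  by apply: eq_tlift => l' r'; rewrite !amulA.
rewrite kactE theta1E /theta2 (gammaM canI gammaP); first last.
- exact: theta2_Rbal.
- exact: theta2_bilin.
rewrite -[RHS](gammaK_sum (f := f)) //.
rewrite /kact1 (tlift_lin _ (kact_bilin a z) (@kact_bal a z) (theta1_linear h)).
apply: eq_tlift => l s; rewrite theta1E /theta2 /f.
by apply: eq_tlift => l' r'; rewrite amulA pureT_bal.
Qed.

Definition theta : YH -> Z := tlift theta1.
Let tb : balanced (@ract _ _ kact_rmod) (@lact _ _ (res_lmod j)) theta1.
Proof. exact: theta1_bal. Qed.
Lemma thetaE (a : A) (z : X) h : theta (pureYH (pureY a z) h) = theta2 a z h.
Proof. by rewrite /theta (tliftE theta1_bilin tb) theta1E. Qed.
Lemma theta_linear : linear theta.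
Proof. exact: (tlift_linear theta1_bilin tb). Qed.

Hypothesis coactS : forall s, exists w : A ⊗ K, kmap id j w = ca_coact (v s).

Let HB : bilin pureYH. Proof. exact: pure_bilin. Qed.

(** The inverse of [theta]. The antipode appears because K acts on A ⊗_R X from
    the right. *)
Definition psi2 (a b : A) (z : X) : YH :=
  Σ_(b0 ⊗ b1 <- ca_coact b) pureYH (pureY (a ∙ b0) z) (antipode b1).

Lemma psi2_aux a z :
  bilin (fun (b0 : A) (b1 : H) => pureYH (pureY (a ∙ b0) z) (antipode b1)).
Proof.
split=> ?; first exact: (lin_comp (HB.1 _) (lin_comp (YB.1 _) (AB.2 _))).
exact: (lin_comp (HB.2 _) (@antipode_linear _ _)).
Qed.
Lemma psi2_lin1 b z : linear (fun a => psi2 a b z).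
Proof.
rewrite /psi2; apply: linear_klift_param => [a|x h]; first exact: psi2_aux.
exact: (lin_comp (HB.1 _) (lin_comp (YB.1 _) (AB.1 _))).
Qed.
Lemma psi2_bilin a : bilin (psi2 a).
Proof.
have B := psi2_aux a.
split=> [z|b]; first exact: (lin_comp (klift_linear (B z)) (@ca_coact_linear _ _ A)).
apply: linear_klift_param => // x h.
exact: (lin_comp (HB.1 _) (YB.2 _)).
Qed.

(** The identity [gamma_antipode_tens] takes place in A ⊗_R S, as ρ(s) is in
    A ⊗ K. *)
Lemma gammaK_antipode s (w : A ⊗ K) : kmap id j w = ca_coact (v s) ->
  Σ_(s0 ⊗ x <- w) bm_lact s0 (gammaK (antipode x) : ASbim) = pureS 𝟙 s :> AS.
Proof.
move=> e; have lB := bm_lact_bilin ASbim.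
have B : bilin (fun s0 x => bm_lact s0 (gammaK (antipode x) : ASbim)).
  split=> ?; first exact: (lB.1 _).
  exact: (lin_comp (lB.2 _) (lin_comp gammaKL (@antipode_linear _ _))).
apply: tens_valI; rewrite (klift_lin (h := tens_val)) //; last exact: tens_val_linear.
rewrite [RHS](rmapidE v_mor) -[RHS](gamma_antipode_tens canI gammaP) -e.
rewrite klift_kmap; [|exact: lin_id|exact: he_linear|exact: gamma_antipode_bilin].
by apply: eq_tlift => s0 x; rewrite tens_val_lact gammaKE he_antipode.
Qed.

Lemma psi2_bal a b s z : psi2 a (b ∙ v s) z = psi2 a b (lact s z).
Proof.
have [w e] := coactS s; rewrite /psi2.
have B := psi2_aux a z; rewrite ca_coactM //; apply: eq_tlift => b0 b1; rewrite -e.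
pose f (l : A) (r : S) := pureYH (pureY (a ∙ b0 ∙ l) (lact r z)) (antipode b1).
have fB : bilin f.
  split=> ?; first exact: (lin_comp (HB.1 _) (lin_comp (YB.1 _) (AB.2 _))).
  exact: (lin_comp (HB.1 _) (lin_comp (YB.2 _) (XB.1 _))).
have fb : Kbal f by move=> l r t; rewrite /f amulA pureY_bal lactA.
transitivity (tlift f (pureS 𝟙 s)); last by rewrite tliftE // /f amul1r.
have lB := bm_lact_bilin ASbim.
have gB : bilin (fun s0 x => bm_lact s0 (gammaK (antipode x) : ASbim)).
  split=> ?; first exact: (lB.1 _).
  exact: (lin_comp (lB.2 _) (lin_comp gammaKL (@antipode_linear _ _))).
rewrite -(gammaK_antipode e) (klift_lin (h := tlift f : AS -> YH)) //; last exact: tlift_linear.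
rewrite klift_kmap; [|exact: lin_id|exact: he_linear|]; last first.
  split=> ?.
    exact: (lin_comp (HB.1 _) (lin_comp (YB.1 _) (lin_comp (AB.2 _) (AB.2 _)))).
  exact: (lin_comp (HB.2 _) (lin_comp (@antipode_linear _ _) ((amul_bilin (s := H)).2 _))).
apply: eq_tlift => s0 x; rewrite sum_lact // antipodeM he_antipode.
transitivity (pureYH (kact (pureY (a ∙ (b0 ∙ s0)) z) (antipode x)) (antipode b1)).
  exact/esym/(pure_balanced (@ract _ _ kact_rmod) (@lact _ _ (res_lmod j))).
rewrite kactE /kact1 (tlift_lin _ (kact_bilin _ _) (@kact_bal _ _) (HB.1 _)).
by apply: eq_tlift => l r; rewrite /f !amulA.
Qed.

Definition psi1 (a : A) (t : T) : YH := tlift (psi2 a) t.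
Let psi2b a : balanced (@ract _ _ (bm_right sub_ext)) (@lact _ _ X) (psi2 a).
Proof. by move=> b s z; apply: psi2_bal. Qed.
Lemma psi1E (a b : A) (z : X) : psi1 a (pureT b z) = psi2 a b z.
Proof. exact: (tliftE (psi2_bilin a) (psi2b a)). Qed.
Lemma psi1_linear a : linear (psi1 a).
Proof. exact: (tlift_linear (psi2_bilin a) (psi2b a)). Qed.
Lemma psi1_bilin : bilin psi1.
Proof.
split=> [t|]; last exact: psi1_linear.
apply: linear_tlift_param => [a|a|b z].
- exact: psi2_bilin.
- exact: psi2b.
exact: psi2_lin1.
Qed.
Lemma psi1_bal (a : A) (r : R) t :
  psi1 (a ∙ val r) t = psi1 a (tens_lact (P := sub_ext) (val r : A) t).
Proof.
have tL := @tens_lact_linear _ _ _ sub_ext X (val r : A).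
move: t; apply: tens_ext => [||b z].
- exact: psi1_linear.
- exact: (lin_comp (psi1_linear a) tL).
rewrite tens_lactE !psi1E /psi2 ca_coactM.
  rewrite coinv_idP kliftE; first by apply: eq_tlift => b0 b1; rewrite amul1l !amulA.
  exact: (ca_coactM_bilin b (psi2_aux a z)).
exact: psi2_aux.
Qed.

Definition psi : Z -> YH := tlift psi1.
Let pb : balanced (@ract _ _ (ext_rmod D0 A)) (@lact _ _ Tmod) psi1.
Proof. exact: psi1_bal. Qed.
Lemma psiE (a b : A) (z : X) : psi (pureZ a (pureT b z)) = psi2 a b z.
Proof. by rewrite /psi (tliftE psi1_bilin pb) psi1E. Qed.
Lemma psi_linear : linear psi.
Proof. exact: (tlift_linear psi1_bilin pb). Qed.

(** The composite sends (a ⊗ z) ⊗ h to (a l r_[0] ⊗ z) ⊗ S(r_[1]), where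
    l ⊗ r is γ(h). *)
Lemma thetaK : cancel theta psi.
Proof.
apply: tens_ext => [||y h]; [exact: (lin_comp psi_linear theta_linear)|exact: lin_id|].
move: y; apply: tens_ext => [||a z].
- exact: (lin_comp psi_linear (lin_comp theta_linear (HB.1 h))).
- exact: HB.1.
rewrite thetaE /theta2 (tlift_lin _ (theta2_bilin a z) (@theta2_Rbal a z) psi_linear).
transitivity (Σγ_(l ⊗ r <- h) Σ_(r0 ⊗ r1 <- ca_coact r)
    pureYH (pureY (a ∙ (l ∙ r0)) z) (antipode r1)).
  apply: eq_tlift => l r; rewrite psiE.
  by apply: eq_tlift => r0 r1; rewrite amulA.
rewrite (gamma_coact_right gammaP (f := fun (x : A) (g : H) => pureYH (pureY (a ∙ x) z) g)).
  by rewrite amul1r.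
by split=> ?; [exact: (lin_comp (HB.1 _) (lin_comp (YB.1 _) (AB.2 _)))|exact: HB.2].
Qed.

(** The composite sends a ⊗ (b ⊗ z) to a b_[0] l ⊗ (r ⊗ z), where l ⊗ r is
    γ(S(b_[1])). *)
Lemma psiK : cancel psi theta.
Proof.
apply: tens_ext => [||a t]; [exact: (lin_comp theta_linear psi_linear)|exact: lin_id|].
move: t; apply: tens_ext => [||b z].
- exact: (lin_comp theta_linear (lin_comp psi_linear (ZB.2 a))).
- exact: ZB.2.
rewrite psiE /psi2 (klift_lin (h := theta)); [|exact: psi2_aux|exact: theta_linear].
transitivity (Σ_(b0 ⊗ b1 <- ca_coact b) Σγ_(l ⊗ r <- antipode b1)
   pureZ (a ∙ (b0 ∙ l)) (pureT r z)).
  apply: eq_tlift => b0 b1; rewrite thetaE.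
  by apply: eq_tlift => l r; rewrite amulA.
rewrite (gamma_antipode canI gammaP (f := fun l r : A => pureZ (a ∙ l) (pureT r z))).
- by rewrite amul1r.
- exact: theta2_bilin.
- exact: theta2_Rbal.
Qed.

End Theta.

Section ThetaNatural.
Variables (X X' : lmodule S) (f : X -> X').
Hypothesis fM : lmod_mor f.

Definition kact_map : kact_rmod X -> kact_rmod X' := rmap id f.
Lemma kact_mapE (a : A) (z : X) : kact_map (rpure (ext_rmod D0 A) (restr_lmod m X) a z) =
  rpure (ext_rmod D0 A) (restr_lmod m X') a (f z).
Proof. exact: (rmapidE (restr_mor m fM)). Qed.

Lemma kact_map_mor : rmod_mor kact_map.
Proof.
have L := rmapid_linear (P := ext_rmod D0 A) (restr_mor m fM); have [fL fS] := fM.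
split=> // y x; move: y; apply: tens_ext => [||a z].
- exact: (lin_comp L (kact_linear x)).
- exact: (lin_comp (kact_linear x) L).
rewrite [ract _ _]kactE [LHS](tlift_lin _ (kact_bilin a z) (@kact_bal _ a z) L).
rewrite kact_mapE [RHS]kactE; apply: eq_tlift => l s.
by rewrite [LHS]kact_mapE fS.
Qed.

Definition theta_map : rtens (kact_rmod X) (res_lmod j) -> rtens (kact_rmod X') (res_lmod j) :=
  rmap kact_map id.
Definition ext_map : tens_lmod sub_ext X -> tens_lmod sub_ext X' := tens_fmap (P := sub_ext) f.

Lemma ext_map_mor : lmod_mor (X := restr_lmod (coinv_val_mor A D0) (tens_lmod sub_ext X))
  (Y := restr_lmod (coinv_val_mor A D0) (tens_lmod sub_ext X')) ext_map.
Proof. exact/restr_mor/tens_fmap_mor. Qed.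

Lemma theta_natural t : theta (theta_map t) = rmap id ext_map (theta t).
Proof.
have [L R0] := kact_map_mor; have EM := ext_map_mor.
have LL : linear theta_map by apply: rmap_linear.
have L3 := rmapid_linear (P := ext_rmod D0 A) EM.
have HB X0 := pure_bilin (@ract _ _ (kact_rmod X0)) (@lact _ _ (res_lmod j)).
move: t; apply: tens_ext => [||y h].
- exact: (lin_comp (theta_linear (X := X')) LL).
- exact: (lin_comp L3 (theta_linear (X := X))).
have e y' : theta_map (pure _ _ y' h) = pure _ _ (kact_map y') h.
  by apply: rmapE.
move: y; apply: tens_ext => [||a z].
- exact: (lin_comp (theta_linear (X := X')) (lin_comp LL ((HB X).1 h))).
- exact: (lin_comp L3 (lin_comp (theta_linear (X := X)) ((HB X).1 h))).
rewrite e kact_mapE !thetaE.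
rewrite /theta2 (tlift_lin _ (theta2_bilin a z) (@theta2_Rbal _ a z) L3).
apply: eq_tlift => l r; rewrite (rmapidE EM); congr pure.
by rewrite [RHS](tens_fmapE (P := sub_ext) fM).
Qed.
End ThetaNatural.

Hypothesis coactS : forall s, exists w : A ⊗ K, kmap id j w = ca_coact (v s).
Hypothesis Hff : left_faithfully_flat (res_lmod j).

(** Exactness of f, g over S is equivalent to that of their base changes along
    A over R, then along H over K. By [theta_natural], what is obtained is the
    base change along A over R of the base change along A over S, and A over R
    can be removed. *)
Theorem ff_intermediate : right_faithfully_flat (bm_right sub_ext).
Proof.
move=> X Y Z f g fM gM.
rewrite (Aff (restr_mor m fM) (restr_mor m gM)).
rewrite (Hff (kact_map_mor fM) (kact_map_mor gM)).
rewrite (Aff (ext_map_mor fM) (ext_map_mor gM)).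
apply: (exact_pair_iso (e1 := @theta X) (e2 := @theta Y) (e3 := @theta Z)).
- by exists (@psi X); [exact: thetaK|exact: psiK].
- by exists (@psi Y); [exact: thetaK|exact: psiK].
- by exists (@psi Z); [exact: thetaK|exact: psiK].
- exact: theta_linear.
- exact: theta_natural.
- exact: theta_natural.
Qed.
End IntermediateAlgebra.

(** * The quotient by a Hopf subalgebra *)
Section HopfSubalgebra.
Variables (k : fieldType) (K H : hopfAlgType k) (j : hopf_emb K H).
Variables (A : comodalg H) (C : hquot H).
Notation D0 := (hquot_id H).
Notation R := (coinv_alg D0 A).
Notation A0 := (coinv_alg C A).
Notation sub := (coinv_sub (hm_of_id C) A).
Hypothesis jC : forall x : K, hq_proj C (j x) = counit x *: hq_proj C 𝟙.
Hypothesis kerC : forall h, hq_proj C h = 0 -> kspan (HKplus j) h.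
Hypothesis Aff : right_faithfully_flat (ext_rmod D0 A).
Hypothesis canI : injective (@canV k H A D0 (reg_lmod A)).
Notation AA := (rtens (ext_rmod D0 A) (restr_lmod (coinv_val_mor A D0) (reg_lmod A))).
Variable gamma : H -> AA.
Hypothesis gammaP : is_translation gamma.
Notation "Σγ_( l ⊗ r <- h ) E" := (tlift (fun l r : A => E) (gamma h))
  (at level 41, l name, r name, h at level 100, E at level 41).
Notation pureC X := (rpure (ext_rmod C A) X).

Lemma canV_id_bijective V : bijective (@canV k H A D0 V).
Proof.
apply: (canV_bijective canI gammaP) => h /= h0 V' v.
by rewrite h0 (lin0 ((canV_inv_bilin D0 gammaP V').2 v)).
Qed.

Definition A0R : lmodule R := restr_lmod sub (reg_lmod A0).
Notation AK := (rtens (ext_rmod D0 A) A0R).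
Notation vA := (coinv_val_mor A C).

Lemma val_coinv_sub (r : R) : vA (sub r) = val r. Proof. by []. Qed.
Lemma coinv_valI : injective vA. Proof. by move=> x y; apply: val_inj. Qed.
Notation valAA := (@tens_val k H A A0 sub vA).
(** The element γ(x) is in the kernel A ⊗_R A0 of A ⊗_R A -> A ⊗_R (A ⊗ C)
    because x, being in K, satisfies x_(1) ⊗ x_(2) = 𝟙 ⊗ x in C ⊗ H. *)
Lemma gammaK_exists : exists2 gammaK : K -> AK, linear gammaK & forall x, valAA (gammaK x) = gamma (j x).
Proof.
have /choice [gammaK gammaKE] : forall x, exists t, valAA t = gamma (j x).
  move=> x.
  have iM := v_mor val_coinv_sub; have iE : exact_pair vA (@coinv_diff _ _ _ _ (reg_dk A C)).
    move=> u; rewrite coinv_diff_eq0; split=> [uP|[v <-]]; last exact: valP.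
    by exists (@Coinv _ _ _ (via C (ca_comod A)) u uP).
  apply: (@coinv_descent _ _ _ _ (reg_dk A C) D0 (hm_of_id C) Aff
     (bij_inj (canV_id_bijective _)) _ _ iM iE).
  rewrite gammaP.2 !kliftE; [|by lin|by lin].
  have [_ c1 _] := ca_ax A.
  rewrite [dk_coact _]/(kmap id (hq_proj C) (ca_coact 𝟙)) c1.
  have pL := hq_proj_linear C.
  rewrite kliftE; last by lin.
  rewrite he_comul klift_kmap; [|by lin..].
  transitivity (Σ_(x1 ⊗ x2 <- comul x) counit x1 *: ((𝟙 ⊗ hq_proj C 𝟙) ⊗ j x2 : (A ⊗ C) ⊗ H)).
    by rewrite (comul_counitl (f := fun x => (𝟙 ⊗ hq_proj C 𝟙) ⊗ j x)) //; lin.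
  apply: eq_tlift => x1 x2.
  by rewrite [hm_of_id C _]jC (linZ (kpureR _)) (linZ (kpureL _)).
exists gammaK => // a x y; apply: (tens_valI val_coinv_sub coinv_valI Aff).
rewrite (tens_val_linear val_coinv_sub) !gammaKE (he_linear j).
exact: gammaP.1.
Qed.

Variable gammaK : K -> AK.
Hypothesis gammaKL : linear gammaK.
Hypothesis gammaKE : forall x, valAA (gammaK x) = gamma (j x).
Notation "ΣK_( l ⊗ r <- h ) E" := (tlift (fun (l : A) (r : A0) => E) (gammaK h))
  (at level 41, l name, r name, h at level 100, E at level 41).
Let gammaK_sum := gammaK_sum val_coinv_sub gammaKE.

(** l(gx) ⊗ r(gx) v = l(g) l(x) ⊗ r(x) r(g) v in A ⊗_A0 V, and r(x) in A0 moves to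
    the left, where l(x) r(x) = ε(x). *)
Lemma gammaC (h : H) : hq_proj C h = 0 ->
  forall (V : lmodule A) (v : V), canV_inv C gamma v h = 0.
Proof.
move=> /kerC h0 V v; have iL := (canV_inv_bilin C gammaP V).2 v.
elim: h0 => [|a u w [g x x0] _ IH]; first exact: lin0 iL.
rewrite iL IH addr0; suff -> : canV_inv C gamma v (g ∙ j x) = 0 by rewrite scaler0.
have fB := pureC_lact_bilin C v; have fb := @pureC_lact_bal _ _ A C _ v.
rewrite /canV_inv (gammaM canI gammaP) //.
have pB := pure_bilin (@ract _ _ (ext_rmod C A)) (@lact _ _ (restr_lmod (coinv_val_mor A C) V)).
transitivity (Σγ_(l ⊗ r <- g) (0 : rtens (ext_rmod C A) (restr_lmod (coinv_val_mor A C) V))).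
  apply: eq_tlift => l r.
  rewrite -(gammaK_sum (f := fun l' r' => pureC (restr_lmod (coinv_val_mor A C) V) (l ∙ l') (lact (r' ∙ r) v))); first last.
  - by move=> a' s b; rewrite -!amulA amulA fb.
  - split=> ?; first exact: (lin_comp (fB.1 _) ((amul_bilin (s := A)).2 _)).
    exact: (lin_comp (fB.2 _) ((amul_bilin (s := A)).1 _)).
  transitivity (ΣK_(l' ⊗ s <- x) pureC (restr_lmod (coinv_val_mor A C) V) (l ∙ (l' ∙ val s)) (lact r v)).
    apply: eq_tlift => l' s; rewrite amulA lactA.
    by rewrite (ext_balanced (X := restr_lmod (coinv_val_mor A C) V)).
  rewrite (gammaK_sum (f := fun l' r' => pureC (restr_lmod (coinv_val_mor A C) V) (l ∙ (l' ∙ r')) (lact r v))); first last.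
  - by move=> a' s b; rewrite !amulA.
  - have LL := lin_comp (pB.1 (lact r v)) ((amul_bilin (s := A)).2 l).
    split=> ?; first exact: (lin_comp LL ((amul_bilin (s := A)).1 _)).
    exact: (lin_comp LL ((amul_bilin (s := A)).2 _)).
  rewrite (gamma_mul gammaP (f := fun y => pureC (restr_lmod (coinv_val_mor A C) V) (l ∙ y) (lact r v))).
    by rewrite he_counit x0 scale0r.
  exact: (lin_comp (pB.1 (lact r v)) ((amul_bilin (s := A)).2 l)).
have z0 : linear (fun=> 0 : rtens (ext_rmod C A) (restr_lmod (coinv_val_mor A C) V)).
  by move=> W a' y z; rewrite scaler0 addr0.
by rewrite -(tlift_lin (h := fun=> 0 : rtens (ext_rmod C A) (restr_lmod (coinv_val_mor A C) V)) (gamma g) fB fb).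
Qed.

Lemma canC_bijective V : bijective (@canV k H A C V).
Proof. exact: (canV_bijective canI gammaP gammaC). Qed.


Theorem ext_faithfully_flat : left_faithfully_flat (res_lmod j) ->
  (forall s : A0, exists w : A ⊗ K, kmap id j w = ca_coact (val s)) ->
  right_faithfully_flat (ext_rmod C A).
Proof.
move=> Hff coactA.
exact: (ff_intermediate val_coinv_sub coinv_valI Aff canI gammaP gammaKL gammaKE coactA Hff).
Qed.
End HopfSubalgebra.

(** * The structure theorem for Doi-Hopf modules *)
Section StructureTheorem.
Variables (k : fieldType) (H : hopfAlgType k) (C : hquot H) (A : comodalg H).
Notation A0 := (coinv_alg C A).
Hypothesis Cff : right_faithfully_flat (ext_rmod C A).
Hypothesis canB : forall V, bijective (@canV k H A C V).
Notation pureC X := (rpure (ext_rmod C A) X).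

Section Counit.
Variable U : dkmod A C.
Notation T := (rtens (ext_rmod C A) (coinv_lmod U)).
Let lB := lact_bilin U.

Definition coinv_counit : T -> U := tlift (fun (a : A) (u : coinv_lmod U) => lact a (val u : U)).

Let cB : bilin (fun (a : A) (u : coinv_lmod U) => lact a (val u : U)).
Proof. by split=> ?; [exact: lB.1|exact: (lin_comp (lB.2 _) (@val_linear _ _ C (dk_comod U)))]. Qed.
Let cb : balanced (@ract _ _ (ext_rmod C A)) (@lact _ _ (coinv_lmod U))
  (fun (a : A) (u : coinv_lmod U) => lact a (val u : U)).
Proof. by move=> a s u; rewrite [LHS]lactA. Qed.

Lemma coinv_counitE (a : A) (u : coinv_lmod U) :
  coinv_counit (pureC (coinv_lmod U) a u) = lact a (val u : U).
Proof. exact: (tliftE cB cb). Qed.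
Lemma coinv_counit_linear : linear coinv_counit.
Proof. exact: (tlift_linear cB cb). Qed.

Lemma dk_coact_lact_coinv (a : A) (u : coinv_lmod U) :
  dk_coact (lact a (val u : U)) =
  Σ_(a0 ⊗ a1 <- ca_coact a) lact a0 (val u : U) ⊗ hq_proj C a1.
Proof.
rewrite dk_lcoact [dk_coact _](coinvE u) tprod_pureR; [|exact: lB|exact: hq_act_bilin].
by apply: eq_tlift => a0 a1; rewrite -hq_proj_act amul1r.
Qed.

Lemma coinv_counit_mor : dk_mor (U := ind_dk (coinv_lmod U)) coinv_counit.
Proof.
have cL := coinv_counit_linear.
have [iL _ _] := dk_cm (ind_dk (coinv_lmod U)).
have pB := pure_bilin (@ract _ _ (ext_rmod C A)) (@lact _ _ (coinv_lmod U)).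
have pL := hq_proj_linear C.
split.
  split=> // a; have [tB _ _] := tens_lax (ext_bimod C A) (coinv_lmod U).
  apply: tens_ext => [||b u].
  - exact: (lin_comp cL (tB.2 a)).
  - exact: (lin_comp (lB.2 a) cL).
  rewrite [lact _ _]tens_lactE [LHS]coinv_counitE [in RHS]coinv_counitE.
  by rewrite [LHS]lactA.
apply: tens_ext => [||a u].
- exact: (lin_comp (@dk_coact_linear _ _ _ _ U) cL).
- exact: (lin_comp (kmap_linear cL (@lin_id _ C)) iL).
rewrite [in LHS]coinv_counitE dk_coact_lact_coinv.
rewrite [dk_coact _]ind_coactE (kmap_comp _ cL (@lin_id _ _) (pB.1 u) (@lin_id _ _)).
rewrite [coact _]/(kmap id (hq_proj C) (ca_coact a)).
rewrite (eq_kmap (f' := fun b : A => lact b (val u : U)) (g' := id)) //; last first.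
  by move=> b; rewrite coinv_counitE.
exact/esym/(etrans (kmap_comp (ca_coact a) (lB.1 _) (@lin_id _ C) (@lin_id _ A) pL)).
Qed.

Lemma val_coinv_mor : lmod_mor (Y := restr_lmod (coinv_val_mor A C) U)
  (fun u : coinv_lmod U => val u : U).
Proof. by split=> // ; exact: val_linear. Qed.

(** This computes [coinv_counit] through the Galois bijection of U. *)
Lemma canV_rmap_val (t : T) :
  canV (rmap id (fun u : coinv_lmod U => val u : U) t :
    rtens (ext_rmod C A) (restr_lmod (coinv_val_mor A C) U)) =
  dk_coact (coinv_counit t).
Proof.
have cL := coinv_counit_linear; have VM := val_coinv_mor.
move: t; apply: tens_ext => [||a u].
- exact: (lin_comp (@canV_linear _ _ A C U) (rmapid_linear VM)).
- exact: (lin_comp (@dk_coact_linear _ _ _ _ U) cL).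
by rewrite (rmapidE VM) canVE coinv_counitE dk_coact_lact_coinv.
Qed.

Lemma dk_coactI : injective (@dk_coact _ _ _ _ U).
Proof.
have [_ _ r1] := dk_cm U.
exact: (can_inj (g := tlift (fun y c => counit c *: y))).
Qed.

(** A ⊗_A0 U^co is the kernel of A ⊗_A0 [coinv_diff]; under the Galois
    bijections it is the kernel of the cobar differential U ⊗ C -> U ⊗ C ⊗ C,
    which is the image of ρ by coassociativity. *)
Lemma coinv_counit_bijective : bijective coinv_counit.
Proof.
have VM := val_coinv_mor.
apply: inj_surj_bij => [t t' e|u].
  have /(ff_injective Cff VM) : injective (fun u : coinv_lmod U => val u : U) by exact: val_inj.
  by apply; apply: (bij_inj (canB U)); rewrite !canV_rmap_val e.
have [ci ciK cK] := canB U.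
have [|t' e] := @coinv_descent _ _ _ _ U C (hm_id C) Cff (bij_inj (canB _))
   (coinv_lmod U) _ VM (@coinv_exact _ _ _ _ U) (ci (dk_coact u)).
  rewrite cK.
  have := coact_sum (X := dk_comod U) (F := fun u c d => (u ⊗ c) ⊗ d) u.
  rewrite /= => <-; last by split; lin.
  by apply: eq_tlift => y c; rewrite -{1}[dk_coact y]tlift_pure (klift_lin (h := fun z => z ⊗ c)); lin.
exists t'; apply: dk_coactI; rewrite -canV_rmap_val e cK //.
Qed.
End Counit.

Section Unit.
Variable Q : lmodule A0.
Notation T := (ind_dk Q).
Notation pureQ := (rpure (ext_rmod C A) Q).
Let pB : bilin pureQ. Proof. exact: pure_bilin. Qed.

Lemma coinv_unit_subproof (q : Q) : pureQ 𝟙 q \in @coinv_pred _ _ _ (dk_comod T).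
Proof.
have [_ c1 _] := ca_ax A; have pL := hq_proj_linear C.
apply/eqP; rewrite [coact _]ind_coactE [coact _]/(kmap id (hq_proj C) (ca_coact 𝟙)) c1.
rewrite kliftE; last by lin.
by rewrite kmapE //; exact: pB.1.
Qed.
Definition coinv_unit (q : Q) : coinv_lmod T := Coinv (coinv_unit_subproof q).

Lemma coinv_unit_mor : lmod_mor coinv_unit.
Proof.
split=> [a x y|s q]; apply: val_inj.
  by rewrite val_linear /= pB.2.
rewrite /= -(ext_balanced (𝟙 : A) s q) amul1l [RHS]tens_lactE.
by congr (pure _ _ _ _); rewrite [RHS]amul1r.
Qed.

Lemma coinv_counit_unit t : coinv_counit (rmap id coinv_unit t) = t :> T.
Proof.
have eL := @coinv_counit_linear T; have uM := coinv_unit_mor.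
move: t; apply: tens_ext => [||a q].
- exact: (lin_comp eL (rmapid_linear uM)).
- exact: lin_id.
rewrite (rmapidE uM) coinv_counitE [lact _ _]tens_lactE.
by congr (pure _ _ _ _); rewrite [LHS]amul1r.
Qed.

(** By the triangle identity [coinv_counit_unit], A ⊗_A0 - turns the unit into a
    bijection. *)
Lemma coinv_unit_bijective : bijective coinv_unit.
Proof.
have uM := coinv_unit_mor; have eK := coinv_counit_unit.
have [e' eK1 eK2] := coinv_counit_bijective T.
apply: inj_surj_bij; first by apply/(ff_injective Cff uM); exact: (can_inj eK).
apply/(ff_surjective Cff uM) => y; exists (coinv_counit y).
by apply: (can_inj eK1); rewrite eK.
Qed.
End Unit.
End StructureTheorem.

(** * Tensor products of coinvariants *)
Section BicomodAsDk.
Variables (k : fieldType) (H : hopfAlgType k) (C : hquot H) (A B : comodalg H).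
Variable N : bicomod B A.

Lemma bc_dkC_ax : is_dkmod (C := C) (U := bm_left N) (@coact _ _ (via C (bc_comod N))).
Proof.
split; first exact: (@cm_ax _ _ (via C (bc_comod N))).
move=> b n; have lB := bm_lact_bilin N.
exact: (@via_coact _ _ C (ca_comod B) (bc_comod N) (bc_comod N) _ lB (bc_lcoact (M := N))).
Qed.
Definition bc_dkC : dkmod B C := Dkmod bc_dkC_ax.

Notation N0 := (coinv_bimod C N).
Notation EN := (rtens (ext_rmod C B) (bm_left N0)).

Lemma coinv_bc_subproof (n : N0) : (val n : N) \in @coinv_pred _ _ _ (dk_comod bc_dkC).
Proof. exact: (valP n). Qed.
(** The coinvariants of N as a bicomodule and as a Doi-Hopf module have the same
    elements but live in different types. *)
Definition coinv_bc_to (n : N0) : coinv_lmod bc_dkC := Coinv (coinv_bc_subproof n).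

Lemma coinv_bc_to_mor : lmod_mor (X := bm_left N0) coinv_bc_to.
Proof.
split=> [a x y|s n]; apply: val_inj => //.
Qed.

Lemma coinv_bc_to_bijective : bijective coinv_bc_to.
Proof.
apply: inj_surj_bij => [x y /(congr1 val) e|[n nP]]; first exact: val_inj.
by exists (@Coinv _ _ _ (via C (bc_comod N)) n nP); apply: val_inj.
Qed.

Definition bc_counit : EN -> N := tlift (fun (b : B) (n : N0) => bm_lact b (val n : N)).

Let lB := bm_lact_bilin N.
Let valL : linear (fun n : N0 => val n : N) := @val_linear _ _ C (via C (bc_comod N)).
Let cB : bilin (fun (b : B) (n : N0) => bm_lact b (val n : N)).
Proof. by split=> ?; [exact: lB.1|exact: (lin_comp (lB.2 _) valL)]. Qed.
Let cb : balanced (@ract _ _ (ext_rmod C B)) (@lact _ _ (bm_left N0))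
  (fun (b : B) (n : N0) => bm_lact b (val n : N)).
Proof. by move=> a s u; have [_ _ lA] := bm_lax N; rewrite [LHS]lA. Qed.

Lemma bc_counitE (b : B) (n : N0) :
  bc_counit (rpure (ext_rmod C B) (bm_left N0) b n) = bm_lact b (val n : N).
Proof. exact: (tliftE cB cb). Qed.
Lemma bc_counit_linear : linear bc_counit.
Proof. exact: (tlift_linear cB cb). Qed.

Lemma bc_counit_lact b (t : tens_bimod (ext_bimod C B) N0) :
  bc_counit (bm_lact b t) = bm_lact b (bc_counit t).
Proof.
have eL := bc_counit_linear; have [_ _ lA] := bm_lax N.
have L := (bm_lact_bilin (tens_bimod (ext_bimod C B) N0)).2 b.
move: t; apply: tens_ext => [||c n].
- exact: (lin_comp eL L).
- exact: (lin_comp (lB.2 b) eL).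
by rewrite [bm_lact _ _]tens_lactE !bc_counitE [LHS]lA.
Qed.

Lemma bc_counit_ract s (t : tens_bimod (ext_bimod C B) N0) :
  bc_counit (bm_ract t s) = bm_ract (bc_counit t) (val s).
Proof.
have eL := bc_counit_linear.
have L := (bm_ract_bilin (tens_bimod (ext_bimod C B) N0)).1 s.
move: t; apply: tens_ext => [||c n].
- exact: (lin_comp eL L).
- exact: (lin_comp ((bm_ract_bilin N).1 _) eL).
by rewrite [bm_ract _ _]tens_ractE !bc_counitE [RHS]bm_assoc.
Qed.

Hypothesis Bff : right_faithfully_flat (ext_rmod C B).
Hypothesis canB : forall V, bijective (@canV k H B C V).

Lemma bc_counit_bijective : bijective bc_counit.
Proof.
have M := coinv_bc_to_mor.
have e : bc_counit =1 coinv_counit (U := bc_dkC) \o rmap id coinv_bc_to.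
  apply: tens_ext => [||b n]; first exact: bc_counit_linear.
    exact: (lin_comp (@coinv_counit_linear _ _ _ _ bc_dkC) (rmapid_linear M)).
  apply: etrans (bc_counitE b n) (esym _).
  apply: etrans (congr1 (coinv_counit (U := bc_dkC)) (rmapidE M b n)) _.
  exact: coinv_counitE.
apply: (eq_bij (f := coinv_counit (U := bc_dkC) \o rmap id coinv_bc_to)) => //.
apply: bij_comp; first exact: (coinv_counit_bijective Bff canB).
exact: (rmapid_bijective (ext_rmod C B) M coinv_bc_to_bijective).
Qed.
End BicomodAsDk.

Section Lambda.
Variables (k : fieldType) (H : hopfAlgType k) (C : hquot H) (A B : comodalg H).
Variable N : bicomod B A.
Notation A0 := (coinv_alg C A).
Notation N0 := (coinv_bimod C N).
Notation EN := (tens_bimod (ext_bimod C B) N0).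
Hypothesis Bff : right_faithfully_flat (ext_rmod C B).
Hypothesis canB : forall V, bijective (@canV k H B C V).

Section Q.
Variable Q : lmodule A0.
Notation NQ := (tens_lmod N0 Q).
Notation L := (rtens (ext_rmod C B) NQ).
Notation AQ := (tens_lmod (ext_bimod C A) Q).
Notation R := (rtens (bm_right N) AQ).
Notation pureNQ := (rpure (bm_right N0) Q).
Notation pureL := (rpure (ext_rmod C B) NQ).
Notation pureAQ := (rpure (ext_rmod C A) Q).
Notation pureR := (rpure (bm_right N) AQ).
Let BNQ : bilin pureNQ. Proof. exact: pure_bilin. Qed.
Let BL : bilin pureL. Proof. exact: pure_bilin. Qed.
Let BAQ : bilin pureAQ. Proof. exact: pure_bilin. Qed.
Let BR : bilin pureR. Proof. exact: pure_bilin. Qed.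
Let lB := bm_lact_bilin N.
Let rB := bm_ract_bilin N.
Let valL : linear (fun n : N0 => val n : N) := @val_linear _ _ C (via C (bc_comod N)).

Lemma pureR_bal (n : N) (a : A) (t : AQ) : pureR (bm_ract n a) t = pureR n (lact a t).
Proof. exact: (pure_balanced (@ract _ _ (bm_right N)) (@lact _ _ AQ)). Qed.
Lemma pureAQ1 (a : A) q : lact a (pureAQ 𝟙 q : AQ) = pureAQ a q :> AQ.
Proof. by rewrite [LHS]tens_lactE; congr (pure _ _ _ _); exact: amul1r. Qed.

(** The isomorphism B ⊗_B0 (N0 ⊗_A0 Q) = N ⊗_A (A ⊗_A0 Q) underlying the
    squares. *)
Definition lambda2 (b : B) (n : N0) (q : Q) : R := pureR (bm_lact b (val n)) (pureAQ 𝟙 q).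

Lemma lambda2_bilin b : bilin (lambda2 b).
Proof.
split=> ?; first exact: (lin_comp (BR.1 _) (lin_comp (lB.2 b) valL)).
exact: (lin_comp (BR.2 _) (BAQ.2 _)).
Qed.
Lemma lambda2_bal b : balanced (@ract _ _ (bm_right N0)) (@lact _ _ Q) (lambda2 b).
Proof.
move=> n s q; rewrite /lambda2 [val _]/(bm_ract (val n) (val s)) -bm_assoc pureR_bal.
by rewrite pureAQ1 -(amul1l (val s)) [pureAQ _ _](ext_balanced (𝟙 : A) s q).
Qed.
Definition lambda1 (b : B) (t : NQ) : R := tlift (lambda2 b) t.
Lemma lambda1E (b : B) (n : N0) (q : Q) : lambda1 b (pureNQ n q) = lambda2 b n q.
Proof. exact: (tliftE (lambda2_bilin b) (lambda2_bal b)). Qed.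
Lemma lambda1_bilin : bilin lambda1.
Proof.
split=> [t|b]; last exact: (tlift_linear (lambda2_bilin b) (lambda2_bal b)).
apply: linear_tlift_param => [b|b|n q]; [exact: lambda2_bilin|exact: lambda2_bal|].
exact: (lin_comp (BR.1 _) (lB.1 _)).
Qed.
Lemma lambda1_bal : balanced (@ract _ _ (ext_rmod C B)) (@lact _ _ NQ) lambda1.
Proof.
move=> b s; have [tB _ _] := tens_lax N0 Q; have [_ _ lA] := bm_lax N.
apply: tens_ext => [||n q]; first exact: (lambda1_bilin.2 _).
  exact: (lin_comp (lambda1_bilin.2 b) (tB.2 s)).
rewrite [lact _ _]tens_lactE !lambda1E /lambda2; congr pureR; exact: lA.
Qed.
Definition lambda : L -> R := tlift lambda1.
Lemma lambdaE (b : B) (n : N0) (q : Q) :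
  lambda (pureL b (pureNQ n q)) = pureR (bm_lact b (val n)) (pureAQ 𝟙 q).
Proof. by rewrite /lambda (tliftE lambda1_bilin lambda1_bal) lambda1E. Qed.
Lemma lambda_linear : linear lambda.
Proof. exact: (tlift_linear lambda1_bilin lambda1_bal). Qed.

Lemma lambda_ext (P : lmodType k) (f g : L -> P) : linear f -> linear g ->
  (forall b n q, f (pureL b (pureNQ n q)) = g (pureL b (pureNQ n q))) -> f =1 g.
Proof.
move=> fL gL e; apply: tens_ext => // b t; move: t.
by apply: tens_ext => [||n q] //; [exact: (lin_comp fL (BL.2 b))|exact: (lin_comp gL (BL.2 b))].
Qed.

(** The inverse of [lambda] sends n ⊗ (a ⊗ q) to [lambda_at q t], where t is the
    element of B ⊗_B0 N0 that corresponds to n a. *)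
Definition lambda_at (q : Q) : EN -> L := rmap id (fun n : N0 => pureNQ n q).
Lemma lambda_at_mor q : lmod_mor (X := bm_left N0) (Y := NQ) (fun n : N0 => pureNQ n q).
Proof.
split; first exact: (BNQ.1 q).
by move=> s n; rewrite [RHS]tens_lactE.
Qed.
Lemma lambda_atE (b : B) (n : N0) q :
  lambda_at q (rpure (ext_rmod C B) (bm_left N0) b n) = pureL b (pureNQ n q).
Proof. exact: (rmapidE (lambda_at_mor q)). Qed.
Lemma lambda_at_bilin : bilin (fun (t : EN) q => lambda_at q t).
Proof.
have L3 q := rmapid_linear (P := ext_rmod C B) (lambda_at_mor q).
split=> [q|t]; first exact: L3.
move=> c q q'; move: t; apply: tens_ext => [||b n]; first exact: L3.
  exact: (linear_add (linear_scale c (L3 q)) (L3 q')).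
by rewrite !lambda_atE BNQ.2 BL.2.
Qed.
Lemma lambda_at_ract (t : EN) s q : lambda_at q (bm_ract t s) = lambda_at (lact s q) t.
Proof.
have L := (bm_ract_bilin EN).1 s.
move: t; apply: tens_ext => [||b n].
- exact: (lin_comp (lambda_at_bilin.1 q) L).
- exact: (lambda_at_bilin.1 _).
rewrite [bm_ract _ _]tens_ractE !lambda_atE; congr pureL.
exact: (pure_balanced (@ract _ _ (bm_right N0)) (@lact _ _ Q)).
Qed.
Lemma lambda_lambda_at (t : EN) q : lambda (lambda_at q t) = pureR (bc_counit t) (pureAQ 𝟙 q).
Proof.
have eL := @bc_counit_linear _ _ C _ _ N.
move: t; apply: tens_ext => [||b n].
- exact: (lin_comp lambda_linear (lambda_at_bilin.1 q)).
- exact: (lin_comp (BR.1 _) eL).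
by rewrite lambda_atE lambdaE bc_counitE.
Qed.

(** This needs N = B ⊗_B0 N0 as (B, A0)-bimodules. *)
Lemma lambda_bijective : bijective lambda.
Proof.
have [ei eK eiK] := @bc_counit_bijective _ _ C _ _ N Bff canB.
have eiL : linear ei := linear_inverse (@bc_counit_linear _ _ C _ _ N) eK eiK.
have eiR (s : A0) (n : N) : ei (bm_ract n (val s)) = bm_ract (ei n : EN) s.
  by apply: (can_inj eK); rewrite bc_counit_ract !eiK.
pose s2 (n : N) (a : A) (q : Q) : L := lambda_at q (ei (bm_ract n a)).
have s2B n : bilin (s2 n).
  split=> ?; first exact: (lin_comp (lambda_at_bilin.1 _) (lin_comp eiL (rB.2 n))).
  exact: (lambda_at_bilin.2 _).
have s2b n : balanced (@ract _ _ (ext_rmod C A)) (@lact _ _ Q) (s2 n).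
  have [_ _ rA] := bm_rax N.
  by move=> a s q; rewrite /s2 -lambda_at_ract -eiR -rA.
pose s1 (n : N) (t : AQ) : L := tlift (s2 n) t.
have s1L n : linear (s1 n) by exact: (tlift_linear (s2B n) (s2b n)).
have s1E n (a : A) q : s1 n (pureAQ a q) = s2 n a q by exact: (tliftE (s2B n) (s2b n)).
have s1B : bilin s1.
  split=> // t; apply: linear_tlift_param => // a q.
  exact: (lin_comp (lambda_at_bilin.1 _) (lin_comp eiL (rB.1 _))).
have s1b : balanced (@ract _ _ (bm_right N)) (@lact _ _ AQ) s1.
  have [tB _ _] := tens_lax (ext_bimod C A) Q; have [_ _ rA] := bm_rax N.
  move=> n a; apply: tens_ext => [||a' q]; first exact: s1L.
    exact: (lin_comp (s1L n) (tB.2 a)).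
  by rewrite [lact _ _]tens_lactE !s1E /s2 -rA.
exists (tlift s1 : R -> L).
  apply: lambda_ext => [||b n q]; last first.
    rewrite lambdaE (tliftE s1B s1b) s1E /s2.
    have [_ r1 _] := bm_rax N.
    by rewrite r1 -bc_counitE eK lambda_atE.
    exact: lin_id.
  exact: (lin_comp (tlift_linear s1B s1b) lambda_linear).
have LL := lin_comp lambda_linear (tlift_linear s1B s1b).
apply: tens_ext => [||n t] //.
move: t; apply: tens_ext => [||a q].
- exact: (lin_comp LL (BR.2 n)).
- exact: BR.2.
by rewrite (tliftE s1B s1b) s1E /s2 lambda_lambda_at eiK pureR_bal pureAQ1.
Qed.

Lemma lambda_mor : dk_mor (U := ind_dk NQ) (V := tens_dk N (ind_dk Q)) lambda.
Proof.
have LL := lambda_linear; have [_ _ lA] := bm_lax N.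
have [iL _ _] := dk_cm (ind_dk NQ); have [tL _ _] := dk_cm (tens_dk N (ind_dk Q)).
have pL := hq_proj_linear C.
split.
  split=> // b; have L1 := (lact_bilin (ind_dk NQ)).2 b.
  have L2 := (lact_bilin (tens_dk N (ind_dk Q))).2 b.
  apply: lambda_ext; [exact: (lin_comp LL L1)|exact: (lin_comp L2 LL)|].
  move=> c n q; rewrite [lact _ _]tens_lactE [LHS]lambdaE [in RHS]lambdaE [RHS]tens_lactE.
  by congr pureR; exact: lA.
apply: lambda_ext => [||b n q].
- exact: (lin_comp tL LL).
- exact: (lin_comp (kmap_linear LL (@lin_id _ C)) iL).
rewrite [in LHS]lambdaE [LHS]tens_dk_coactE.
have -> : dk_coact (pureAQ 𝟙 q : ind_dk Q) = pureAQ 𝟙 q ⊗ hq_proj C 𝟙.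
  exact: (coinvE (coinv_unit q)).
rewrite tprod_pureR; [|exact: BR|exact: hq_act_bilin].
transitivity (kmap (fun x => pureR x (pureAQ 𝟙 q)) id
   (@coact _ _ (via C (bc_comod N)) (bm_lact b (val n)))).
  rewrite [RHS](kmap_comp (bc_coact _) (BR.1 _) (@lin_id _ C) (@lin_id _ N) pL).
  by apply: eq_kmap => // h; rewrite -hq_proj_act amul1r.
have -> : @coact _ _ (via C (bc_comod N)) (bm_lact b (val n)) =
    Σ_(b0 ⊗ b1 <- ca_coact b) bm_lact b0 (val n) ⊗ hq_proj C b1.
  exact: (dk_coact_lact_coinv b (coinv_bc_to n)).
rewrite [dk_coact _]ind_coactE (kmap_comp _ LL (@lin_id _ _) (BL.1 _) (@lin_id _ _)).
rewrite (eq_kmap (f' := fun b' : B => pureR (bm_lact b' (val n)) (pureAQ 𝟙 q)) (g' := id)) //; last first.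
  by move=> b'; rewrite lambdaE.
have L1 := BR.1 (pureAQ 𝟙 q); have L2 := lB.1 (val n).
rewrite (klift_lin (h := kmap (fun x => pureR x (pureAQ 𝟙 q)) id)); first last.
- exact: kmap_linear.
- by lin.
apply/esym/(etrans (kmap_comp (ca_coact b) (lin_comp L1 L2) (@lin_id _ C) (@lin_id _ B) pL)).
by apply: eq_tlift => b0 b1; rewrite kmapE.
Qed.
End Q.

Lemma lambda_natural (Q Q' : lmodule A0) (f : Q -> Q') : lmod_mor f ->
  forall t, lambda (tens_fmap (P := ext_bimod C B) (X := tens_lmod N0 Q) (Y := tens_lmod N0 Q')
      (tens_fmap (P := N0) f) t) =
    tens_fmap (P := N) (X := tens_lmod (ext_bimod C A) Q) (Y := tens_lmod (ext_bimod C A) Q')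
      (tens_fmap (P := ext_bimod C A) f) (lambda t).
Proof.
move=> fM; have nM := tens_fmap_mor N0 fM; have aM := tens_fmap_mor (ext_bimod C A) fM.
apply: lambda_ext => [||b n q].
- exact: (lin_comp (@lambda_linear Q') (tens_fmap_linear (P := ext_bimod C B) nM)).
- exact: (lin_comp (tens_fmap_linear (P := N) aM) (@lambda_linear Q)).
by rewrite (tens_fmapE nM) (tens_fmapE fM) !lambdaE (tens_fmapE aM) (tens_fmapE fM).
Qed.
End Lambda.

(** * Natural isomorphisms *)
Section NatIso.
Variables (C D E : category).
Implicit Types F G K : functor C D.

Lemma nat_iso_sym F G : nat_iso F G -> nat_iso G F.
Proof.
move=> [eta [etaN etaI]]; pose eta' x := sval (cid (etaI x)).
have e1 x : compm (eta' x) (eta x) = idm _ by case: (svalP (cid (etaI x))).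
have e2 x : compm (eta x) (eta' x) = idm _ by case: (svalP (cid (etaI x))).
exists eta'; split=> [x y f|x]; last by exists (eta x).
rewrite -[RHS]comp1m -(e1 y) -Defs.compA [compm (eta y) _]Defs.compA etaN.
by rewrite -Defs.compA e2 compm1.
Qed.

Lemma is_iso_comp (c d e : D) (f : Defs.hom d e) (g : Defs.hom c d) :
  is_iso f -> is_iso g -> is_iso (compm f g).
Proof.
move=> [f' [f1 f2]] [g' [g1 g2]]; exists (compm g' f'); split.
  by rewrite -Defs.compA [compm f' _]Defs.compA f1 comp1m.
by rewrite -Defs.compA [compm g _]Defs.compA g2 comp1m.
Qed.

Lemma nat_iso_trans F G K : nat_iso F G -> nat_iso G K -> nat_iso F K.
Proof.
move=> [eta [etaN etaI]] [th [thN thI]].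
exists (fun x => compm (th x) (eta x)); split=> [x y f|x]; last exact: is_iso_comp.
by rewrite -Defs.compA etaN Defs.compA thN -Defs.compA.
Qed.

Lemma nat_iso_postcomp F G (K : functor D E) :
  nat_iso F G -> nat_iso (compF K F) (compF K G).
Proof.
move=> [eta [etaN etaI]]; exists (fun x => fmap K (eta x)); split=> [x y f|x] /=.
  by rewrite -!fmapM etaN.
have [g [g1 g2]] := etaI x.
by exists (fmap K g); rewrite -!fmapM g1 g2 !fmap1.
Qed.

Lemma nat_iso_precomp F G (K : functor E C) :
  nat_iso F G -> nat_iso (compF F K) (compF G K).
Proof.
move=> [eta [etaN etaI]]; exists (fun x => eta (K x)); split=> [x y f|x] /=.
  exact: etaN.
exact: etaI.
Qed.
End NatIso.

Section BijectiveMorphisms.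
Variables (k : fieldType) (H : hopfAlgType k).

Lemma lmod_iso (R : kalgType k) (X Y : lmodule R) (f : Defs.hom (c := lmod_cat R) X Y) :
  bijective f -> is_iso f.
Proof.
case=> g fK gK; exists (CHom (lmod_mor_inverse (chom_ax f) fK gK)).
by split; apply: chom_eq.
Qed.

Lemma dk_iso (A : comodalg H) (C : hquot H) (U V : dkmod A C)
    (f : Defs.hom (c := dk_cat A C) U V) : bijective f -> is_iso f.
Proof.
case=> g fK gK; have [fM fC] := chom_ax f; have gM := lmod_mor_inverse fM fK gK.
have [fL _] := fM; have [gL _] := gM.
have gD : dk_mor g.
  split=> // v; rewrite -{2}[v]gK fC kmap_comp //.
  by rewrite (eq_kmap (f' := id) (g' := id)) // kmap_id.
by exists (CHom gD); split; apply: chom_eq.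
Qed.

Lemma bicomod_iso (A B : comodalg H) (M N : bicomod A B)
    (f : Defs.hom (c := bicomod_cat A B) M N) : bijective f -> is_iso f.
Proof.
case=> g fK gK; have [fL fl fr fC] := chom_ax f.
have gL := linear_inverse fL fK gK.
have gD : bicomod_mor g.
  split=> // [a m|m b|m].
  - by apply: (can_inj fK); rewrite fl !gK.
  - by apply: (can_inj fK); rewrite fr !gK.
  rewrite -{2}[m]gK fC kmap_comp //.
  by rewrite (eq_kmap (f' := id) (g' := id)) // kmap_id.
by exists (CHom gD); split; apply: chom_eq.
Qed.

Lemma is_iso_bijective (A B : comodalg H) (M N : bicomod A B)
    (f : Defs.hom (c := bicomod_cat A B) M N) : is_iso f -> bijective f.
Proof.
move=> [g [gf fg]]; exists g => x.
  exact: (congr1 (fun h : Defs.hom (c := bicomod_cat A B) M M => h x) gf).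
exact: (congr1 (fun h : Defs.hom (c := bicomod_cat A B) N N => h x) fg).
Qed.
End BijectiveMorphisms.

(** * Strict Morita contexts act on Doi-Hopf modules *)
Section MoritaDk.
Variables (k : fieldType) (H : hopfAlgType k) (C : hquot H) (A B : comodalg H).
Variables (M : bicomod A B) (N : bicomod B A).
Variable alpha : tens_bc M N -> reg_bc A.
Hypothesis alphaM : bicomod_mor alpha.
Hypothesis alphaB : bijective alpha.
Notation pureMN := (rpure (bm_right M) (bm_left N)).
Let aL : linear alpha. Proof. by case: alphaM. Qed.
Let BMN : bilin pureMN. Proof. exact: pure_bilin. Qed.

Section U.
Variable U : lmodule A.
Notation NU := (tens_lmod N U).
Notation T := (rtens (bm_right M) NU).
Notation pureNU := (rpure (bm_right N) U).
Notation pureT := (rpure (bm_right M) NU).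
Let BNU : bilin pureNU. Proof. exact: pure_bilin. Qed.
Let BT : bilin pureT. Proof. exact: pure_bilin. Qed.
Let lB := lact_bilin U.

(** (M ⊗_B N) ⊗_A U = A ⊗_A U = U, written on M ⊗_B (N ⊗_A U). *)
Definition morita2 (m : M) (n : N) (u : U) : U := lact (alpha (pureMN m n) : A) u.
Lemma morita2_bilin m : bilin (morita2 m).
Proof.
split=> ?; last exact: lB.2.
exact: (lin_comp (lB.1 _) (lin_comp aL (BMN.2 m))).
Qed.
Lemma morita2_bal m : balanced (@ract _ _ (bm_right N)) (@lact _ _ U) (morita2 m).
Proof.
move=> n a u; rewrite /morita2 -lactA; congr lact.
have [_ _ ar _] := alphaM; rewrite -[RHS]ar; congr alpha.
by rewrite [RHS]tens_ractE.
Qed.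
Definition morita1 (m : M) (t : NU) : U := tlift (morita2 m) t.
Lemma morita1E (m : M) (n : N) (u : U) : morita1 m (pureNU n u) = morita2 m n u.
Proof. exact: (tliftE (morita2_bilin m) (@morita2_bal m)). Qed.
Lemma morita1_bilin : bilin morita1.
Proof.
split=> [t|m]; last exact: (tlift_linear (morita2_bilin m) (@morita2_bal m)).
apply: linear_tlift_param => [m|m|n u]; [exact: morita2_bilin|exact: morita2_bal|].
exact: (lin_comp (lB.1 _) (lin_comp aL (BMN.1 n))).
Qed.
Lemma morita1_bal : balanced (@ract _ _ (bm_right M)) (@lact _ _ NU) morita1.
Proof.
move=> m b; have [tB _ _] := tens_lax N U.
apply: tens_ext => [||n u]; first exact: (morita1_bilin.2 _).
  exact: (lin_comp (morita1_bilin.2 m) (tB.2 b)).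
rewrite [lact _ _]tens_lactE !morita1E /morita2; congr (lact (alpha _) u).
exact: (pure_balanced (@ract _ _ (bm_right M)) (@lact _ _ (bm_left N))).
Qed.
Definition morita : T -> U := tlift morita1.
Lemma moritaE (m : M) (n : N) (u : U) :
  morita (pureT m (pureNU n u)) = lact (alpha (pureMN m n) : A) u.
Proof. by rewrite /morita (tliftE morita1_bilin morita1_bal) morita1E. Qed.
Lemma morita_linear : linear morita.
Proof. exact: (tlift_linear morita1_bilin morita1_bal). Qed.

Lemma morita_ext (P : lmodType k) (f g : T -> P) : linear f -> linear g ->
  (forall m n u, f (pureT m (pureNU n u)) = g (pureT m (pureNU n u))) -> f =1 g.
Proof.
move=> fL gL e; apply: tens_ext => // m t; move: t.
by apply: tens_ext => [||n u] //; [exact: (lin_comp fL (BT.2 m))|exact: (lin_comp gL (BT.2 m))].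
Qed.

(** At the preimage of 𝟙 under [alpha], this is the inverse of [morita]. *)
Definition morita_at (u : U) : tens_bc M N -> T := rmap id (fun n : N => pureNU n u).
Lemma morita_at_mor u : lmod_mor (X := bm_left N) (Y := NU) (fun n : N => pureNU n u).
Proof. by split=> [|b n]; [exact: (BNU.1 u)|rewrite [RHS]tens_lactE]. Qed.
Lemma morita_atE (m : M) (n : N) u : morita_at u (pureMN m n) = pureT m (pureNU n u).
Proof. exact: (rmapidE (morita_at_mor u)). Qed.
Lemma morita_at_linear u : linear (morita_at u).
Proof. exact: (rmapid_linear (P := bm_right M) (morita_at_mor u)). Qed.
Lemma morita_at_linear2 t : linear (fun u => morita_at u t).
Proof.
move=> c u u'; move: t; apply: tens_ext => [||m n].
- exact: morita_at_linear.
- exact: (linear_add (linear_scale c (morita_at_linear u)) (morita_at_linear u')).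
by rewrite !morita_atE BNU.2 BT.2.
Qed.
Lemma morita_at_ract t a u : morita_at u (bm_ract t a) = morita_at (lact a u) t.
Proof.
have rL := (bm_ract_bilin (tens_bc M N)).1 a.
move: t; apply: tens_ext => [||m n].
- exact: (lin_comp (morita_at_linear u) rL).
- exact: morita_at_linear.
rewrite [bm_ract _ _]tens_ractE !morita_atE; congr pureT.
exact: (pure_balanced (@ract _ _ (bm_right N)) (@lact _ _ U)).
Qed.
Lemma morita_morita_at t u : morita (morita_at u t) = lact (alpha t : A) u.
Proof.
move: t; apply: tens_ext => [||m n].
- exact: (lin_comp morita_linear (morita_at_linear u)).
- exact: (lin_comp (lB.1 u) aL).
by rewrite morita_atE moritaE.
Qed.

(** [morita_at u] is right A-linear in the sense of [morita_at_ract], so that at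
    (a, u) the preimage of 𝟙 can be replaced by that of a. *)
Lemma morita_bijective : bijective morita.
Proof.
have [ai aK aiK] := alphaB; have [_ _ ar _] := alphaM.
exists (fun u => morita_at u (ai (𝟙 : A))) => [t|u].
  move: t; apply: morita_ext; [|exact: lin_id|].
    exact: (lin_comp (morita_at_linear2 _) morita_linear).
  move=> m n u; rewrite moritaE -morita_at_ract -morita_atE; congr morita_at.
  by apply: (can_inj aK); rewrite ar aiK; exact: amul1l.
by rewrite morita_morita_at aiK lact1.
Qed.
End U.

Lemma morita_mor (U : dkmod A C) : dk_mor (U := tens_dk M (tens_dk N U)) (@morita U).
Proof.
have mL := @morita_linear U; have lB := lact_bilin U; have [_ al _ ac] := alphaM.
pose X := tens_dk M (tens_dk N U); have [xL _ _] := dk_cm X.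
split.
  split=> // a; have L := (lact_bilin X).2 a.
  apply: morita_ext; [exact: (lin_comp mL L)|exact: (lin_comp (lB.2 a) mL)|].
  move=> m n u; rewrite [lact _ _]tens_lactE !moritaE -lactA; congr (lact _ u).
  by rewrite -[RHS]al; congr alpha; rewrite [RHS]tens_lactE.
apply: morita_ext => [||m n u].
- exact: (lin_comp (@dk_coact_linear _ _ _ _ U) mL).
- exact: (lin_comp (kmap_linear mL (@lin_id _ C)) xL).
have hB := amul_bilin (s := H); have qB := hq_act_bilin C.
have BNU := pure_bilin (@ract _ _ (bm_right N)) (@lact _ _ U).
have BT := pure_bilin (@ract _ _ (bm_right M)) (@lact _ _ (tens_lmod N U)).
have aB : bilin (fun m n => alpha (pureMN m n)) by exact: lin_bilin.
have ac' x : ca_coact (alpha x : A) = kmap alpha id (bc_coact x) := ac x.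
rewrite moritaE dk_lcoact ac' [bc_coact _]tens_bc_coactE kmap_tprod //.
rewrite [dk_coact _ in RHS]tens_dk_coactE [dk_coact (d := tens_dk N U) _]tens_dk_coactE.
rewrite kmap_tprod //.
apply: (tprod_assoc (h := fun m t => morita (pure _ _ m t))) => //.
- exact: (lin_bilin mL BT).
- by move=> a b c; rewrite moritaE.
- by move=> a b c; rewrite hq_actA.
Qed.

Lemma morita_natural (U V : lmodule A) (f : U -> V) : lmod_mor f ->
  forall t, morita (tens_fmap (P := M) (X := tens_lmod N U) (Y := tens_lmod N V)
    (tens_fmap (P := N) f) t) = f (morita t).
Proof.
move=> fM; have [fL fA] := fM; have nM := tens_fmap_mor N fM.
apply: morita_ext => [||m n u].
- exact: (lin_comp (@morita_linear V) (tens_fmap_linear (P := M) nM)).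
- exact: (lin_comp fL (@morita_linear U)).
by rewrite (tens_fmapE nM) (tens_fmapE fM) !moritaE fA.
Qed.

Lemma morita_nat_iso :
  nat_iso (compF (tens_dkF C M) (tens_dkF C N)) (idF (dk_cat A C)).
Proof.
exists (fun U : dkmod A C => CHom (morita_mor U)); split=> [U V f|U].
  by apply: chom_eq => t; apply: (morita_natural (proj1 (chom_ax f))).
by apply: dk_iso; apply: morita_bijective.
Qed.
End MoritaDk.

(** * The squares of functors *)
Section Squares.
Variables (k : fieldType) (H : hopfAlgType k) (C : hquot H).

Definition coalgebra_galois (A : comodalg H) :=
  right_faithfully_flat (ext_rmod C A) /\ forall V, bijective (@canV k H A C V).

Section OneAlgebra.
Variable A : comodalg H.
Hypothesis AC : coalgebra_galois A.

Lemma coinv_counit_natural (U V : dkmod A C) (f : U -> V) (fM : dk_mor f) :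
  forall t, coinv_counit (tens_fmap (P := ext_bimod C A) (X := coinv_lmod U)
    (Y := coinv_lmod V) (coinv_fmap fM) t) = f (coinv_counit t).
Proof.
have [[fL fA] fC] := fM; have cM := coinv_fmap_mor fM.
apply: tens_ext => [||a u].
- exact: (lin_comp (@coinv_counit_linear _ _ _ _ V) (tens_fmap_linear (P := ext_bimod C A) cM)).
- exact: (lin_comp fL (@coinv_counit_linear _ _ _ _ U)).
by rewrite (tens_fmapE (P := ext_bimod C A) cM) !coinv_counitE fA.
Qed.

Lemma ind_coinv_nat_iso :
  nat_iso (compF (indF C A) (coinvF C A)) (idF (dk_cat A C)).
Proof.
have [Aff canA] := AC.
exists (fun U : dkmod A C => CHom (coinv_counit_mor U)); split=> [U V f|U]; last first.
  by apply: dk_iso; apply: (coinv_counit_bijective Aff canA).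
by apply: chom_eq => t; apply: (coinv_counit_natural (chom_ax f)).
Qed.

Lemma coinv_ind_nat_iso :
  nat_iso (compF (coinvF C A) (indF C A)) (idF (lmod_cat (coinv_alg C A))).
Proof.
have [Aff canA] := AC; apply: nat_iso_sym.
exists (fun Q : lmodule (coinv_alg C A) => CHom (coinv_unit_mor Q)); split=> [Q R f|Q].
  apply: chom_eq => q; apply: val_inj.
  by rewrite /= (tens_fmapE (P := ext_bimod C A) (chom_ax f)).
by apply: lmod_iso; apply: (coinv_unit_bijective Aff canA).
Qed.
End OneAlgebra.

Variables (A B : comodalg H) (N : bicomod B A).
Hypotheses (AC : coalgebra_galois A) (BC : coalgebra_galois B).

Lemma tens_ind_nat_iso :
  nat_iso (compF (tens_dkF C N) (indF C A)) (compF (indF C B) (tensF (coinv_bimod C N))).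
Proof.
have [Bff canB] := BC; apply: nat_iso_sym.
exists (fun Q : lmodule (coinv_alg C A) => CHom (lambda_mor N Q)); split=> [Q R f|Q].
  by apply: chom_eq => t; apply: (lambda_natural (chom_ax f)).
by apply: dk_iso; apply: (lambda_bijective _ Bff canB).
Qed.

(** [tens_ind_nat_iso] conjugated by the equivalences of the structure theorem. *)
Lemma coinv_tens_nat_iso :
  nat_iso (compF (coinvF C B) (tens_dkF C N)) (compF (tensF (coinv_bimod C N)) (coinvF C A)).
Proof.
have e1 := nat_iso_postcomp (coinvF C B) (nat_iso_postcomp (tens_dkF C N)
  (nat_iso_sym (ind_coinv_nat_iso AC))).
have e2 := nat_iso_precomp (coinvF C A) (nat_iso_postcomp (coinvF C B) tens_ind_nat_iso).
have e3 := nat_iso_precomp (coinvF C A) (nat_iso_precomp (tensF (coinv_bimod C N))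
  (coinv_ind_nat_iso BC)).
exact: (nat_iso_trans (nat_iso_trans e1 e2) e3).
Qed.
End Squares.

(** * Coinvariants of the Hopf algebra itself *)
Section SubalgebraDescent.
Variables (k : fieldType) (R S : kalgType k) (f : kalg_mor R S).
Hypothesis Sff : left_faithfully_flat (restr_lmod f (reg_lmod S)).
Notation SS := (tens_bimod (restr_rbimod f) (restr_lbimod f)).
Notation pureSS := (rpure (bm_right (restr_rbimod f)) (bm_left (restr_lbimod f))).
Let B2 : bilin pureSS. Proof. exact: pure_bilin. Qed.

Definition amitsur_ract (t : SS) (r : R) : SS := bm_ract t (f r).
Lemma amitsur_rax : is_rmodule amitsur_ract.
Proof.
have [rB r1 rA] := bm_rax SS.
split=> [|t|r s t]; rewrite /amitsur_ract.
- by split=> ?; [exact: rB.1|exact: (lin_comp (rB.2 _) (km_linear f))].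
- by rewrite km1 r1.
- by rewrite kmM rA.
Qed.
Definition amitsur_rmod : rmodule R := RModule amitsur_rax.

Definition amitsur_d (s : S) : SS := pureSS s 𝟙 - pureSS 𝟙 s.
Lemma amitsur_d_linear : linear amitsur_d.
Proof. exact: (linear_add (B2.1 _) (linear_opp (B2.2 _))). Qed.

Lemma pureSS_bal (s t : S) r : pureSS (s ∙ f r) t = pureSS s (f r ∙ t).
Proof. exact: (pure_balanced (@ract _ _ (bm_right (restr_rbimod f)))
  (@lact _ _ (bm_left (restr_lbimod f))) s r t). Qed.

Notation Sr := (bm_right (restr_rbimod f)).
Notation Rr := (RModule (amul_rmodule R)).
Notation Sl := (restr_lmod f (reg_lmod S)).

Lemma amitsur_f_mor : rmod_mor (X := Rr) (Y := Sr) f.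
Proof. by split=> [|x r]; [exact: km_linear|exact: kmM]. Qed.
Lemma amitsur_d_mor : rmod_mor (X := Sr) (Y := amitsur_rmod) amitsur_d.
Proof.
split=> [|s r]; first exact: amitsur_d_linear.
rewrite [RHS](linB ((bm_ract_bilin SS).1 (f r))) /amitsur_d.
rewrite [X in _ = X - _]tens_ractE [X in _ = _ - X]tens_ractE.
congr (_ - _); rewrite [LHS]pureSS_bal; congr pureSS.
by rewrite [RHS]amul1l amul1r.
Qed.

(** Faithfully flat descent: after tensoring with S, the sequence
    R -> S -> S ⊗_R S is split by the multiplication of S. *)
Lemma amitsur_exact : exact_pair f amitsur_d.
Proof.
apply/(Sff amitsur_f_mor amitsur_d_mor) => y.
have [fL fR] := amitsur_f_mor; have [dL dR] := amitsur_d_mor.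
pose T3 := rtens amitsur_rmod Sl.
have rB := bm_ract_bilin SS; have [_ r1 rA] := bm_rax SS.
have fE (r : R) (s : S) : rmap f id (rpure Rr Sl r s) = rpure Sr Sl (f r) s by exact: rmapE.
have dE (a s : S) : rmap amitsur_d id (rpure Sr Sl a s) = rpure amitsur_rmod Sl (amitsur_d a) s.
  by exact: rmapE.
have dLL : linear (rmap amitsur_d id : rtens Sr Sl -> T3) by exact: rmap_linear.
have fLL : linear (rmap f id : rtens Rr Sl -> rtens Sr Sl) by exact: rmap_linear.
pose mu : T3 -> SS := tlift (fun (t : SS) (s : S) => bm_ract t s).
have mub : balanced (@ract _ _ amitsur_rmod) (@lact _ _ Sl) (fun (t : SS) (s : S) => bm_ract t s).
  by move=> t r s; rewrite [RHS]rA.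
have muL : linear mu by exact: tlift_linear.
have muE (t : SS) (s : S) : mu (rpure amitsur_rmod Sl t s) = bm_ract t s by exact: (tliftE rB mub).
pose mul : rtens Sr Sl -> S := tlift (fun a b : S => a ∙ b).
have mulb : balanced (@ract _ _ Sr) (@lact _ _ Sl) (fun a b : S => a ∙ b).
  by move=> a r b; exact/esym/amulA.
have mulL : linear mul by apply: tlift_linear => //; exact: amul_bilin.
have key z : mu (rmap amitsur_d id z) = z - pureSS 𝟙 (mul z) :> rtens Sr Sl.
  move: z; apply: tens_ext => [||a s].
  - exact: (lin_comp muL dLL).
  - exact: (linear_add (@lin_id _ _) (linear_opp (lin_comp (B2.2 _) mulL))).
  rewrite dE muE (linB (rB.1 s)) /mul tliftE //; last exact: amul_bilin.
  rewrite [X in X - _ = _]tens_ractE [X in _ - X = _]tens_ractE.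
  by congr (_ - _); congr pureSS; rewrite [LHS]amul1l.
split=> [d0|[z <-]].
  exists (rpure Rr Sl 𝟙 (mul y)); rewrite fE km1.
  by apply/eqP; rewrite eq_sym -subr_eq0 -key d0 (lin0 muL).
move: z; apply: (tens_ext (f' := fun=> 0)) => [||r s].
- exact: (lin_comp dLL fLL).
- by move=> c x z; rewrite scaler0 addr0.
rewrite fE dE /amitsur_d.
have -> : pureSS (f r) 𝟙 = pureSS 𝟙 (f r) by rewrite -[in LHS](amul1l (f r)) pureSS_bal amul1r.
by rewrite subrr (lin0 ((pure_bilin _ _).1 s)).
Qed.
End SubalgebraDescent.

Section HopfSubalgebraCoinvariants.
Variables (k : fieldType) (K H : hopfAlgType k) (j : hopf_emb K H) (C : hquot H).
Hypothesis jC : forall x : K, hq_proj C (j x) = counit x *: hq_proj C 𝟙.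
Hypothesis kerC : forall h, hq_proj C h = 0 -> kspan (HKplus j) h.
Hypothesis Sbij : bijective (antipode : H -> H).
Hypothesis Hff : left_faithfully_flat (res_lmod j).

Definition emb_mor : kalg_mor K H := KAlgMor (he_linear j) (he1 j) (heM j).
Notation HH := (tens_bimod (restr_rbimod emb_mor) (restr_lbimod emb_mor)).
Notation pureHH := (rpure (bm_right (restr_rbimod emb_mor)) (bm_left (restr_lbimod emb_mor))).

(** By [amitsur_exact], K consists of the h with h ⊗ 𝟙 = 𝟙 ⊗ h in H ⊗_K H.
    The map y ⊗ x |-> x_(2) ⊗ S^-1(x_(1)) y from H ⊗ C to H ⊗_K H sends
    h_(1) ⊗ h_(2) to h ⊗ 𝟙 and h ⊗ 𝟙 to 𝟙 ⊗ h. *)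
Lemma coinv_hopf_subalgebra h :
  Σ_(h1 ⊗ h2 <- comul h) h1 ⊗ hq_proj C h2 = h ⊗ hq_proj C 𝟙 -> exists x, j x = h.
Proof.
have [s sK Ks] := Sbij; have SL := @antipode_linear k H.
have sL : linear s := linear_inverse SL sK Ks.
have SI : injective (antipode : H -> H) := can_inj sK.
have sM x y : s (x ∙ y) = s y ∙ s x by apply: SI; rewrite antipodeM !Ks.
have s1 : s 𝟙 = 𝟙 by apply: SI; rewrite Ks antipode1.
have mB := amul_bilin (s := H).
have sl x : Σ_(x1 ⊗ x2 <- comul x) s x2 ∙ x1 = counit x *: 𝟙.
  apply: SI; rewrite (klift_lin (h := antipode)) ?(linZ SL) ?antipode1; [|by lin|by lin].
  rewrite -(antipode_sum (f := id)); last exact: lin_id.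
  by apply: eq_tlift => x1 x2; rewrite antipodeM Ks.
have sr x : Σ_(x1 ⊗ x2 <- comul x) x2 ∙ s x1 = counit x *: 𝟙.
  apply: SI; rewrite (klift_lin (h := antipode)) ?(linZ SL) ?antipode1; [|by lin|by lin].
  rewrite -(sum_antipode (f := id)); last exact: lin_id.
  by apply: eq_tlift => x1 x2; rewrite antipodeM Ks.
have B2 : bilin pureHH by exact: pure_bilin.
pose xi (y x : H) : HH := Σ_(x1 ⊗ x2 <- comul x) pureHH x2 (s x1 ∙ y).
have xiB1 (y : H) : bilin (fun x1 x2 => pureHH x2 (s x1 ∙ y)).
  split=> z; last exact: B2.1.
  exact: (lin_comp (B2.2 z) (lin_comp (mB.1 y) sL)).
have xiB : bilin xi.
  split=> [x|y]; last exact: (lin_comp (klift_linear (xiB1 y)) (@comul_linear k H)).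
  apply: linear_klift_param => // x1 x2; exact: (lin_comp (B2.2 _) (mB.2 _)).
(* for z in K, z_(2) moves to the right, where it cancels S^-1(z_(1)) *)
have xi0 y x : hq_proj C x = 0 -> xi y x = 0.
  move=> /kerC; elim=> [|a u w [g z z0] _ IH]; first exact: (lin0 (xiB.2 y)).
  rewrite (xiB.2 y) IH addr0; suff -> : xi y (g ∙ j z) = 0 by rewrite scaler0.
  have jL := he_linear j; have xiB1y := xiB1 y.
  rewrite /xi comulM klift_tprod //.
  rewrite he_comul; transitivity (Σ_(g1 ⊗ g2 <- comul g) (0 : HH)).
    apply: eq_tlift => g1 g2; rewrite klift_kmap //; last first.
      split=> w'; last exact: (lin_comp (B2.1 _) (mB.2 _)).
      exact: (lin_comp (B2.2 _) (lin_comp (mB.1 y) (lin_comp sL (mB.2 _)))).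
    transitivity (Σ_(z1 ⊗ z2 <- comul z) pureHH g2 ((j z2 ∙ s (j z1)) ∙ (s g1 ∙ y))).
      by apply: eq_tlift => z1 z2; rewrite sM (pureSS_bal emb_mor) !amulA.
    have FL : linear (fun t => pureHH g2 (t ∙ (s g1 ∙ y))).
      exact: (lin_comp (B2.2 _) (mB.1 _)).
    transitivity (Σ_(z1 ⊗ z2 <- comul (j z)) pureHH g2 ((z2 ∙ s z1) ∙ (s g1 ∙ y))).
      rewrite he_comul klift_kmap //.
      split=> w'; first exact: (lin_comp FL (lin_comp (mB.2 _) sL)).
      exact: (lin_comp FL (mB.1 _)).
    rewrite -(klift_lin (h := fun t => pureHH g2 (t ∙ (s g1 ∙ y)))) //; last by lin.
    by rewrite sr he_counit z0 scale0r; exact: (lin0 FL).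
  by rewrite -(klift_lin (f := fun g1 g2 : H => g1 ⊗ g2) (h := fun=> 0 : HH)) //;
    [lin | move=> c x' y'; rewrite scaler0 addr0].
have [G GB GE] := bilin_factor xiB xi0.
move=> e; have e1 : pureHH h 𝟙 = pureHH 𝟙 h.
  transitivity (tlift G (Σ_(h1 ⊗ h2 <- comul h) h1 ⊗ hq_proj C h2)); last first.
    rewrite e kliftE // GE /xi comul1 kliftE; last exact: xiB1.
    by rewrite s1 amul1l.
  rewrite klift_klift //; last by lin.
  transitivity (Σ_(h1 ⊗ h2 <- comul h) Σ_(h21 ⊗ h22 <- comul h2) pureHH h22 (s h21 ∙ h1)).
    rewrite -comul_sum; last first.
      split=> u v.
      - exact: (lin_comp (B2.2 _) (mB.2 _)).
      - exact: (lin_comp (B2.2 _) (lin_comp (mB.1 _) sL)).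
      - exact: B2.1.
    rewrite -(comul_counitl (f := fun x => pureHH x 𝟙)); last exact: B2.1.
    apply: eq_tlift => h1 h2; rewrite -(linZ (B2.2 h2)) -sl.
    by rewrite (klift_lin (h := fun t => pureHH h2 t)); [|lin|exact: B2.2].
  by apply: eq_tlift => h1 h2; rewrite kliftE // GE.
have Hff' : left_faithfully_flat (restr_lmod emb_mor (reg_lmod H)) by exact: Hff.
have /(amitsur_exact Hff') [x <-] : amitsur_d emb_mor h = 0.
  by rewrite /amitsur_d e1 subrr.
by exists x.
Qed.

(** If x is coinvariant, coassociativity puts ρ(x) in the kernel of id ⊗ D, where
    D(h) = h_(1) ⊗ h_(2) - h ⊗ 𝟙 has kernel K; over a field this kernel is
    X ⊗ K, the image of id ⊗ (id - g D) for a generalized inverse g of D. *)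
Lemma coinv_coact_retraction : exists2 p : H -> K, linear p &
  forall (X : comodule H) (x : coinv (via C X)),
    kmap id (fun h => j (p h)) (@coact _ _ X (val x)) = @coact _ _ X (val x).
Proof.
pose D h := Σ_(h1 ⊗ h2 <- comul h) h1 ⊗ hq_proj C h2 - h ⊗ hq_proj C 𝟙.
have DL : linear D by rewrite /D; lin.
have [g gL gE] := linear_generalized_inverse DL; have jL := he_linear j.
have PL : linear (fun h => h - g (D h)).
  exact: (linear_add (@lin_id _ H) (linear_opp (lin_comp gL DL))).
have /choice [p pE] h : exists x, j x = h - g (D h).
  apply: coinv_hopf_subalgebra; apply/eqP; rewrite -subr_eq0; apply/eqP.
  by rewrite -[LHS]/(D (h - g (D h))) (linB DL) gE subrr.
exists p => [a x y|X x].
  by apply: (he_inj (h := j)); rewrite jL !pE PL.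
rewrite (eq_kmap (f' := id) (g' := fun h => h - g (D h))) //.
transitivity (Σ_(m ⊗ n <- @coact _ _ X (val x)) (m ⊗ n - m ⊗ g (D n))).
  by apply: eq_tlift => m n; rewrite -(linB (kpureR m)).
rewrite klift_sub; [|by lin|]; last first.
  by split=> ?; [exact: kpureL|exact: (lin_comp (kpureR _) (lin_comp gL DL))].
rewrite tlift_pure.
have -> : Σ_(m ⊗ n <- @coact _ _ X (val x)) m ⊗ g (D n) =
    kmap id g (kmap id D (@coact _ _ X (val x))) by rewrite kmap_comp.
suff -> : kmap id D (@coact _ _ X (val x)) = 0.
  by rewrite (lin0 (kmap_linear (@lin_id _ X) gL)) subr0.
rewrite /kmap.
transitivity (Σ_(x0 ⊗ x1 <- @coact _ _ X (val x))
  (x0 ⊗ (Σ_(h1 ⊗ h2 <- comul x1) h1 ⊗ hq_proj C h2) - x0 ⊗ (x1 ⊗ hq_proj C 𝟙))).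
  by apply: eq_tlift => x0 x1; rewrite -(linB (kpureR x0)).
rewrite klift_sub; [|by lin|by lin]; apply/eqP; rewrite subr_eq0; apply/eqP.
transitivity (Σ_(x0 ⊗ x1 <- @coact _ _ X (val x)) Σ_(h1 ⊗ h2 <- comul x1)
  x0 ⊗ (h1 ⊗ hq_proj C h2)).
  apply: eq_tlift => x0 x1; rewrite (klift_lin (h := fun t => x0 ⊗ t)) //; lin.
rewrite -coact_sum; last by split; lin.
by rewrite (coinv_via_sum (f := fun y c => Σ_(y0 ⊗ y1 <- coact y) y0 ⊗ (y1 ⊗ c))) //; lin.
Qed.
End HopfSubalgebraCoinvariants.

(** * Restriction of the coactions to coinvariants *)
Section RestrictedCoaction.
Variables (k : fieldType) (K H : hopfAlgType k) (j : hopf_emb K H) (C : hquot H).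
Let jL := he_linear j.
Implicit Types X Y Z : comodule H.
Notation "X ^co" := (coinv (via C X)) (at level 2, format "X ^co").
Let vL X : linear (fun x : X^co => val x : X) := @val_linear _ _ C (via C X).

Lemma kmap_val_inj X : injective (kmap (fun x : X^co => val x : X) j).
Proof. by apply: kmap_inj => //; [exact: val_inj|exact: he_inj]. Qed.

Section Existence.
Hypothesis jC : forall x : K, hq_proj C (j x) = counit x *: hq_proj C 𝟙.
Variable p : H -> K.
Hypothesis pL : linear p.
Hypothesis pP : forall X (x : X^co),
  kmap id (fun h => j (p h)) (@coact _ _ X (val x)) = @coact _ _ X (val x).

(** Since ρ(x) is in X ⊗ K, coassociativity shows that x_[0] is coinvariant:
    x_[0] ⊗ x_[1] ⊗ x_[2] = x_[0] ⊗ 𝟙 ⊗ x_[1] in X ⊗ C ⊗ H. *)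
Lemma restricts_coact_exists X : exists rho : X^co -> X^co ⊗ K, restricts_coact j rho.
Proof.
have [q qL qK] := linear_retraction (@vL X) val_inj.
have cL := @coact_linear k H X; have pCL := hq_proj_linear C.
pose E (x : X) := Σ_(x0 ⊗ x1 <- coact x) x0 ⊗ hq_proj C x1 - x ⊗ hq_proj C 𝟙.
have EL : linear E by rewrite /E; lin.
have E0 x : E x = 0 -> val (q x) = x.
  move=> ex; have xP : (x : via C X) \in @coinv_pred _ _ _ (via C X).
    by apply/eqP/eqP; rewrite -subr_eq0; apply/eqP.
  by rewrite -[x in LHS]/(val (Coinv xP : X^co)) qK.
have [g gL gE] := linear_generalized_inverse EL.
have PL : linear (fun x => x - g (E x)).
  exact: (linear_add (@lin_id _ X) (linear_opp (lin_comp gL EL))).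
exists (fun x : X^co => kmap q p (@coact _ _ X (val x))) => x.
set rx := @coact _ _ X (val x).
have e1 : kmap id (fun h => j (p h)) rx = rx by exact: pP.
have e2 : kmap E id rx = 0.
  rewrite /kmap.
  transitivity (Σ_(x0 ⊗ x1 <- rx) ((Σ_(x00 ⊗ x01 <- coact x0) x00 ⊗ hq_proj C x01) ⊗ x1
      - (x0 ⊗ hq_proj C 𝟙) ⊗ x1)).
    by apply: eq_tlift => x0 x1; rewrite /E (linB (kpureL x1)).
  rewrite klift_sub; [|by lin|by lin]; apply/eqP; rewrite subr_eq0; apply/eqP.
  transitivity (Σ_(x0 ⊗ x1 <- rx) Σ_(x00 ⊗ x01 <- coact x0) (x00 ⊗ hq_proj C x01) ⊗ x1).
    by apply: eq_tlift => x0 x1; rewrite (klift_lin (h := fun t => t ⊗ x1)) //; lin.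
  rewrite (coact_sum (F := fun x00 x01 x1 => (x00 ⊗ hq_proj C x01) ⊗ x1)); last by split; lin.
  rewrite -/rx -e1 klift_kmap; [|by lin|by lin|by lin].
  rewrite klift_kmap; [|by lin|by lin|by lin].
  apply: eq_tlift => x0 x1; rewrite he_comul klift_kmap; [|by lin..].
  transitivity (Σ_(c1 ⊗ c2 <- comul (p x1)) counit c1 *: ((x0 ⊗ hq_proj C 𝟙) ⊗ j c2)).
    by apply: eq_tlift => c1 c2; rewrite jC (linZ (kpureR _)) (linZ (kpureL _)).
  by rewrite (comul_counitl (f := fun c => (x0 ⊗ hq_proj C 𝟙) ⊗ j c)) //; lin.
have e3 : kmap (fun x => x - g (E x)) id rx = rx.
  rewrite /kmap.
  transitivity (Σ_(m ⊗ n <- rx) (m ⊗ n - g (E m) ⊗ n)).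
    by apply: eq_tlift => m n; rewrite -(linB (kpureL n)).
  rewrite klift_sub; [|by lin|]; last first.
    by split=> ?; [exact: (lin_comp (kpureL _) (lin_comp gL EL))|exact: kpureR].
  rewrite tlift_pure -[X in _ - X]/(kmap (fun x => g (E x)) id rx).
  by rewrite -(kmap_comp _ gL (@lin_id _ H) EL (@lin_id _ H)) e2 (lin0 (kmap_linear gL (@lin_id _ H))) subr0.
have vqL : linear (fun x : X => val (q x) : X) := lin_comp (@vL X) qL.
rewrite (kmap_comp rx (@vL X) jL qL pL) -[in LHS]e3.
rewrite (kmap_comp _ vqL (lin_comp jL pL) PL (@lin_id _ H)).
rewrite (eq_kmap (f' := fun x => id (x - g (E x))) (g' := fun h => j (p h))) //; last first.
  by move=> y; rewrite E0 // (linB EL) gE subrr.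
by rewrite -(kmap_comp rx (@lin_id _ X) (lin_comp jL pL) PL (@lin_id _ H)) e3.
Qed.
End Existence.

(** Identities in X^co ⊗ K and X^co ⊗ (K ⊗ K) are checked in X ⊗ H and
    X ⊗ (H ⊗ H). *)
Lemma restricts_comodule X (rho : X^co -> X^co ⊗ K) :
  restricts_coact j rho -> is_comodule rho.
Proof.
move=> rP; have [cL cA c1] := cm_ax X; have vI := @kmap_val_inj X.
have rL : linear rho.
  move=> a x y; apply: vI.
  by rewrite (kmap_linear (@vL X) jL) !rP vL cL.
have jjL := kmap_linear jL jL.
split=> // [x|x].
  apply: (kmap_inj (f := fun x : X^co => val x : X) (g := kmap j j)) => //.
  - exact: val_inj.
  - by apply: kmap_inj => //; exact: he_inj.
  have comL := @comul_linear k H; have comKL := @comul_linear k K.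
  transitivity (tassoc (kmap (@coact _ _ X) id (@coact _ _ X (val x)))); last first.
    rewrite cA -rP (kmap_comp _ (@lin_id _ X) comL (@vL X) jL).
    rewrite (kmap_comp _ (@vL X) jjL (@lin_id _ _) comKL).
    by apply: eq_kmap => // y; rewrite he_comul.
  rewrite -rP (kmap_comp _ cL (@lin_id _ H) (@vL X) jL).
  rewrite -(eq_kmap (f := fun y => kmap (fun x : X^co => val x : X) j (rho y)) (g := fun y => j y)) //.
  rewrite -(kmap_comp _ (kmap_linear (@vL X) jL) jL rL (@lin_id _ K)).
  exact: tassoc_kmap.
apply: val_inj; rewrite -[RHS]c1 -rP klift_kmap //; last exact: counit_scale_bilin.
rewrite (klift_lin (h := fun x : X^co => val x : X)) //; last exact: counit_scale_bilin.
by apply: eq_tlift => y c; rewrite (linZ (@vL X)) he_counit.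
Qed.

(** Multiplicativity of the coactions on A0, M0 and N0, and colinearity of the
    restriction of α, are all instances of this. *)
Lemma restricts_mul X Y Z (f : X -> Y -> Z) (f0 : X^co -> Y^co -> Z^co)
    rX rY rZ : bilin f -> bilin f0 ->
  (forall x y, coact (f x y) = tprod f amul (coact x) (coact y)) ->
  (forall x y, val (f0 x y) = f (val x) (val y)) ->
  restricts_coact j rX -> restricts_coact j rY -> restricts_coact j rZ ->
  forall x y, rZ (f0 x y) = tprod f0 amul (rX x) (rY y).
Proof.
move=> fB f0B fC fE rXP rYP rZP x y; apply: kmap_val_inj.
have KB := amul_bilin (s := K); have HB := amul_bilin (s := H).
rewrite rZP fE fC -rXP -rYP tprod_kmap // kmap_tprod //.
by apply: eq_tprod => u v; rewrite ?fE ?heM.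
Qed.
End RestrictedCoaction.

(** * The Morita context of the coinvariants *)
Section CoinvariantMorita.
Variables (k : fieldType) (H : hopfAlgType k) (C : hquot H) (A B : comodalg H).
Variables (M : bicomod A B) (N : bicomod B A).
Variable alpha : tens_bc M N -> reg_bc A.
Hypothesis alphaM : bicomod_mor alpha.
Notation M0 := (coinv_bimod C M).
Notation N0 := (coinv_bimod C N).
Notation A0 := (coinv_alg C A).
Notation B0 := (coinv_alg C B).
Notation T0 := (tens_bimod M0 N0).
Notation pureMN := (rpure (bm_right M) (bm_left N)).
Notation pure0 := (rpure (bm_right M0) (bm_left N0)).
Let aL : linear alpha. Proof. by case: alphaM. Qed.
Let BMN : bilin pureMN. Proof. exact: pure_bilin. Qed.
Let vML : linear (fun m : M0 => val m : M) := @val_linear _ _ C (via C (bc_comod M)).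
Let vNL : linear (fun n : N0 => val n : N) := @val_linear _ _ C (via C (bc_comod N)).

Definition coinv_tens_val : T0 -> tens_bc M N :=
  tlift (fun (m : M0) (n : N0) => pureMN (val m) (val n)).
Let vB : bilin (fun (m : M0) (n : N0) => pureMN (val m) (val n)).
Proof. exact: (bilin_comp BMN vML vNL). Qed.
Let vb : balanced (@ract _ _ (bm_right M0)) (@lact _ _ (bm_left N0))
  (fun (m : M0) (n : N0) => pureMN (val m) (val n)).
Proof.
move=> m b n.
exact: (pure_balanced (@ract _ _ (bm_right M)) (@lact _ _ (bm_left N)) _ (val b) _).
Qed.
Lemma coinv_tens_valE (m : M0) (n : N0) : coinv_tens_val (pure0 m n) = pureMN (val m) (val n).
Proof. exact: (tliftE vB vb). Qed.
Lemma coinv_tens_val_linear : linear coinv_tens_val.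
Proof. exact: (tlift_linear vB vb). Qed.

Lemma alpha_coact m n : ca_coact (alpha (pureMN m n) : A) =
  tprod (fun m n => alpha (pureMN m n)) amul (bc_coact m) (bc_coact n).
Proof.
have [_ _ _ ac] := alphaM; have mB := amul_bilin (s := H).
by rewrite [LHS]ac [bc_coact _]tens_bc_coactE kmap_tprod.
Qed.
Lemma alpha_pure_bilin : bilin (fun m n => alpha (pureMN m n)).
Proof. exact: lin_bilin. Qed.

(** Being compatible with the coactions, α preserves coinvariants like any
    product does. *)
Lemma alpha_coinv t :
  (alpha (coinv_tens_val t) : A) \in @coinv_pred _ _ _ (via C (ca_comod A)).
Proof.
apply/eqP; have vL := coinv_tens_val_linear; have avL := lin_comp aL vL.
have cL := @coact_linear _ C (via C (ca_comod A)).
move: t; apply: tens_ext => [||m n].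
- exact: (lin_comp cL avL).
- exact: (lin_comp (kpureL _) avL).
rewrite coinv_tens_valE; apply/eqP.
exact: (valP (@coinv_mul _ _ C (bc_comod M) (via C (bc_comod N)) (via C (ca_comod A)) _
  alpha_pure_bilin (@via_coact _ _ C (bc_comod M) (bc_comod N) (ca_comod A) _
    alpha_pure_bilin alpha_coact) m n)).
Qed.

Definition coinv_alpha (t : T0) : A0 := Coinv (alpha_coinv t).

Lemma coinv_alphaE (m : M0) (n : N0) :
  val (coinv_alpha (pure0 m n)) = alpha (pureMN (val m) (val n)).
Proof. by rewrite /= coinv_tens_valE. Qed.

Lemma coinv_alpha_linear : linear coinv_alpha.
Proof.
move=> a x y; apply: val_inj; rewrite val_linear /=.
exact: (lin_comp aL coinv_tens_val_linear).
Qed.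

Lemma coinv_alpha_lact (a : A0) t : coinv_alpha (bm_lact a t) = a ∙ coinv_alpha t.
Proof.
have cL := coinv_alpha_linear; have [_ al _ _] := alphaM.
have L := (bm_lact_bilin T0).2 a; have L' := (amul_bilin (s := A0)).2 a.
move: t; apply: tens_ext => [||m n].
- exact: (lin_comp cL L).
- exact: (lin_comp L' cL).
apply: val_inj; rewrite [bm_lact _ _]tens_lactE [LHS]coinv_alphaE.
rewrite -[RHS]/(val a ∙ val (coinv_alpha (pure0 m n))) coinv_alphaE.
by rewrite -[RHS]al; congr alpha; rewrite [RHS]tens_lactE.
Qed.

Lemma coinv_alpha_ract (a : A0) t : coinv_alpha (bm_ract t a) = coinv_alpha t ∙ a.
Proof.
have cL := coinv_alpha_linear; have [_ _ ar _] := alphaM.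
have L := (bm_ract_bilin T0).1 a; have L' := (amul_bilin (s := A0)).1 a.
move: t; apply: tens_ext => [||m n].
- exact: (lin_comp cL L).
- exact: (lin_comp L' cL).
apply: val_inj; rewrite [bm_ract _ _]tens_ractE [LHS]coinv_alphaE.
rewrite -[RHS]/(val (coinv_alpha (pure0 m n)) ∙ val a) coinv_alphaE.
by rewrite -[RHS]ar; congr alpha; rewrite [RHS]tens_ractE.
Qed.

Hypothesis alphaB : bijective alpha.
Hypotheses (AC : coalgebra_galois C A) (BC : coalgebra_galois C B).

Lemma ext_mul_bijective : exists2 mul : rtens (ext_rmod C A) (reg_lmod A0) -> A,
  bijective mul & linear mul /\ forall (a : A) (s : A0),
    mul (rpure (ext_rmod C A) (reg_lmod A0) a s) = a ∙ val s.
Proof.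
have mB : bilin (fun (a : A) (s : A0) => a ∙ val s).
  by have [mL mR] := amul_bilin (s := A); split=> ?; [exact: mL|exact: (lin_comp (mR _) (@val_linear _ _ C (via C (ca_comod A))))].
have mb : balanced (@ract _ _ (ext_rmod C A)) (@lact _ _ (reg_lmod A0)) (fun (a : A) (s : A0) => a ∙ val s).
  by move=> a s t; exact/esym/amulA.
have pB := pure_bilin (@ract _ _ (ext_rmod C A)) (@lact _ _ (reg_lmod A0)).
have mL := tlift_linear mB mb; have mE := tliftE mB mb.
exists (tlift (fun (a : A) (s : A0) => a ∙ val s)); last by split.
exists (fun a : A => rpure (ext_rmod C A) (reg_lmod A0) a 𝟙) => [|a]; last first.
  by rewrite mE [LHS]amul1r.
apply: tens_ext => [||a s]; [exact: (lin_comp (pB.1 𝟙) mL)|exact: lin_id|].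
by rewrite mE ext_balanced; congr (pure _ _ _ _); exact: amul1r.
Qed.

(** After A ⊗_A0 -, the map becomes the chain of bijections
    A ⊗_A0 M0 ⊗_B0 N0 = M ⊗_B B ⊗_B0 N0 = M ⊗_B N = A. *)
Lemma coinv_alpha_bijective : bijective coinv_alpha.
Proof.
have [Aff canA] := AC; have [Bff canB] := BC.
pose X := tens_lmod M0 (bm_left N0).
have cM : lmod_mor (X := X) (Y := reg_lmod A0) coinv_alpha.
  by split; [exact: coinv_alpha_linear|exact: coinv_alpha_lact].
have [mul mulB [mulL mulE]] := ext_mul_bijective.
have cN : lmod_mor (X := tens_lmod (ext_bimod C B) (bm_left N0)) (Y := bm_left N)
    (@bc_counit _ _ C _ _ N).
  by split; [exact: bc_counit_linear|exact: bc_counit_lact].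
have cNB := rmapid_bijective (bm_right M) cN (bc_counit_bijective N Bff canB).
have lamB := lambda_bijective M Aff canA (bm_left N0).
have [_ al _ _] := alphaM.
have cRL := rmapid_linear (P := ext_rmod C A) cM; have cNL := rmapid_linear (P := bm_right M) cN.
have lamL := @lambda_linear _ _ C _ _ M (bm_left N0).
have e : (fun t => mul (rmap id coinv_alpha t)) =1
    (fun t => alpha (rmap id (@bc_counit _ _ C _ _ N) (lambda (N := M) (Q := bm_left N0) t))).
  apply: lambda_ext => [||a m n].
  - exact: (lin_comp mulL cRL).
  - exact: (lin_comp aL (lin_comp cNL lamL)).
  rewrite (rmapidE cM) mulE coinv_alphaE lambdaE (rmapidE cN) bc_counitE.
  have [_ l1 _] := bm_lax N; rewrite l1 -[LHS]al; congr alpha.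
  exact: tens_lactE.
have B1 : bijective (rmap id coinv_alpha : rtens (ext_rmod C A) X ->
    rtens (ext_rmod C A) (reg_lmod A0)).
  have [i iK Ki] := bij_comp alphaB (bij_comp cNB lamB).
  exists (fun z => i (mul z)) => [t|z].
    by apply: etrans (congr1 i (e t)) _; exact: iK.
  by apply: (bij_inj mulB); apply: etrans (e _) _; exact: Ki.
have [ci ciK cK] := B1.
apply: inj_surj_bij.
  by apply/(ff_injective Aff cM); exact: (can_inj ciK).
by apply/(ff_surjective Aff cM) => y; exists (ci y); exact: cK.
Qed.
End CoinvariantMorita.

Section KStructures.
Variables (k : fieldType) (K H : hopfAlgType k) (j : hopf_emb K H) (C : hquot H).

Lemma restricts_comodalg (A : comodalg H) (rA : coinv_alg C A -> coinv_alg C A ⊗ K) :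
  restricts_coact j (X := ca_comod A) rA -> is_comodalg rA.
Proof.
move=> rP; have [_ c1 cM] := ca_ax A.
have vL : linear (fun x : coinv_alg C A => val x : A) := @val_linear _ _ C (via C (ca_comod A)).
split; first exact: restricts_comodule rP.
  apply: (@kmap_val_inj _ _ _ j C (ca_comod A)).
  have jL := he_linear j.
  rewrite [LHS]rP; apply: etrans c1 (esym _).
  by apply: etrans (kmapE vL jL 𝟙 𝟙) _; rewrite he1.
move=> a b.
exact: (restricts_mul (X := ca_comod A) (Y := ca_comod A) (Z := ca_comod A)
  (@amul_bilin _ A) (@amul_bilin _ (coinv_alg C A)) cM (fun _ _ => erefl) rP rP rP).
Qed.

Section Bicomod.
Variables (A B : comodalg H) (M : bicomod A B).
Notation A0 := (coinv_alg C A).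
Notation B0 := (coinv_alg C B).
Notation M0 := (coinv_bimod C M).
Variables (rA : A0 -> A0 ⊗ K) (rB : B0 -> B0 ⊗ K) (rM : M0 -> M0 ⊗ K).
Hypotheses (hA : is_comodalg rA) (hB : is_comodalg rB).
Hypothesis rAP : restricts_coact j (X := ca_comod A) rA.
Hypothesis rBP : restricts_coact j (X := ca_comod B) rB.
Hypothesis rMP : restricts_coact j (X := bc_comod M) rM.

Lemma restricts_bicomod : is_bicomod (A := Comodalg hA) (B := Comodalg hB) rM.
Proof.
split; first exact: restricts_comodule rMP.
  exact: (restricts_mul (X := ca_comod A) (Y := bc_comod M) (Z := bc_comod M)
    (@bm_lact_bilin _ _ _ M) (@bm_lact_bilin _ _ _ M0) (bc_lcoact (M := M))
    (fun _ _ => erefl) rAP rMP rMP).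
exact: (restricts_mul (X := bc_comod M) (Y := ca_comod B) (Z := bc_comod M)
  (@bm_ract_bilin _ _ _ M) (@bm_ract_bilin _ _ _ M0) (bc_rcoact (M := M))
  (fun _ _ => erefl) rMP rBP rMP).
Qed.
End Bicomod.

Section Alpha.
Variables (A B : comodalg H) (M : bicomod A B) (N : bicomod B A).
Notation A0 := (coinv_alg C A).
Notation B0 := (coinv_alg C B).
Notation M0 := (coinv_bimod C M).
Notation N0 := (coinv_bimod C N).
Variables (rA : A0 -> A0 ⊗ K) (rB : B0 -> B0 ⊗ K) (rM : M0 -> M0 ⊗ K) (rN : N0 -> N0 ⊗ K).
Hypotheses (hA : is_comodalg rA) (hB : is_comodalg rB).
Hypothesis hM : is_bicomod (A := Comodalg hA) (B := Comodalg hB) rM.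
Hypothesis hN : is_bicomod (A := Comodalg hB) (B := Comodalg hA) rN.
Hypothesis rAP : restricts_coact j (X := ca_comod A) rA.
Hypothesis rMP : restricts_coact j (X := bc_comod M) rM.
Hypothesis rNP : restricts_coact j (X := bc_comod N) rN.
Variable alpha : tens_bc M N -> reg_bc A.
Hypothesis alphaM : bicomod_mor alpha.

Lemma coinv_alpha_mor :
  bicomod_mor (M := tens_bc (Bicomod hM) (Bicomod hN)) (N := reg_bc (Comodalg hA))
    (coinv_alpha (C := C) alphaM).
Proof.
have cL := coinv_alpha_linear (C := C) alphaM.
split=> //; [exact: coinv_alpha_lact|by move=> t a; exact: coinv_alpha_ract|].
have [tL _ _] := bc_cm (tens_bc (Bicomod hM) (Bicomod hN)).
have [[rL _ _] _ _] := hA.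
apply: tens_ext => [||m n].
- exact: (lin_comp rL cL).
- exact: (lin_comp (kmap_linear cL (@lin_id _ K)) tL).
have KB := amul_bilin (s := K).
have pB := pure_bilin (@ract _ _ (bm_right (Bicomod hM))) (@lact _ _ (bm_left (Bicomod hN))).
rewrite [bc_coact _ in RHS]tens_bc_coactE kmap_tprod //.
exact: (restricts_mul (X := bc_comod M) (Y := bc_comod N) (Z := ca_comod A)
  (alpha_pure_bilin alphaM) (lin_bilin cL pB) (alpha_coact alphaM)
  (coinv_alphaE (C := C) alphaM) rMP rNP rAP).
Qed.
End Alpha.
End KStructures.

(** * Hopf-Galois extensions and H/HK^+ *)
Section HopfSubalgebraQuotient.
Variables (k : fieldType) (K H : hopfAlgType k) (j : hopf_emb K H).
Notation C := (hbar_quot j).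

Lemma hbar_proj_emb (x : K) : hq_proj C (j x) = counit x *: hq_proj C 𝟙.
Proof. by have := hbar_projM j 𝟙 x; rewrite amul1l. Qed.

Lemma hbar_proj_ker (h : H) : hq_proj C h = 0 -> kspan (HKplus j) h.
Proof.
rewrite -(lin0 (hbar_proj_linear j)) => e.
by rewrite -[h]subr0; apply/qprojP.
Qed.

Hypothesis Sbij : bijective (antipode : H -> H).
Hypothesis Hff : left_faithfully_flat (res_lmod j).

(** The retraction of H onto K supplies the last condition of
    [ext_faithfully_flat], that ρ(s) is in A ⊗ K for s in A0. *)
Lemma galois_coalgebra_galois (A : comodalg H) : right_ff_galois A -> coalgebra_galois C A.
Proof.
move=> [Aff canB].
have canB' : bijective (@canV k H A (hquot_id H) (reg_lmod A)) by exact: canB.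
have canI := bij_inj canB'; have [gamma gammaP] := translation_exists canB'.
have [gammaK gammaKL gammaKE] := gammaK_exists hbar_proj_emb Aff canI gammaP.
have [p pL pP] := coinv_coact_retraction hbar_proj_ker Sbij Hff.
split; last exact: (canC_bijective hbar_proj_ker canI gammaP gammaKE).
apply: (ext_faithfully_flat Aff canI gammaP gammaKL gammaKE Hff) => s.
exists (kmap id p (ca_coact (val s))).
rewrite (kmap_comp _ (@lin_id _ A) (he_linear j) (@lin_id _ A) pL).
exact: (pP (ca_comod A) s).
Qed.
End HopfSubalgebraQuotient.

Theorem theorem7p4 (k : fieldType) (K H : hopfAlgType k) (j : hopf_emb K H)
    (A B : comodalg H) (M : bicomod A B) (N : bicomod B A)
    (c : morita_context M N) :
  let Hbar := hbar_quot j in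
  let A0 := coinv_alg Hbar A in
  let B0 := coinv_alg Hbar B in
  let M0 := coinv_bimod Hbar M in
  let N0 := coinv_bimod Hbar N in
  bijective (antipode : K -> K) -> bijective (antipode : H -> H) ->
  left_faithfully_flat (res_lmod j) ->
  right_ff_galois A -> right_ff_galois B -> strict c ->
  [/\ (exists (rA : A0 -> A0 ⊗ K) (hA : is_comodalg rA)
              (rB : B0 -> B0 ⊗ K) (hB : is_comodalg rB)
              (rM : M0 -> M0 ⊗ K)
              (hM : is_bicomod (A := Comodalg hA) (B := Comodalg hB) rM)
              (rN : N0 -> N0 ⊗ K)
              (hN : is_bicomod (A := Comodalg hB) (B := Comodalg hA) rN),
         [/\ restricts_coact j (X := ca_comod A) rA,
             restricts_coact j (X := ca_comod B) rB,
             restricts_coact j (X := bc_comod M) rM &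
             restricts_coact j (X := bc_comod N) rN] /\
         exists c0 : morita_context (Bicomod hM) (Bicomod hN), strict c0),
      inverse_equivalences (tens_dkF Hbar M) (tens_dkF Hbar N) &
      [/\ nat_iso (compF (coinvF Hbar B) (tens_dkF Hbar N))
                  (compF (tensF N0) (coinvF Hbar A)),
          nat_iso (compF (coinvF Hbar A) (tens_dkF Hbar M))
                  (compF (tensF M0) (coinvF Hbar B)),
          nat_iso (compF (tens_dkF Hbar N) (indF Hbar A))
                  (compF (indF Hbar B) (tensF N0)) &
          nat_iso (compF (tens_dkF Hbar M) (indF Hbar B))
                  (compF (indF Hbar A) (tensF M0))]].
Proof.
move=> Hbar A0 B0 M0 N0 _ Sbij Hff Agal Bgal [alphaI betaI].
have AC := galois_coalgebra_galois Sbij Hff Agal.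
have BC := galois_coalgebra_galois Sbij Hff Bgal.
have alphaB := is_iso_bijective alphaI; have betaB := is_iso_bijective betaI.
have alphaM := chom_ax (mc_alpha c); have betaM := chom_ax (mc_beta c).
split; last first.
- split; [exact: (coinv_tens_nat_iso N AC BC)|exact: (coinv_tens_nat_iso M BC AC)|
    exact: (tens_ind_nat_iso N BC)|exact: (tens_ind_nat_iso M AC)].
- split; [exact: (morita_nat_iso Hbar alphaM alphaB)|exact: (morita_nat_iso Hbar betaM betaB)].
have [p pL pP] := coinv_coact_retraction (hbar_proj_ker (j := j)) Sbij Hff.
have rex X := restricts_coact_exists (hbar_proj_emb j) pL pP X.
have [rA rAP] := rex (ca_comod A); have [rB rBP] := rex (ca_comod B).
have [rM rMP] := rex (bc_comod M); have [rN rNP] := rex (bc_comod N).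
have hA := restricts_comodalg rAP; have hB := restricts_comodalg rBP.
have hM := restricts_bicomod hA hB rAP rBP rMP.
have hN := restricts_bicomod hB hA rBP rAP rNP.
exists rA, hA, rB, hB, rM, hM, rN, hN; split=> //.
have aM := coinv_alpha_mor hM hN rAP rMP rNP alphaM.
have bM := coinv_alpha_mor hN hM rBP rNP rMP betaM.
unshelve eexists.
- apply: (@MoritaContext _ _ _ _ (Bicomod hM) (Bicomod hN) (CHom aM) (CHom bM)) => [m m' n|n n' m].
  + apply: val_inj; have eA := coinv_alphaE alphaM m n; have eB := coinv_alphaE betaM n m'.
    apply: etrans (congr1 (fun a : A => bm_lact a (val m' : M)) eA) _.
    apply: etrans (mc_alphaP c (val m) (val m') (val n)) (esym _).
    exact: (congr1 (fun b : B => bm_ract (val m : M) b) eB).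
  + apply: val_inj; have eB := coinv_alphaE betaM n m; have eA := coinv_alphaE alphaM m n'.
    apply: etrans (congr1 (fun b : B => bm_lact b (val n' : N)) eB) _.
    apply: etrans (mc_betaP c (val n) (val n') (val m)) (esym _).
    exact: (congr1 (fun a : A => bm_ract (val n : N) a) eA).
split; apply: bicomod_iso.
- exact: (coinv_alpha_bijective alphaM alphaB AC BC).
- exact: (coinv_alpha_bijective betaM betaB BC AC).
Qed.
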